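(* Let $m$ be a fully supported Radon measure on $\mathbb{R}$. Let $(\mathcal{E},\mathcal{F})$ and $(\mathfrak{E},\mathfrak{F})$ be two regular and strongly local Dirichlet forms on $L^2(\mathbb{R},m)$, with effective intervals $\{(I_n,\mathtt{s}_n):n\ge 1\}$ and $\{(\mathtt{I}_k,\mathfrak{s}_k):k\ge 1\}$ respectively, and let $\lambda_{\mathtt{s}}$ and $\lambda_{\mathfrak{s}}$ be the scale measures associated to $\{(I_n,\mathtt{s}_n)\}$ and $\{(\mathtt{I}_k,\mathfrak{s}_k)\}$ respectively. Then $(\mathfrak{E},\mathfrak{F})$ is a D-subspace of $(\mathcal{E},\mathcal{F})$ on $L^2(\mathbb{R},m)$ if and only if the following two conditions hold: (1) $\{\mathtt{I}_k:k\ge1\}$ is coarser than $\{I_n:n\ge1\}$, in the sense that for any $n$, $I_n\subset \mathtt{I}_k$ for some $k$; (2) $\lambda_{\mathfrak{s}}\ll\lambda_{\mathtt{s}}$ and $\dfrac{d\lambda_{\mathfrak{s}}}{d\lambda_{\mathtt{s}}}=0$ or $1$, $\lambda_{\mathtt{s}}$-a.e.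
   Context: $\langle a,b\rangle$ denotes an interval with endpoints $-\infty\le a<b\le\infty$, where each endpoint may or may not belong to it; intervals in $\mathbb{R}$ do not contain $\pm\infty$. For $J=\langle a,b\rangle$ fix the point $e\in J$: $e=(a+b)/2$ if both endpoints are finite, $e=a+1$ if only $a$ is finite, $e=b-1$ if only $b$ is finite, $e=0$ if $J=\mathbb{R}$. Let $\mathbf{S}(J)$ be the set of strictly increasing continuous functions $\mathtt{s}:J\to\mathbb{R}$ with $\mathtt{s}(e)=0$ (scale functions); put $\mathtt{s}(a)=\lim_{x\downarrow a}\mathtt{s}(x)$, $\mathtt{s}(b)=\lim_{x\uparrow b}\mathtt{s}(x)$, and let $d\mathtt{s}$ be the induced measure on $J$. Let $\mathbf{S}_\infty(J)$ be the set of $\mathtt{s}\in\mathbf{S}(J)$ adapted to $J$: $a\in J$ iff $a+\mathtt{s}(a)>-\infty$ (i.e. both $a$ and $\mathtt{s}(a)$ finite), and $b\in J$ iff $b+\mathtt{s}(b)<\infty$. For a function $u$ on $J$, $u\ll\mathtt{s}$ means $u=g\circ\mathtt{s}$ with $g$ (locally) absolutely continuous, and $\frac{du}{d\mathtt{s}}:=g'\circ\mathtt{s}$. For $\mathtt{s}\in\mathbf{S}_\infty(J)$ define $\mathcal{F}^{(\mathtt{s})}$ as the set of $u\in L^2(J,m|_J)$ with $u\ll\mathtt{s}$, $\frac{du}{d\mathtt{s}}\in L^2(J,d\mathtt{s})$, with $u(a)=0$ whenever ($a=-\infty$, $\mathtt{s}(-\infty)>-\infty$, $m((-\infty,0])<\infty$)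 and $u(b)=0$ whenever ($b=\infty$, $\mathtt{s}(\infty)<\infty$, $m([0,\infty))<\infty$) (values at infinite endpoints being limits), and $\mathcal{E}^{(\mathtt{s})}(u,v)=\frac12\int_J\frac{du}{d\mathtt{s}}\frac{dv}{d\mathtt{s}}\,d\mathtt{s}$. A class of effective intervals is an at most countable family $\{(I_n,\mathtt{s}_n):n\ge1\}$ of mutually disjoint intervals $I_n\subset\mathbb{R}$ with $\mathtt{s}_n\in\mathbf{S}_\infty(I_n)$. It represents the regular strongly local Dirichlet form on $L^2(\mathbb{R},m)$ given by $\mathcal{F}=\{u\in L^2(\mathbb{R},m): u|_{I_n}\in\mathcal{F}^{(\mathtt{s}_n)}\ \forall n,\ \sum_n\mathcal{E}^{(\mathtt{s}_n)}(u|_{I_n},u|_{I_n})<\infty\}$, $\mathcal{E}(u,v)=\sum_n\mathcal{E}^{(\mathtt{s}_n)}(u|_{I_n},v|_{I_n})$. It is a known theorem (Li–Ying) that every regular strongly local Dirichlet form on $L^2(\mathbb{R},m)$ is represented this way by a class of effective intervals, unique up to order; these are called its effective intervals. The scale measure associated to $\{(I_n,\mathtt{s}_n)\}$ is $\lambda_{\mathtt{s}}=\sum_n d\mathtt{s}_n$, a $\sigma$-finite measure on $\mathbb{R}$ (each $d\mathtt{s}_n$ extended by zero outside $I_n$). For regular Dirichlet forms $(\mathcal{E}^1,\mathcal{F}^1)$, $(\mathcal{E}^2,\mathcal{F}^2)$ on the same $L^2$ space, $(\mathcal{E}^1,\mathcal{F}^1)$ is a D-subspace (regular Dirichlet subspace)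 of $(\mathcal{E}^2,\mathcal{F}^2)$ if $\mathcal{F}^1\subset\mathcal{F}^2$ and $\mathcal{E}^2(u,v)=\mathcal{E}^1(u,v)$ for all $u,v\in\mathcal{F}^1$. *)

(* Defs.v *)
From HB Require Import structures.
From mathcomp Require Import all_boot all_order all_algebra.
From mathcomp Require Import all_classical all_reals all_analysis.
From mathcomp Require Import measurable_realfun.

Set Implicit Arguments.
Unset Strict Implicit.
Unset Printing Implicit Defensive.
Import Order.TTheory GRing.Theory Num.Theory.
Import numFieldNormedType.Exports.

Local Open Scope classical_set_scope.
Local Open Scope ring_scope.

Section Measures.
Context {R : realType}.
Notation borel := (measurableTypeR R).
Implicit Types mu nu : {measure set borel -> \bar R}.

(* On R, a Radon measure is a Borel measure that is finite on compact sets. *)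
Definition radon mu := forall K : set R, compact K -> (mu K < +oo)%E.

Definition fully_supported mu :=
  forall U : set R, open U -> U !=set0 -> (0 < mu U)%E.

Definition square_integrable mu (D : set R) (u : R -> R) :=
  measurable_fun D u /\
  (\int[mu]_(x in D) ((u x) ^+ 2)%:E < +oo)%E.

Definition L2dist2 mu (u v : R -> R) : R :=
  fine (\int[mu]_x ((u x - v x) ^+ 2)%:E).

(* The library's Radon-Nikodym derivative is defined for finite nu only, while
   scale measures are just sigma-finite. *)
Definition radon_nikodym_derivative nu mu (f : R -> \bar R) :=
  [/\ measurable_fun setT f, forall x, (0 <= f x)%E &
      forall A : set borel, measurable A -> nu A = \int[mu]_(x in A) f x]%E.

End Measures.

Section DirichletForms.
Context {R : realType}.
Notation borel := (measurableTypeR R).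

(* L2(R, m) is represented by the functions in [Lfun m 2]; [dom] is a set of
   such functions saturated under m-a.e. equality, and [form] is only
   meaningful on [dom]. *)
Record quad_form := QuadForm {
  dom : set (R -> R) ;
  form :> (R -> R) -> (R -> R) -> R }.

Context (m : {measure set borel -> \bar R}).
Implicit Types E : quad_form.

Definition norm1sq E (u : R -> R) : R := E u u + L2dist2 m u (cst 0).

Definition clip01 (u : R -> R) (x : R) : R := Num.min (Num.max (u x) 0) 1.

Record dirichlet_form E : Prop := DirichletForm {
  dom_L2 : forall u, dom E u -> u \in Lfun m 2%:E ;
  dom_ae : forall u v : R -> R, dom E u -> v \in Lfun m 2%:E ->
    (u = v %[ae m]) -> dom E v ;
  form_ae : forall u u' v, dom E u -> dom E u' -> dom E v ->
    (u = u' %[ae m]) -> E u v = E u' v ;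
  dom_linear : forall (a : R) u v, dom E u -> dom E v -> dom E (a *: u + v) ;
  dom_dense : forall u : R -> R, u \in Lfun m 2%:E ->
    forall e : R, 0 < e -> exists2 v, dom E v & L2dist2 m u v < e ;
  form_sym : forall u v, dom E u -> dom E v -> E u v = E v u ;
  form_linear : forall (a : R) u v w, dom E u -> dom E v -> dom E w ->
    E (a *: u + v) w = a * E u w + E v w ;
  form_ge0 : forall u, dom E u -> 0 <= E u u ;
  form_closed : forall u_ : nat -> R -> R, (forall n, dom E (u_ n)) ->
    (forall e : R, 0 < e -> exists N, forall p q, (N <= p)%N -> (N <= q)%N ->
       norm1sq E (u_ p - u_ q) < e) ->
    exists2 u, dom E u & norm1sq E (u_ n - u) @[n --> \oo] --> 0 ;
  form_markov : forall u, dom E u ->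
    dom E (clip01 u) /\ E (clip01 u) (clip01 u) <= E u u }.

Definition Cc (f : R -> R) :=
  continuous f /\ compact (closure [set x | f x != 0]).

Definition regular_dirichlet_form E :=
  [/\ dirichlet_form E,
      forall u, dom E u -> forall e : R, 0 < e ->
        exists v, [/\ dom E v, Cc v & norm1sq E (u - v) < e] &
      forall f, Cc f -> forall e : R, 0 < e ->
        exists v, [/\ dom E v, Cc v & forall x, `|f x - v x| < e]].

(* Support of the measure |u| dm. *)
Definition msupport (u : R -> R) : set R :=
  [set x | forall U : set R, nbhs x U -> ~ {ae m, forall y, U y -> u y = 0}].

Definition strongly_local E :=
  forall u v, dom E u -> dom E v ->
    compact (msupport u) -> compact (msupport v) ->
    (exists (U : set R) (c : R), [/\ open U, msupport u `<=` U &
       {ae m, forall y, U y -> v y = c}]) ->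
    E u v = 0.

Definition D_subspace E1 E2 :=
  [/\ regular_dirichlet_form E1, regular_dirichlet_form E2,
      dom E1 `<=` dom E2 &
      forall u v, dom E1 u -> dom E1 v -> E2 u v = E1 u v].

End DirichletForms.
Arguments quad_form : clear implicits.

Section ScaleFunctions.
Context {R : realType}.
Notation borel := (measurableTypeR R).

Definition base_point (J : interval R) : R :=
  match J with
  | Interval (BSide _ a) (BSide _ b) => (a + b) / 2
  | Interval (BSide _ a) (BInfty _) => a + 1
  | Interval (BInfty _) (BSide _ b) => b - 1
  | Interval (BInfty _) (BInfty _) => 0
  end.

Definition scale_function (J : interval R) (s : R -> R) :=
  [/\ {in J &, {homo s : x y / x < y}}, {within [set` J], continuous s} &
      s (base_point J) = 0].

(* A pair (J, s) with s in S(J); the values of s outside J are irrelevant. *)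
Record scaled_interval := ScaledInterval {
  sitv : interval R ;
  scale : R -> R ;
  sitv_lt : (ereal_of_itv_bound sitv.1 < ereal_of_itv_bound sitv.2)%E ;
  scaleP : scale_function sitv scale }.

Implicit Types J : scaled_interval.

Definition lend J : \bar R := ereal_of_itv_bound (sitv J).1.
Definition rend J : \bar R := ereal_of_itv_bound (sitv J).2.

Definition scale_lend J : \bar R :=
  match (sitv J).1 with
  | BSide _ a => lim ((scale J x)%:E @[x --> a^'+])
  | BInfty _ => lim ((scale J x)%:E @[x --> -oo])
  end.
Definition scale_rend J : \bar R :=
  match (sitv J).2 with
  | BSide _ b => lim ((scale J x)%:E @[x --> b^'-])
  | BInfty _ => lim ((scale J x)%:E @[x --> +oo])
  end.

Definition adapted J :=
  ((EFin @` [set` sitv J]) (lend J) <-> (-oo < lend J + scale_lend J)%E) /\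
  ((EFin @` [set` sitv J]) (rend J) <-> (rend J + scale_rend J < +oo)%E).

(* The measure ds, extended by zero outside J: as s is injective and
   continuous, it is the transport of Lebesgue measure on s(J) by the inverse
   of s; see [dscale_itv]. *)
Definition dscale J (A : set borel) : \bar R :=
  lebesgue_measure (scale J @` (A `&` [set` sitv J])).

Lemma scale_inj J : {in sitv J &, injective (scale J)}.
Proof.
have [h _ _] := scaleP J => x y xJ yJ sxy.
have [xy|yx|//] := ltgtP x y.
- by have := h x y xJ yJ xy; rewrite sxy ltxx.
- by have := h y x yJ xJ yx; rewrite sxy ltxx.
Qed.

Lemma scale_image_interval J (B : set R) : is_interval B ->
  is_interval (scale J @` (B `&` [set` sitv J])).
Proof.
move=> iB; apply/connected_intervalP/connected_continuous_connected.
  apply/connected_intervalP => x y [Bx Jx] [By Jy] z xzy; split.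
    exact: iB Bx By _ xzy.
  exact: (@interval_is_interval _ (sitv J)) Jx Jy _ xzy.
have [_ cs _] := scaleP J.
by apply: continuous_subspaceW cs => x [].
Qed.

Lemma measurable_scale_image J (A : set borel) : measurable A ->
  measurable (scale J @` (A `&` [set` sitv J]) : set borel).
Proof.
pose G := [set A : set borel |
  measurable (scale J @` (A `&` [set` sitv J]) : set borel)].
have GI (B : set R) : is_interval B -> G B.
  move=> iB; apply: (@is_interval_measurable R).
  exact: scale_image_interval.
have sG : sigma_algebra setT G.
  split.
  - by rewrite /G /= set0I image_set0; exact: measurable0.
  - move=> B GB.
    have GT : G setT by exact: GI.
    rewrite /G /=.
    have -> : scale J @` ((setT `\` B) `&` [set` sitv J]) =
        (scale J @` (setT `&` [set` sitv J])) `\`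
        (scale J @` (B `&` [set` sitv J])).
      apply/seteqP; split => [_ [x [[_ nBx] Jx] <-]|_ [[x [_ Jx] <-] nB]].
        split; first by exists x.
        by case=> y [By Jy] /(scale_inj Jy Jx) yx; apply: nBx; rewrite -yx.
      by exists x => //; split => //; split => // Bx; apply: nB; exists x.
    exact: measurableD GT GB.
  - move=> F GF; rewrite /G /= setI_bigcupl image_bigcup.
    exact: bigcupT_measurable.
have RG : @RGenOInfty.G R `<=` G.
  by move=> _ [x ->]; apply: GI; exact: interval_is_interval.
move=> mA; have : (@RGenOInfty.G R).-sigma.-measurable A.
  by rewrite -RGenOInfty.measurableE.
exact: (smallest_sub sG RG).
Qed.

Lemma dscale0 J : dscale J set0 = 0%E.
Proof. by rewrite /dscale set0I image_set0 measure0. Qed.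

Lemma dscale_ge0 J A : (0 <= dscale J A)%E.
Proof. exact: measure_ge0. Qed.

Lemma dscale_semi_sigma_additive J : semi_sigma_additive (dscale J).
Proof.
move=> F mF tF _; rewrite /dscale setI_bigcupl image_bigcup.
apply: (@measure_semi_sigma_additive _ _ _ (@lebesgue_measure R)).
- by move=> n; exact: measurable_scale_image.
- apply/trivIsetP => i j _ _ ij; rewrite -subset0 => _ [[x [Fx Jx] <-]].
  case=> y [Fy Jy] /(scale_inj Jy Jx) xy.
  have /trivIsetP /(_ i j Logic.I Logic.I ij) := tF.
  by rewrite -subset0 => /(_ x); apply; split => //; rewrite -xy.
- by apply: bigcupT_measurable => n; exact: measurable_scale_image.
Qed.

HB.instance Definition _ J := isMeasure.Build _ _ _ (dscale J)
  (dscale0 J) (@dscale_ge0 J) (@dscale_semi_sigma_additive J).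

Lemma dscale_itv J (x y : R) : x \in sitv J -> y \in sitv J -> x <= y ->
  dscale J `[x, y] = (scale J y - scale J x)%:E.
Proof.
have [h cs _] := scaleP J => xJ yJ xy; rewrite /dscale.
have subJ : `[x, y] `<=` [set` sitv J].
  by move=> z /=; rewrite in_itv /= => xzy;
    exact: (@interval_is_interval _ (sitv J)) xJ yJ _ xzy.
have hle : {in sitv J &, {homo scale J : u v / u <= v}}.
  by move=> u v uJ vJ; rewrite le_eqVlt => /predU1P[->//|/(h u v uJ vJ)/ltW].
have -> : scale J @` (`[x, y] `&` [set` sitv J]) =
    `[scale J x, scale J y]%classic.
  rewrite setIidl//; apply/seteqP; split => [_ [z zxy <-]|z /=].
    have zJ := subJ _ zxy; move: zxy => /=; rewrite !in_itv /= => /andP[xz zy].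
    by rewrite !hle.
  rewrite in_itv/= => szs.
  have [|c cxy <-] := @IVT _ (scale J) x y z xy (continuous_subspaceW subJ cs).
    by rewrite min_l ?max_r ?hle//.
  by exists c.
rewrite lebesgue_measure_itv /= lte_fin.
have [_|yx] := ltP (scale J x) (scale J y); first by rewrite EFinB.
have /eqP -> : scale J x == scale J y by rewrite eq_le yx hle.
by rewrite subrr.
Qed.

Definition abs_continuous_on (c d : R) (g : R -> R) :=
  forall e : R, 0 < e -> exists2 delta : R, 0 < delta &
    forall (n : nat) (l r : 'I_n -> R),
      (forall i, [/\ c <= l i, l i <= r i & r i <= d]) ->
      trivIset setT (fun i => `]l i, r i[%classic) ->
      \sum_(i < n) (r i - l i) < delta ->
      \sum_(i < n) `|g (r i) - g (l i)| < e.

Definition locally_abs_continuous (K : set R) (g : R -> R) :=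
  forall c d, `[c, d] `<=` K -> abs_continuous_on c d g.

(* u << s on J *)
Definition scale_abs_continuous J (u : R -> R) :=
  exists2 g, locally_abs_continuous (scale J @` [set` sitv J]) g &
    {in sitv J, u =1 g \o scale J}.

Definition scale_inv J (y : R) : R :=
  xget 0 [set x | x \in sitv J /\ scale J x = y].

(* du/ds = g' \o s, where g = u \o s^-1 on s(J). The values of g outside s(J)
   can only affect g' at the endpoints of s(J), which are ds-null. *)
Definition scale_derive J (u : R -> R) : R -> R :=
  derive1 (u \o scale_inv J) \o scale J.

Definition scale_energy J (u v : R -> R) : \bar R :=
  (2^-1%:E * \int[dscale J]_(x in [set` sitv J])
    (scale_derive J u x * scale_derive J v x)%:E)%E.

Definition scale_dom (m : {measure set borel -> \bar R}) J : set (R -> R) :=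
  [set u | [/\ square_integrable m [set` sitv J] u,
    scale_abs_continuous J u,
    square_integrable (dscale J) [set` sitv J] (scale_derive J u),
    lend J = -oo%E -> (-oo < scale_lend J)%E -> (m `]-oo, 0%R]%classic < +oo)%E ->
      u x @[x --> -oo] --> 0 &
    rend J = +oo%E -> (scale_rend J < +oo)%E -> (m `[0%R, +oo[%classic < +oo)%E ->
      u x @[x --> +oo] --> 0]].

End ScaleFunctions.
Arguments scaled_interval : clear implicits.

Section EffectiveIntervals.
Context {R : realType}.
Notation borel := (measurableTypeR R).

(* An at most countable family {(I_n, s_n)}, indexed by a set of naturals; the
   pairs of index outside [index] play no role. *)
Record interval_family := IntervalFamily {
  index : set nat ;
  member :> nat -> scaled_interval R }.

Implicit Types I : interval_family.

Definition effective_intervals I :=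
  trivIset (index I) (fun n => [set` sitv (I n)]) /\
  forall n, index I n -> adapted (I n).

Definition family_energy I (u v : R -> R) : \bar R :=
  (\sum_(0 <= n <oo | n \in index I) scale_energy (I n) u v)%E.

Context (m : {measure set borel -> \bar R}).

(* The functions u (not classes) that are on each I_n the good version, namely
   the continuous one; they exist in each class of the domain as the I_n are
   disjoint. *)
Definition family_dom I : set (R -> R) :=
  [set u | [/\ u \in Lfun m 2%:E,
    forall n, index I n -> scale_dom m (I n) u &
    (family_energy I u u < +oo)%E]].

Definition represents I (E : quad_form R) :=
  (forall u : R -> R, dom E u <-> (u \in Lfun m 2%:E /\
     exists2 v, family_dom I v & u = v %[ae m])) /\
  (forall u v, family_dom I u -> family_dom I v ->
     (E u v)%:E = family_energy I u v).

Definition dscale_or0 I (n : nat) : {measure set borel -> \bar R} :=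
  if n \in index I then (dscale (I n) : {measure set borel -> \bar R})
  else (mzero : {measure set borel -> \bar R}).

Definition scale_measure I : {measure set borel -> \bar R} :=
  mseries (dscale_or0 I) 0.

Definition coarser (I' I : interval_family) :=
  forall n, index I n -> exists2 k, index I' k &
    [set` sitv (I n)] `<=` [set` sitv (I' k)].

End EffectiveIntervals.
Arguments interval_family : clear implicits.

(* Main.v *)
Require Import Defs.
From HB Require Import structures.
From mathcomp Require Import all_boot all_order all_algebra.
From mathcomp Require Import all_classical all_reals all_analysis.
From mathcomp Require Import measurable_realfun ring lra.

(** In this file I and s refer to the family and scales of the form E, and I' and
    s' to those of E'. By polarization, E' is a D-subspace of E if and only if
    every function u of finite energy along I' has a version of finite energy
    along I, with the same energy ([D_subspace_family]). Energies are integrals of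
    (du/ds)^2 against the scale measure ([family_energyE]).

    Suppose that the scale measure of I' is that of I restricted to a set A, and
    that each I_n lies in an interval J' of I'. On I_n the function
    phi = s' \o s^-1 is increasing and 1-Lipschitz, so that a function
    u = g \o s' = (g \o phi) \o s is also absolutely continuous along s. By
    Lebesgue's differentiation theorem phi' is almost everywhere the indicator of A
    ([is_derive_density]). Where phi' = 1 we have du/ds = du/ds'
    ([derive1_comp_unit_speed]). Outside A, which s' maps to a null set, du/ds = 0
    by Lusin's property (N) of the absolutely continuous function g
    ([null_scale_derive]). Hence du/ds is the indicator of A times du/ds', and the
    energies agree ([family_energy_density]).

    Conversely, let E' be a D-subspace of E. The domain of E' contains functions
    that jump at the endpoints of the intervals of I', while those of E are
    continuous inside each I_n: the interior of I_n is therefore contained in a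
    single J' ([inner_inclusion]). Next, consider a tent, that is a function
    with slope 1 along s' on an interval, slope -1 on another interval of the same
    height, and slope 0 elsewhere. Equating its two energies expresses the s' mass
    of the two intervals as the integral of (ds'/ds)^2 over them
    ([speed_slopes]); playing with three intervals, one gets this for each interval
    separately, so that (ds'/ds)^2 is the density f of the scale measure of I' with
    respect to that of I ([scale_measure_speed]). But a density f of ds' with
    respect to ds is equal to ds'/ds almost everywhere. Thus f = f^2, and f is 0 or
    1 ([ae_speed01]). In particular ds' <= ds, so that s' is finite at the endpoints
    where s is, and adaptedness of the intervals extends the inclusion of interiors
    to the endpoints ([necessarily_coarser]). *)

Set Implicit Arguments.
Unset Strict Implicit.
Unset Printing Implicit Defensive.
Import Order.TTheory GRing.Theory Num.Theory.
Import numFieldNormedType.Exports.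
(* Imported again because the names dscale and index have since been shadowed. *)
Import Defs.
Local Open Scope classical_set_scope.
Local Open Scope ring_scope.

(** * Derivatives of real functions *)

Section Derivatives.
Context {R : realType}.
Implicit Types f g : R -> R.

Lemma derive1_nonderivable f x : ~ derivable f x 1 -> derive1 f x = 0.
Proof. by rewrite derive1E /derive /derivable => /dvgP. Qed.

Lemma near_eq_derive1 f g x : (\near x, f x = g x) -> derive1 f x = derive1 g x.
Proof. by rewrite !derive1E; exact: near_eq_derive. Qed.

Lemma is_derive_derive1 f (x : R) : derivable f x 1 -> is_derive x 1 f (derive1 f x).
Proof. by rewrite derive1E => /derivableP. Qed.

Lemma is_derive1_derive1 f (x l : R) : is_derive x 1 f l -> derive1 f x = l.
Proof. by rewrite derive1E => -[]. Qed.

Lemma derive1_csub (c : R) f x : derive1 (fun y => c - f y) x = - derive1 f x.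
Proof.
have [/is_derive_derive1 df|nfx] := pselect (derivable f x 1).
  apply: is_derive1_derive1.
  by rewrite -[X in is_derive _ _ _ X]add0r; apply: is_deriveB.
rewrite (derive1_nonderivable nfx) oppr0.
apply: derive1_nonderivable => ncf; apply: nfx.
have -> : f = (fun y => c - (c - f y)).
  by apply/funext => y; rewrite opprB addrC subrK.
exact: derivableB.
Qed.

Lemma derive1_subc (c : R) f x : derive1 (fun y => f y - c) x = derive1 f x.
Proof.
have [/is_derive_derive1 df|nfx] := pselect (derivable f x 1).
  apply: is_derive1_derive1.
  by rewrite -[X in is_derive _ _ _ X]subr0; apply: is_deriveB.
rewrite (derive1_nonderivable nfx).
apply: derive1_nonderivable => ncf; apply: nfx.
have -> : f = (fun y => (f y - c) + c).
  by apply/funext => y; rewrite subrK.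
exact: derivableD.
Qed.

(** Since phi has a local inverse of slope 1 as well, G is derivable at phi t
    exactly when G \o phi is derivable at t; the equality thus also holds when
    both derivatives take the default value 0. *)
Lemma derive1_comp_unit_speed (G phi psi : R -> R) (t : R) :
  (\forall z \near t, psi (phi z) = z) ->
  (\forall y \near phi t, phi (psi y) = y) ->
  {near t, continuous phi} -> is_derive t 1 phi 1 ->
  derive1 (G \o phi) t = derive1 G (phi t).
Proof.
move=> psiK phiK cphi dphi.
have psit : psi (phi t) = t by exact: nbhs_singleton psiK.
have dpsi : is_derive (phi t) 1 psi 1.
  rewrite -[X in is_derive _ _ _ X]invr1.
  by apply: (is_derive_inverse psiK cphi) => //; exact: oner_neq0.
have [GD|nGD] := pselect (derivable G (phi t) 1).
  have dG := is_derive_derive1 GD.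
  by have /is_derive1_derive1-> := is_derive1_comp dG dphi; rewrite mulr1.
rewrite (derive1_nonderivable nGD).
apply: derive1_nonderivable => nGphi; apply: nGD.
have := is_derive_derive1 nGphi; rewrite -{1}psit => dGphi.
have := is_derive1_comp dGphi dpsi => /@ex_derive.
by apply: near_eq_derivable; near=> y; rewrite /= (near phiK).
Unshelve. all: by end_near. Qed.

(** By continuity of f this is a closed condition on the point, and being
    derivable on U is a countable combination of such conditions. *)
Let cauchy_quotients (U : set R) f (d e : R) := [set x |
  (forall y, `|y - x| < d -> U y) /\
  forall h k, 0 < `|h| < d -> 0 < `|k| < d ->
    `|h^-1 * (f (h + x) - f x) - k^-1 * (f (k + x) - f x)| <= e].

Let closed_cauchy_quotients (U : set R) f (d e : R) :
  {in U, continuous f} -> 0 < d -> closed (cauchy_quotients U f d e).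
Proof.
move=> cf d0; rewrite -[X in closed X]setCK; apply: open_closedC.
rewrite openE => x /= /not_andP[/existsNP[y /not_implyP[yx Uy]]|].
  have : \forall z \near x, `|y - z| < d.
    have cz : (fun z => `|y - z|) @ x --> `|y - x|.
      by apply: cvg_norm; apply: cvgB; [exact: cvg_cst|exact: cvg_id].
    exact: (cvgr_lt _ cz).
  by apply: filterS => z yz [/(_ y yz)].
move=> /existsNP[h /existsNP[k /not_implyP[hd /not_implyP[kd /negP]]]].
rewrite -ltNge => ltq.
have [xU|] := pselect (forall y, `|y - x| < d -> U y); last first.
  move=> /existsNP[y /not_implyP[yx Uy]].
  have : \forall z \near x, `|y - z| < d.
    have cz : (fun z => `|y - z|) @ x --> `|y - x|.
      by apply: cvg_norm; apply: cvgB; [exact: cvg_cst|exact: cvg_id].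
    exact: (cvgr_lt _ cz).
  by apply: filterS => z yz [/(_ y yz)].
have cx l : `|l| < d -> (fun z => f (l + z)) @ x --> f (l + x).
  move=> ld; apply: (@cvg_comp _ _ _ (fun z => l + z) f _ (nbhs (l + x))).
    by apply: cvgD; [exact: cvg_cst|exact: cvg_id].
  by apply: cf; rewrite inE; apply: xU; rewrite addrK.
have c0 : f z @[z --> x] --> f x.
  by apply: cf; rewrite inE; apply: xU; rewrite subrr normr0.
have cq : (fun z => `|h^-1 * (f (h + z) - f z) - k^-1 * (f (k + z) - f z)|) @ x -->
    `|h^-1 * (f (h + x) - f x) - k^-1 * (f (k + x) - f x)|.
  apply: cvg_norm; apply: cvgB.
    apply: cvgM; first exact: cvg_cst.
    by apply: cvgB => //; apply: cx; case/andP: hd.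
  apply: cvgM; first exact: cvg_cst.
  by apply: cvgB => //; apply: cx; case/andP: kd.
have : \forall z \near x,
    e < `|h^-1 * (f (h + z) - f z) - k^-1 * (f (k + z) - f z)|.
  exact: cvgr_gt _ cq _ ltq.
by apply: filterS => z ltz [_ /(_ h k hd kd)]; rewrite leNgt ltz.
Qed.

Let near0_ball (P : R -> Prop) : (\forall h \near 0^', P h) ->
  exists2 d : R, 0 < d & forall h, 0 < `|h| < d -> P h.
Proof.
move=> /nbhs_ballP[d /= d0 dP]; exists d => // h /andP[h0 hd].
by apply: dP; [rewrite /ball /= sub0r normrN|rewrite -normr_gt0].
Qed.

Let derivable_cauchy_quotients (U : set R) f : open U ->
  [set x | U x /\ derivable f x 1] =
  \bigcap_j \bigcup_i cauchy_quotients U f i.+1%:R^-1 j.+1%:R^-1.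
Proof.
move=> oU; apply/seteqP; split => [x [Ux]|x fx].
  rewrite /derivable => /cvg_ex[l /= fl] j _.
  have e0 : 0 < j.+1%:R^-1 / 2 :> R by rewrite divr_gt0.
  have /cvgrPdist_lt/(_ _ e0)/near0_ball[d d0 dfl] := fl.
  have [r /= r0 rU] : exists2 r : R, 0 < r & ball x r `<=` U.
    by apply/nbhs_ballP; exact: open_nbhs_nbhs.
  have [i ilt] : exists i, i.+1%:R^-1 < Num.min d r.
    have m0 : 0 < Num.min d r by rewrite lt_min d0 r0.
    by have [i _ /(_ i (leqnn i))] := near_infty_natSinv_lt (PosNum m0); exists i.
  move: ilt; rewrite lt_min => /andP[id ir].
  exists i => //; split => [y yx|h k].
    by apply: rU; rewrite /ball /= distrC (lt_trans yx).
  move=> /andP[h0 hi] /andP[k0 ki].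
  have Hh : 0 < `|h| < d by rewrite h0 (lt_trans hi).
  have Hk : 0 < `|k| < d by rewrite k0 (lt_trans ki).
  have := dfl h Hh; have := dfl k Hk.
  rewrite [h *: 1]mulr1 [k *: 1]mulr1.
  set a := _ *: _; set b := _ *: _ => la lb.
  rewrite -[_ * (f (h + x) - _)]/b -[_ * (f (k + x) - _)]/a.
  have -> : b - a = (l - a) - (l - b) by ring.
  by rewrite (le_trans (ler_normB _ _))// (splitr (j.+1%:R^-1)) lerD// ltW.
split.
  have [i _ [+ _]] := fx 0%N Logic.I.
  by apply; rewrite subrr normr0 invr_gt0.
apply/cauchy_cvgP/cauchy_exP => e e0.
have [j jlt] : exists j, j.+1%:R^-1 < e.
  by have [j _ /(_ j (leqnn j))] := near_infty_natSinv_lt (PosNum e0); exists j.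
have [i _ [_ fij]] := fx j Logic.I.
pose h0 : R := i.+2%:R^-1.
have h0i : 0 < `|h0| < i.+1%:R^-1.
  have h00 : 0 < h0 by rewrite invr_gt0.
  rewrite gtr0_norm// h00 /= /h0.
  rewrite ltf_pV2 ?posrE//.
  rewrite ltr_nat.
  by [].
exists (h0^-1 *: ((f \o shift x) (h0 *: 1) - f x)).
have : \forall h \near 0^', `|h : R| < i.+1%:R^-1 /\ h != 0.
  near=> h; split.
    by near: h; apply: dnbhs0_lt; rewrite invr_gt0.
  by near: h; exact: nbhs_dnbhs_neq.
apply: filterS => h [hi hn0]; rewrite /ball /= (le_lt_trans _ jlt)//.
have := fij h0 h h0i; rewrite normr_gt0 hn0 hi => /(_ isT).
by rewrite [h *: 1]mulr1 [h0 *: 1]mulr1.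
Unshelve. all: by end_near. Qed.

(** On the Borel set where f is derivable, the derivative is a limit of
    difference quotients along a fixed sequence of steps; elsewhere it is 0. *)
Lemma measurable_derive1 (U : set (measurableTypeR R)) f :
  open (U : set R) -> {in U, continuous f} -> measurable_fun U (derive1 f).
Proof.
move=> oU cf.
pose D := [set x | U x /\ derivable f x 1].
have mU : measurable U by exact: open_measurable.
have mD : measurable (D : set (measurableTypeR R)).
  rewrite /D derivable_cauchy_quotients//; apply: bigcapT_measurable => j.
  apply: bigcupT_measurable => i; apply: closed_measurable.
  by apply: closed_cauchy_quotients => //; rewrite invr_gt0.
have -> : U = D `|` (U `\` D).
  by rewrite setUDr setDv setD0 setUidr// => x [].
apply/measurable_funU; [by []|exact: measurableD|]; split; last first.
  apply: (@eq_measurable_fun _ _ _ _ _ (cst (0:R))); last exact: measurable_cst.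
  move=> x; rewrite inE => -[Ux nD]; rewrite derive1_nonderivable// => fx.
  exact: nD.
pose g : R -> R := f \_ U.
have mg : measurable_fun [set: measurableTypeR R] (g : measurableTypeR R -> R).
  apply/(measurable_restrictT _ _).1 => //.
  by apply: open_continuous_measurable_fun => // x xU; apply: cf.
pose h_ n (x : measurableTypeR R) : R := n.+1%:R * (g (n.+1%:R^-1 + x) - g x).
apply: (@measurable_fun_cvg _ _ _ _ h_) => [n|x [Ux fx]].
  apply: measurable_funTS; apply: measurable_funM => //.
  apply: measurable_funB => //; apply: measurableT_comp => //.
  exact: measurable_funD.
have dfx : h^-1 *: (f (h + x) - f x) @[h --> 0^'] --> derive1 f x.
  move: fx; rewrite /derivable /derive1 => /cvg_ex[l fl].
  apply/cvg_ex; exists l; apply: cvg_trans fl; apply: near_eq_cvg.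
  by apply: nearW => h /=; rewrite [h *: 1]mulr1.
have inv0 : (fun n : nat => n.+1%:R^-1 : R) @ \oo --> 0^'.
  move=> A /near0_ball[d d0 dA]; have := near_infty_natSinv_lt (PosNum d0).
  apply: filterS => n nd; apply: dA.
  by rewrite gtr0_norm ?invr_gt0// nd andbT.
have [r /= r0 rU] : exists2 r : R, 0 < r & ball x r `<=` U.
  by apply/nbhs_ballP; exact: open_nbhs_nbhs.
have := cvg_comp _ _ inv0 dfx; apply: cvg_trans; apply: near_eq_cvg.
near=> n; rewrite /h_ /= invrK /g !patchE ifT; last first.
  rewrite inE; apply: rU; rewrite /ball /= opprD addrCA subrr addr0 normrN.
  rewrite gtr0_norm ?invr_gt0//.
  by near: n; exact: (near_infty_natSinv_lt (PosNum r0)).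
by rewrite mem_set.
Unshelve. all: by end_near. Qed.

End Derivatives.

(** * Images of null sets *)

Section NullImage.
Context {R : realType}.

Let compact_thickening (W U : set R) : compact W -> open U -> W `<=` U ->
  exists2 r : R, 0 < r & forall y z, W y -> `|z - y| < r -> U z.
Proof.
move=> /compact_near_coveringP cW oU WU.
pose P (r x : R) := forall z, `|z - x| < r -> U z.
have r0P : \forall r \near 0^'+, W `<=` P r.
  apply: cW => x Wx.
  have /nbhs_ballP[d /= d0 dU] : nbhs x U.
    by apply: open_nbhs_nbhs; split => //; exact: WU.
  exists (ball x (d / 2), [set r | r < d / 2]) => /=; first split.
  - by apply: nbhsx_ballx; rewrite divr_gt0.
  - by apply: nbhs_right_lt; rewrite divr_gt0.
  move=> [y r] /= [xy rd] z zy; apply: dU; rewrite /ball /= distrC.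
  rewrite (le_lt_trans (ler_distD y _ _))// (splitr d) ltrD//.
    exact: lt_trans rd.
  by rewrite distrC.
have /filter_ex[r [r0 rP]] : \forall r \near 0^'+, 0 < r /\ W `<=` P r.
  apply: filterI; first exact: nbhs_right_gt.
  exact: r0P.
by exists r => // y z Wy; exact: rP.
Qed.

Let exists_cell (c w y : R) n : c <= y <= c + n.+1%:R * w ->
  exists2 i, (i < n.+1)%N & c + i%:R * w <= y <= c + i.+1%:R * w.
Proof.
elim: n => [|n IHn] /andP[cy yc].
  by exists 0%N => //; rewrite mul0r addr0 cy.
have [yn|ny] := leP y (c + n.+1%:R * w).
  have [|i ni yi] := IHn; first by rewrite cy yn.
  by exists i => //; exact: leq_trans ni _.
by exists n.+1 => //; rewrite (ltW ny) yc.
Qed.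

Let compact_extrema (W : set R) : compact W -> W !=set0 ->
  exists l r, [/\ W l, W r & forall y, W y -> l <= y <= r].
Proof.
move=> cW W0.
have cid : {within W, continuous (id : R -> R)}.
  by apply: continuous_subspaceT => x; exact: cvg_id.
have [l lW lP] := compact_EVT_min W0 cW cid.
have [r rW rP] := compact_EVT_max W0 cW cid.
exists l, r; rewrite !inE in lW rW; split => // y Wy.
by rewrite lP ?rP// inE.
Qed.

(** Lusin's property (N), for a map psi whose increments on W are dominated by
    those of g. Take an open neighbourhood of W whose measure is below the
    modulus given by absolute continuity, and a grid so fine that the cells
    meeting W lie in that neighbourhood: the extreme points of W in each cell
    are the endpoints of disjoint intervals of small total length, so that the
    increments of g between them, hence the lengths of the images by psi of the
    cells, have a small sum. *)
Lemma lebesgue_measure_dominated_image0 (c d k : R) (g psi : R -> R)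
    (W : set R) :
  abs_continuous_on c d g -> compact W -> W `<=` `[c, d] ->
  lebesgue_measure W = 0%E -> measurable (psi @` W : set (measurableTypeR R)) ->
  (forall y z, W y -> W z -> y <= z ->
     0 <= psi z - psi y <= k * `|g z - g y|) ->
  lebesgue_measure (psi @` W) = 0%E.
Proof.
move=> acg cW Wcd W0 mpW psig.
have [->|/set0P[y0 Wy0]] := eqVneq W set0; first by rewrite image_set0 measure0.
have cd : c <= d.
  by have := Wcd _ Wy0; rewrite /= in_itv /= => /andP[/le_trans]; apply.
apply/eqP; rewrite -measure_le0; apply/lee_addgt0Pr => e' e'0; rewrite add0e.
pose k' := Num.max k 1.
have k'0 : 0 < k' by rewrite lt_max ltr01 orbT.
have [delta d0 dP] := acg (e' / k') (divr_gt0 e'0 k'0).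
have mW : measurable (W : set (measurableTypeR R)) by exact: compact_measurable.
have WW : (lebesgue_measure W < +oo)%E by rewrite W0.
have [U [oU WU Ud]] := @lebesgue_regularity_outer R W delta mW WW d0.
have mU : measurable (U : set (measurableTypeR R)) by exact: open_measurable.
have {}Ud : (lebesgue_measure U < delta%:E)%E.
  by rewrite -(setDUK WU) measureU ?setDIK//= ?W0 ?add0e//; exact: measurableD.
have [eta eta0 etaU] := compact_thickening cW oU WU.
have [N Nw] : exists N, (d - c) / N.+1%:R < eta.
  have m0 : 0 < eta / (d - c + 1).
    by rewrite divr_gt0// ltr_wpDl// subr_ge0.
  have [N _ /(_ N (leqnn N)) /= Nlt] := near_infty_natSinv_lt (PosNum m0).
  exists N; rewrite (@le_lt_trans _ _ ((d - c + 1) * N.+1%:R^-1))//.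
    by rewrite ler_wpM2r// lerDl.
  by rewrite mulrC -ltr_pdivlMr// ltr_wpDl// subr_ge0.
pose w := (d - c) / N.+1%:R.
have w0 : 0 <= w by rewrite divr_ge0// subr_ge0.
pose cell i := `[c + i%:R * w, c + i.+1%:R * w]%classic.
have /choice[lr lrP] : forall i, exists p : R * R,
    [/\ c <= p.1, p.1 <= p.2, p.2 <= d,
      W `&` cell i `<=` `[p.1, p.2] &
      [/\ W p.1, W p.2, cell i p.1 & cell i p.2] \/
      p.1 = p.2 /\ W `&` cell i = set0].
  move=> i; have [Wi0|/set0P Wi] := eqVneq (W `&` cell i) set0.
    exists (c, c) => /=; split => //; last by right.
    by rewrite Wi0.
  have cWi : compact (W `&` cell i).
    by apply: compact_closedI => //; exact: itv_closed.
  have [l [r [[Wl il] [Wr ir] lrP]]] := compact_extrema cWi Wi.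
  exists (l, r) => /=; split; last by left.
  - by have := Wcd _ Wl; rewrite /= in_itv /= => /andP[].
  - by have /andP[] := lrP _ (conj Wr ir).
  - by have := Wcd _ Wr; rewrite /= in_itv /= => /andP[].
  - by move=> y /lrP; rewrite /= in_itv.
pose l i := (lr i).1; pose r i := (lr i).2.
have cell_l i y : cell i y -> c + i%:R * w <= y <= c + i.+1%:R * w.
  by rewrite /cell /= in_itv.
have cell_w i y z : cell i y -> cell i z -> z - y <= w.
  move=> /cell_l/andP[iy _] /cell_l/andP[_ iz].
  rewrite (le_trans (lerB iz iy))// -(natr1 i) mulrDl mul1r.
  by rewrite opprD addrACA subrr add0r addrAC subrr add0r.
have disj i j : (i < j)%N -> `]l i, r i[ `&` `]l j, r j[ = set0.
  move=> ij; have [_ _ _ _ [[_ _ _ ri]|[ei _]]] := lrP i; last first.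
    by rewrite /l /r ei set_itvoo0 set0I.
  have [_ _ _ _ [[_ _ lj _]|[ej _]]] := lrP j; last first.
    by rewrite {2}/l {2}/r ej set_itvoo0 setI0.
  rewrite -subset0 => z [/=]; rewrite !in_itv/= => /andP[_ zr] /andP[lz _].
  have := lt_trans lz zr; rewrite ltNge => /negP; apply.
  have /andP[_ /le_trans] := cell_l _ _ ri; apply.
  have /andP[+ _] := cell_l _ _ lj; apply: le_trans.
  by rewrite lerD2l ler_wpM2r// ler_nat.
have tlr : trivIset setT (fun i : 'I_N.+1 => `]l i, r i[%classic).
  apply/trivIsetP => i j _ _; rewrite neq_ltn => /orP[|] ij; first exact: disj.
  by rewrite setIC; exact: disj.
have sub_lr i : `]l i, r i[ `<=` U.
  have [_ _ _ _ [[Wl _ li ri]|[ei _]]] := lrP i; last first.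
    by rewrite /l /r ei set_itvoo0; exact: sub0set.
  move=> z /=; rewrite in_itv /= => /andP[lz zr]; apply: (etaU _ _ Wl).
  rewrite gtr0_norm ?subr_gt0//; apply: le_lt_trans Nw.
  by apply: le_trans (cell_w i _ _ li ri); rewrite lerB// ltW.
have lr_le i : l i <= r i by have [] := lrP i.
have sum_lr : \sum_(i < N.+1) (r i - l i) < delta.
  rewrite -lte_fin -sumEFin; apply: le_lt_trans Ud.
  rewrite (eq_bigr (fun i : 'I_N.+1 => lebesgue_measure `]l i, r i[%classic)).
    rewrite -measure_bigsetU_ord//; apply: le_measure; rewrite ?inE//.
      exact: bigsetU_measurable.
    by rewrite -bigcup_mkord_ord; apply: bigcup_sub => i _; exact: sub_lr.
  move=> i _; rewrite lebesgue_measure_itv/= lte_fin.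
  have := lr_le i; rewrite le_eqVlt => /predU1P[->|->].
    by rewrite ltxx subrr.
  by rewrite EFinB.
have lr_cd (i : 'I_N.+1) : [/\ c <= l i, l i <= r i & r i <= d] by have [] := lrP i.
have sum_g := dP N.+1 (fun i => l i) (fun i => r i) lr_cd tlr sum_lr.
have psi_lr i y : W y -> cell i y -> psi (l i) <= psi y <= psi (r i).
  move=> Wy iy; have [_ _ _ /(_ y (conj Wy iy))] := lrP i.
  rewrite /= in_itv/= => /andP[ly yr] [[Wl Wr _ _]|[_ i0]]; last first.
    by have : set0 y by rewrite -i0.
  by rewrite -subr_ge0 -[psi y <= _]subr_ge0; have /andP[-> _] := psig _ _ Wl Wy ly;
    have /andP[-> _] := psig _ _ Wy Wr yr.
apply: (@le_trans _ _ (\sum_(i < N.+1) lebesgue_measure `[psi (l i), psi (r i)]))%E.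
  have := @content_subadditive _ _ _ (@lebesgue_measure R) (psi @` W)
    (fun i => `[psi (l i), psi (r i)]%classic) N.+1; apply => //.
  move=> _ [y Wy <-]; have [i iN iy] : exists2 i, (i < N.+1)%N & cell i y.
    have [|i iN iy] := @exists_cell c w y N.
      have := Wcd _ Wy; rewrite /= in_itv /= => /andP[-> yd]/=.
      by rewrite /w mulrCA divff// mulr1 addrC subrK.
    by exists i => //; rewrite /cell /= in_itv.
  rewrite -(bigcup_mkord N.+1 (fun i => `[psi (l i), psi (r i)]%classic)); exists i => //=.
  by rewrite in_itv/=; exact: psi_lr.
apply: (@le_trans _ _ (\sum_(i < N.+1) (k' * `|g (r i) - g (l i)|)%:E))%E.
  apply: lee_sum => i _; rewrite lebesgue_measure_itv/= lte_fin.
  case: ifPn => _; last by rewrite lee_fin mulr_ge0// ltW.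
  have [_ _ _ _ [[Wl Wr _ _]|[ei _]]] := lrP i; last first.
    by rewrite /l /r ei subee// lee_fin mulr_ge0// ltW.
  have /andP[_] := psig _ _ Wl Wr (lr_le i); rewrite -EFinB lee_fin => /le_trans; apply.
  by rewrite ler_wpM2r// le_max lexx.
rewrite sumEFin lee_fin -mulr_sumr ltW// mulrC -ltr_pdivlMr//.
Qed.

End NullImage.

(** * Scaled intervals and their interiors *)

Section ScaledIntervals.
Context {R : realType}.
Notation borel := (measurableTypeR R).
Implicit Types (J : scaled_interval R) (x y : R) (u v : R -> R).

Definition inner J : set R := [set` sitv J]°.

Lemma open_inner J : open (inner J).
Proof. exact: open_interior. Qed.

Lemma near_inner J x : inner J x -> \forall y \near x, inner J y.
Proof. by move=> xJ; apply: open_nbhs_nbhs; split => //; exact: open_inner. Qed.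

Lemma inner_subset J : inner J `<=` [set` sitv J].
Proof. exact: interior_subset. Qed.

Lemma innerP J x :
  inner J x <-> exists a b, [/\ a \in sitv J, b \in sitv J & a < x < b].
Proof.
split=> [/nbhs_ballP[r /= r0 rJ]|[a [b [aJ bJ /andP[ax xb]]]]].
  have r20 : 0 < r / 2 by rewrite divr_gt0.
  exists (x - r / 2), (x + r / 2); split.
  - by apply: rJ; rewrite /ball /= opprB addrC subrK gtr0_norm//
      ltr_pdivrMr// ltr_pMr// ltr1n.
  - by apply: rJ; rewrite /ball /= opprD addNKr normrN gtr0_norm//
      ltr_pdivrMr// ltr_pMr// ltr1n.
  - by rewrite gtrBl ltrDl r20.
have : \forall z \near x, z \in `]a, b[ by apply: near_in_itvoo; rewrite in_itv /= ax.
apply: filterS => z /=; rewrite in_itv /= => /andP[az zb].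
by apply: (interval_is_interval aJ bJ); rewrite !ltW.
Qed.

Lemma inner_between J x y z : x \in sitv J -> y \in sitv J -> x < z < y -> inner J z.
Proof. by move=> xJ yJ xzy; apply/innerP; exists x, y. Qed.

Lemma inner_segment J x y : inner J x -> inner J y -> `[x, y] `<=` inner J.
Proof.
move=> /innerP[a [_ [aJ _ /andP[ax _]]]] /innerP[_ [b [_ bJ /andP[_ yb]]]] z /=.
rewrite in_itv /= => /andP[xz zy]; apply/innerP; exists a, b; split => //.
by rewrite (lt_le_trans ax)//= (le_lt_trans zy).
Qed.

Lemma sitv_segment J x y : x \in sitv J -> y \in sitv J ->
  `[x, y] `<=` [set` sitv J].
Proof.
by move=> xJ yJ z; rewrite /= in_itv/=; exact: interval_is_interval.
Qed.

Lemma inner_nonempty J : exists x y, [/\ x < y, inner J x & inner J y].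
Proof.
have [a [b [ab abJ]]] : exists a b : R, a < b /\ `]a, b[ `<=` [set` sitv J].
  have := sitv_lt J; case: (sitv J) => -[lb l|[]] [rb r|[]] //=; rewrite ?lte_fin => lr.
  - exists l, r; split => // z; rewrite /= !in_itv/= => /andP[lz zr].
    by case: lb; case: rb; rewrite /= ?lz ?zr ?(ltW lz) ?(ltW zr).
  - exists l, (l + 1); split; first by rewrite ltrDl.
    move=> z; rewrite /= !in_itv/= => /andP[lz _]; rewrite andbT.
    by case: lb; rewrite //= ltW.
  - exists (r - 1), r; split; first by rewrite gtrBl.
    move=> z; rewrite /= !in_itv/= => /andP[_ zr].
    by case: rb; rewrite //= ltW.
  - by exists 0, 1.
have nb z : a < z < b -> inner J z.
  move=> zab; have : \forall t \near z, t \in `]a, b[.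
    by apply: near_in_itvoo; rewrite in_itv.
  exact: filterS.
exists (a + (b - a) / 3), (a + (b - a) / 2).
by split; [lra|apply: nb; lra|apply: nb; lra].
Qed.

Lemma scale_lt J x y : x \in sitv J -> y \in sitv J ->
  (scale J x < scale J y) = (x < y).
Proof.
have [h _ _] := scaleP J => xJ yJ; have [xy|yx|->] := ltgtP x y; last by rewrite ltxx.
- by rewrite h.
- by apply/negbTE; rewrite -leNgt ltW// h.
Qed.

Lemma scale_le J x y : x \in sitv J -> y \in sitv J ->
  (scale J x <= scale J y) = (x <= y).
Proof. by move=> xJ yJ; rewrite !leNgt scale_lt. Qed.

Lemma scaleK J x : x \in sitv J -> scale_inv J (scale J x) = x.
Proof.
move=> xJ; rewrite /scale_inv; case: xgetP => [z _ [zJ]|/(_ x)[]//].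
exact: scale_inj.
Qed.

Lemma scale_invK J z : (scale J @` [set` sitv J]) z ->
  scale_inv J z \in sitv J /\ scale J (scale_inv J z) = z.
Proof. by move=> [x xJ <-]; rewrite scaleK. Qed.

Lemma scale_inv_out J z : ~ (scale J @` [set` sitv J]) z -> scale_inv J z = 0.
Proof.
move=> nz; rewrite /scale_inv; case: xgetP => // x _ [xJ xz]; case: nz.
by exists x.
Qed.

Lemma scale_image_segment J x y : x \in sitv J -> y \in sitv J -> x <= y ->
  scale J @` `[x, y] = `[scale J x, scale J y]%classic.
Proof.
move=> xJ yJ xy; have [_ cs _] := scaleP J.
apply/seteqP; split => [_ [z zxy <-]|z /=].
  have zJ := sitv_segment xJ yJ zxy; move: zxy => /=; rewrite !in_itv /=.
  by rewrite !scale_le.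
rewrite in_itv/= => szs.
have [|c cxy <-] := @IVT _ (scale J) x y z xy
  (continuous_subspaceW (sitv_segment xJ yJ) cs).
  by rewrite min_l ?max_r ?scale_le.
by exists c.
Qed.

Lemma scale_image_oo J x y : x \in sitv J -> y \in sitv J ->
  `]scale J x, scale J y[ `<=` scale J @` `]x, y[.
Proof.
move=> xJ yJ z zxy.
have [xy|yx] := leP x y; last first.
  move: zxy; rewrite /= in_itv /= => /andP[xz zy].
  by have := lt_trans xz zy; rewrite scale_lt// ltNge (ltW yx).
have : (scale J @` `[x, y]) z.
  by rewrite scale_image_segment//; exact: subset_itv_oo_cc zxy.
move=> [t txy tz]; exists t => //; have tJ := sitv_segment xJ yJ txy.
by move: zxy; rewrite /= !in_itv /= -tz !scale_lt.
Qed.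

Lemma continuous_scale J x : inner J x -> {for x, continuous (scale J)}.
Proof.
have [_ cs _] := scaleP J => xJ.
have := continuous_subspaceW (@inner_subset J) cs.
rewrite continuous_open_subspace; last exact: open_inner.
by move=> /(_ x); rewrite inE; exact.
Qed.

Lemma near_scale_invK J x : inner J x ->
  \forall z \near scale J x,
    inner J (scale_inv J z) /\ scale J (scale_inv J z) = z.
Proof.
move=> /innerP[a [b [aJ bJ axb]]].
have xJ : x \in sitv J by apply: inner_subset; exact: (inner_between aJ bJ).
have : \forall z \near scale J x, z \in `]scale J a, scale J b[.
  by apply: near_in_itvoo; rewrite in_itv /= !scale_lt.
apply: filterS => z /(scale_image_oo aJ bJ)[t].
rewrite /= in_itv /= => tab <-.
have tJ : inner J t by exact: (inner_between aJ bJ).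
by rewrite scaleK//; exact: inner_subset.
Qed.

Lemma continuous_scale_inv J x : inner J x ->
  {for scale J x, continuous (scale_inv J)}.
Proof.
move=> xJ; have xJ' := inner_subset xJ.
rewrite /prop_for /continuous_at scaleK//; move=> A.
move=> /nbhs_ballP[e /= e0 eA].
have /nbhs_ballP[r /= r0 rJ] := xJ.
pose d := Num.min (e / 2) (r / 2).
have d0 : 0 < d by rewrite lt_min !divr_gt0.
have de : d < e by rewrite gt_min ltr_pdivrMr// ltr_pMr// ltr1n.
have dr : d < r by rewrite gt_min orbC ltr_pdivrMr// ltr_pMr// ltr1n.
have aJ : x - d \in sitv J.
  by apply: rJ; rewrite /ball /= opprB addrC subrK gtr0_norm.
have bJ : x + d \in sitv J.
  by apply: rJ; rewrite /ball /= opprD addNKr normrN gtr0_norm.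
have : \forall z \near scale J x, z \in `]scale J (x - d), scale J (x + d)[.
  by apply: near_in_itvoo; rewrite in_itv /= !scale_lt// gtrBl ltrDl d0.
apply: filterS => z /(scale_image_oo aJ bJ)[t].
rewrite /= in_itv /= => /andP[dt td] <-.
rewrite scaleK; last by apply: (sitv_segment aJ bJ); rewrite /= in_itv /= !ltW.
by apply: eA; rewrite /ball /= ltr_norml; lra.
Qed.

Lemma open_scale_inner J : open (scale J @` inner J).
Proof.
rewrite openE => _ [x xJ <-]; have := near_scale_invK xJ.
by apply: filterS => z [zJ zE]; exists (scale_inv J z).
Qed.

Lemma measurable_sitv J : measurable ([set` sitv J] : set borel).
Proof. exact: measurable_itv. Qed.

Lemma measurable_inner J : measurable (inner J : set borel).
Proof. by apply: open_measurable; exact: open_inner. Qed.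

Lemma measurable_scale J : measurable_fun ([set` sitv J] : set borel) (scale J).
Proof.
have [_ cs _] := scaleP J.
by apply: subspace_continuous_measurable_fun => //; exact: measurable_sitv.
Qed.

Lemma measurable_scale_inv J :
  measurable_fun [set: borel] (scale_inv J : borel -> borel).
Proof.
have mSJ : measurable (scale J @` [set` sitv J] : set borel).
  by rewrite -[X in scale J @` X]setTI; exact: measurable_scale_image.
move=> _ A mA; rewrite setTI.
have -> : scale_inv J @^-1` A = (scale J @` (A `&` [set` sitv J])) `|`
    (~` (scale J @` [set` sitv J]) `&` [set _ | A 0]).
  apply/seteqP; split => z /=.
    move=> Az; have [zS|zS] := pselect ((scale J @` [set` sitv J]) z).
      by have [? ?] := scale_invK zS; left; exists (scale_inv J z).
    by right; split => //; rewrite -(scale_inv_out zS).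
  by move=> [[x [Ax xJ] <-]|[nz A0]]; [rewrite scaleK|rewrite scale_inv_out].
apply: measurableU; first exact: measurable_scale_image.
apply: measurableI; first exact: measurableC.
have [A0|nA0] := pselect (A 0).
  by rewrite (_ : [set _ | _] = setT)//; apply/seteqP; split.
by rewrite (_ : [set _ | _] = set0)//; apply/seteqP; split.
Qed.

Lemma lend_le J x : x \in sitv J -> (lend J <= x%:E)%E.
Proof.
rewrite /lend; case: (sitv J) => -[b a|b] c; rewrite itv_boundlr => /andP[ax xc] /=.
  by rewrite lee_fin; move: ax; case: b; rewrite bnd_simp// => /ltW.
by case: b ax => //= _; rewrite leNye.
Qed.

Lemma rend_ge J x : x \in sitv J -> (x%:E <= rend J)%E.
Proof.
rewrite /rend; case: (sitv J) => c -[b a|b]; rewrite itv_boundlr => /andP[cx ax] /=.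
  by rewrite lee_fin; move: ax; case: b; rewrite bnd_simp// => /ltW.
by case: b ax => //= _; rewrite leey.
Qed.

Lemma lendNy_closed J x y : lend J = -oo%E -> y \in sitv J -> x <= y -> x \in sitv J.
Proof.
rewrite /lend; case: (sitv J) => -[b a|[]] c //= _.
rewrite !itv_boundlr /= => yc xy.
by apply: le_trans yc; rewrite bnd_simp.
Qed.

Lemma rendy_closed J x y : rend J = +oo%E -> y \in sitv J -> y <= x -> x \in sitv J.
Proof.
rewrite /rend; case: (sitv J) => c -[b a|[]] //= _.
rewrite !itv_boundlr /= !andbT => cy yx.
by apply: le_trans cy _; rewrite bnd_simp.
Qed.

Lemma lend_eq J x y : ~ (x \in sitv J) -> x < y ->
  (forall t, x < t <= y -> t \in sitv J) -> lend J = x%:E.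
Proof.
move=> xJ xy tJ; have yJ : y \in sitv J by apply: tJ; rewrite xy lexx.
case lE : (lend J) => [a| |].
- congr EFin; apply/eqP; rewrite eq_le; apply/andP; split.
    apply/ler_addgt0Pr => e e0; pose t := Num.min (x + e) y.
    have /tJ/lend_le : x < t <= y by rewrite lt_min ltrDl e0 xy ge_min lexx orbT.
    by rewrite lE lee_fin => /le_trans; apply; rewrite ge_min lexx.
  rewrite leNgt; apply/negP => ax; apply: xJ.
  move: lE yJ; rewrite /lend; case: (sitv J) => -[c a'|[]] d //= [aa'].
  rewrite !itv_boundlr /= => /andP[_ yd]; rewrite aa'; apply/andP; split.
    by case: c; rewrite bnd_simp// ltW.
  by apply: le_trans yd; rewrite bnd_simp ltW.
- by have := lend_le yJ; rewrite lE.
- by exfalso; apply: xJ; exact: lendNy_closed lE yJ (ltW xy).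
Qed.

Lemma rend_eq J x y : ~ (x \in sitv J) -> y < x ->
  (forall t, y <= t < x -> t \in sitv J) -> rend J = x%:E.
Proof.
move=> xJ yx tJ; have yJ : y \in sitv J by apply: tJ; rewrite yx lexx.
case rE : (rend J) => [a| |].
- congr EFin; apply/eqP; rewrite eq_le; apply/andP; split; last first.
    apply/ler_addgt0Pr => e e0; pose t := Num.max (x - e) y.
    have /tJ/rend_ge : y <= t < x by rewrite gt_max gtrBl e0 yx le_max lexx orbT.
    by rewrite rE lee_fin ge_max => /andP[+ _]; rewrite lerBlDr.
  rewrite leNgt; apply/negP => ax; apply: xJ.
  move: rE yJ; rewrite /rend; case: (sitv J) => d [c a'|[]] //= [aa'].
  rewrite !itv_boundlr /= => /andP[yd _]; rewrite aa'; apply/andP; split.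
    by apply: le_trans yd _; rewrite bnd_simp ltW.
  by case: c; rewrite bnd_simp// ltW.
- by exfalso; apply: xJ; exact: rendy_closed rE yJ (ltW yx).
- by have := rend_ge yJ; rewrite rE.
Qed.

End ScaledIntervals.

(** * The measure ds and the derivative du/ds *)

Section IntegralRestr.
Context d (T : measurableType d) (R : realType).
Variables (mu : {measure set T -> \bar R}) (A : set T) (mA : measurable A).

Lemma ge0_integral_mrestr (D : set T) (f : T -> \bar R) : measurable D ->
  measurable_fun D f -> (forall x, D x -> 0 <= f x)%E ->
  (\int[mrestr mu mA]_(x in D) f x = \int[mu]_(x in D `&` A) f x)%E.
Proof.
move=> mD mf f0.
pose nu : {measure set T -> \bar R} := mrestr mu mA.
rewrite -[LHS]/(\int[nu]_(x in D) f x)%E.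
rewrite (@ge0_negligible_integral _ _ _ nu D (D `\` A))//.
- rewrite setDD; apply: eq_measure_integral => B mB BA.
  by rewrite /nu /= /mrestr setIidl// => x /BA[].
- exact: measurableD.
- by rewrite /nu /= /mrestr setDE -setIA setICl setI0 measure0.
Qed.

End IntegralRestr.

Section ScaleMeasureOfAnInterval.
Context {R : realType}.
Notation borel := (measurableTypeR R).
Implicit Types (J : scaled_interval R) (x y : R) (u v : R -> R).

Lemma dscale_setI J (A : set borel) :
  dscale J (A `&` [set` sitv J]) = dscale J A.
Proof. by rewrite /dscale -setIA setIid. Qed.

Lemma dscale_countable J (A : set borel) : countable A -> dscale J A = 0%E.
Proof.
move=> cA; apply: countable_lebesgue_measure0.
apply: sub_countable cA; apply: card_le_trans (card_image_le _ _) _.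
by apply: subset_card_le; exact: subIsetl.
Qed.

Lemma finite_endpoints J : finite_set ([set` sitv J] `\` inner J).
Proof.
have fin1 (M : set R) : (forall x y, M x -> M y -> x = y) -> finite_set M.
  move=> M1; have [->|/set0P[x Mx]] := eqVneq M set0; first exact: finite_set0.
  by apply: (sub_finite_set _ (finite_set1 x)) => y My; exact: M1.
apply: (@sub_finite_set _ _ ([set x | x \in sitv J /\ forall y, y \in sitv J -> x <= y]
    `|` [set x | x \in sitv J /\ forall y, y \in sitv J -> y <= x])).
  move=> x [xJ nx]; apply: contrapT => /not_orP[].
  move=> /not_andP[//|/existsNP[a /not_implyP[aJ /negP]]].
  rewrite -ltNge => ax.
  move=> /not_andP[//|/existsNP[b /not_implyP[bJ /negP]]].
  rewrite -ltNge => xb.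
  by apply: nx; apply/innerP; exists a, b; rewrite ax.
rewrite finite_setU; split; apply: fin1 => x y [xJ xP] [yJ yP]; apply/eqP.
  by rewrite eq_le xP// yP.
by rewrite eq_le xP// yP.
Qed.

Lemma dscale_not_inner J : dscale J (~` inner J) = 0%E.
Proof.
rewrite -dscale_setI setIC -setDE.
by apply: dscale_countable; exact: finite_set_countable (finite_endpoints J).
Qed.

Lemma dscale_segment_lty J x y : x \in sitv J -> y \in sitv J ->
  (dscale J `[x, y] < +oo)%E.
Proof.
move=> xJ yJ; have [xy|yx] := leP x y; first by rewrite dscale_itv// ltry.
by rewrite set_itv_ge ?measure0// bnd_simp -ltNge.
Qed.

Let measurable_scale_itv J : measurable (scale J @` [set` sitv J] : set borel).
Proof. by rewrite -[X in scale J @` X]setTI; exact: measurable_scale_image. Qed.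

(** Change of variables t = s(x): the measure ds is the image by the inverse of s
    of Lebesgue measure restricted to s(J), the restriction discarding the points
    where the inverse takes its default value. *)
Lemma ge0_integral_dscale J (D : set borel) (f : borel -> \bar R) :
  measurable D -> D `<=` [set` sitv J] -> measurable_fun D f ->
  (forall x, D x -> 0 <= f x)%E ->
  (\int[dscale J]_(x in D) f x =
   \int[lebesgue_measure]_(t in scale J @` D) f (scale_inv J t))%E.
Proof.
move=> mD DJ mf f0.
have mS := measurable_scale_itv J.
pose mu : {measure set borel -> \bar R} := mrestr (@lebesgue_measure R) mS.
have imD : scale_inv J @^-1` D `&` (scale J @` [set` sitv J]) = scale J @` D.
  apply/seteqP; split => [z [/= Dz /scale_invK[zJ zE]]|_ [x Dx <-]].
    by exists (scale_inv J z).
  by rewrite /= scaleK; [split => //; exists x => //|]; exact: DJ.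
have mSD : measurable (scale J @` D : set borel).
  by rewrite -(setIidl DJ); exact: measurable_scale_image.
have mpD : measurable (scale_inv J @^-1` D : set borel).
  by rewrite -[X in measurable X]setTI; exact: measurable_scale_inv.
have mfs : measurable_fun (scale_inv J @^-1` D : set borel) (f \o scale_inv J).
  apply: (measurable_comp mD) => //; first by move=> _ [z Dz <-].
  exact: measurable_funS (@measurable_scale_inv R J).
pose nu_of : {measure set borel -> \bar R} :=
  pushforward mu (scale_inv J : borel -> borel).
pose nu := nu_of (@measurable_scale_inv R J).
have nuE : (nu : set borel -> \bar R) = pushforward mu (scale_inv J) by [].
rewrite (eq_measure_integral nu); last first.
  move=> A mA AD; rewrite nuE /pushforward /mu /= /mrestr /dscale.
  congr lebesgue_measure; apply/seteqP; split => [_ [x [Ax xJ] <-]|z].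
    by rewrite /= scaleK//; split => //; exists x.
  by move=> [/= Az /scale_invK[zJ zE]]; exists (scale_inv J z).
rewrite nuE ge0_integral_pushforward//; last 2 first.
- exact: measurable_scale_inv.
- by move=> x; rewrite inE; exact: f0.
rewrite /mu ge0_integral_mrestr//; first by rewrite imD.
by move=> x Dx; exact: f0.
Qed.

End ScaleMeasureOfAnInterval.

Section ScaleDerivative.
Context {R : realType}.
Notation borel := (measurableTypeR R).
Implicit Types (J : scaled_interval R) (x y : R) (u v : R -> R).

Lemma near_scale_inv J x (P : R -> Prop) : inner J x -> (\forall z \near x, P z) ->
  \forall t \near scale J x, P (scale_inv J t).
Proof.
move=> xJ Px; have := continuous_scale_inv xJ.
by rewrite /prop_for /continuous_at scaleK; [exact|exact: inner_subset].
Qed.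

Lemma near_eq_scale_derive J u v x : inner J x -> (\forall z \near x, u z = v z) ->
  scale_derive J u x = scale_derive J v x.
Proof.
move=> xJ uv; rewrite /scale_derive /=; apply: near_eq_derive1.
exact: near_scale_inv xJ uv.
Qed.

Lemma near_csub_scale_derive J (c : R) u v x : inner J x ->
  (\forall z \near x, u z = c - v z) ->
  scale_derive J u x = - scale_derive J v x.
Proof.
move=> xJ uv; rewrite (near_eq_scale_derive xJ uv) /scale_derive /=.
by rewrite -[RHS](derive1_csub c).
Qed.

Lemma near_subc_scale_derive J (c : R) u v x : inner J x ->
  (\forall z \near x, u z = v z - c) ->
  scale_derive J u x = scale_derive J v x.
Proof.
move=> xJ uv; rewrite (near_eq_scale_derive xJ uv) /scale_derive /=.
by rewrite -[RHS](derive1_subc c).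
Qed.

Lemma near_cst_scale_derive J (c : R) u x : inner J x ->
  (\forall z \near x, u z = c) -> scale_derive J u x = 0.
Proof.
move=> xJ uc; rewrite (@near_eq_scale_derive _ _ (cst c))// /scale_derive /=.
by rewrite (_ : _ \o _ = cst c)// derive1_cst.
Qed.

Lemma scale_derive_scale J x : inner J x -> scale_derive J (scale J) x = 1.
Proof.
move=> xJ; rewrite /scale_derive /=.
rewrite (@near_eq_derive1 _ _ id) ?derive1_id//.
by apply: filterS (near_scale_invK xJ) => z [].
Qed.

(** Continuity of u inside J makes du/ds a genuine Borel function there, and the
    endpoints of J, being finitely many, do not affect measurability. *)
Lemma measurable_scale_derive J u : {in inner J, continuous u} ->
  measurable_fun ([set` sitv J] : set borel) (scale_derive J u).
Proof.
move=> cu.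
have -> : [set` sitv J] = inner J `|` ([set` sitv J] `\` inner J).
  by rewrite setUDr setDv setD0 setUidr//; exact: inner_subset.
have mi := measurable_inner J.
apply/measurable_funU => //; first by apply: measurableD => //; exact: measurable_sitv.
split; last first.
  move=> _ A mA; apply: countable_measurable; first by move=> t; exact: measurable_set1.
  apply: finite_set_countable; apply: sub_finite_set (finite_endpoints J).
  exact: subIsetl.
apply: (measurable_comp (F := scale J @` inner J)).
- by apply: open_measurable; exact: open_scale_inner.
- by [].
- apply: measurable_derive1; first exact: open_scale_inner.
  move=> z; rewrite inE => -[x xJ <-].
  apply: continuous_comp; first exact: continuous_scale_inv.
  by rewrite scaleK; [apply: cu; rewrite inE|exact: inner_subset].
- apply: (measurable_funS _ _ (@measurable_scale R J)).
    exact: measurable_sitv.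
  exact: inner_subset.
Qed.

End ScaleDerivative.

(** * Scale functions at the endpoints *)

Section ScaleAtEndpoints.
Context {R : realType}.
Implicit Types (J : scaled_interval R) (x y : R).

Let cvg_to_inf (F : set_system R) (FF : ProperFilter F) (D : set R) (h : R -> R) :
  D !=set0 -> (forall y, D y -> \forall x \near F, D x /\ h x <= h y) ->
  (h x)%:E @[x --> F] --> ereal_inf [set (h x)%:E | x in D].
Proof.
move=> [y0 Dy0] near_le.
have lb x : D x -> (ereal_inf [set (h x)%:E | x in D] <= (h x)%:E)%E.
  by move=> Dx; apply: ereal_inf_lbound; exists x.
case L : (ereal_inf _) => [r| |].
- apply/fine_cvgP; split; first by apply: nearW.
  apply/cvgrPdist_lt => e e0.
  have [|_ [y Dy <-]] := lb_ereal_inf_adherent e0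
    (_ : ereal_inf [set (h x)%:E | x in D] \is a fin_num).
    by rewrite L.
  rewrite L -EFinD lte_fin => ye; apply: filterS (near_le y Dy) => x [Dx xy].
  have := lb x Dx; rewrite L lee_fin => rx.
  by rewrite /= ltr_norml; lra.
- by have := lb y0 Dy0; rewrite L.
- apply/cvgeNyPlt => A; have [_ [y Dy <-]] := lb_ereal_infNy_adherent A L.
  rewrite lte_fin => yA; apply: filterS (near_le y Dy) => x [_ xy].
  by rewrite lte_fin (le_lt_trans xy).
Qed.

Let inf_gtNy (D : set R) (h : R -> R) : D !=set0 ->
  (-oo < ereal_inf [set (h x)%:E | x in D])%E <-> exists c, forall x, D x -> c <= h x.
Proof.
move=> [y0 Dy0]; split=> [|[c hc]]; last first.
  rewrite (@lt_le_trans _ _ c%:E) ?ltNyr//; apply: le_ereal_inf_tmp => _ [x Dx <-].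
  by rewrite lee_fin hc.
have lb x : D x -> (ereal_inf [set (h x)%:E | x in D] <= (h x)%:E)%E.
  by move=> Dx; apply: ereal_inf_lbound; exists x.
case L : (ereal_inf _) => [r| |] // _.
  by exists r => x Dx; have := lb x Dx; rewrite L lee_fin.
by have := lb y0 Dy0; rewrite L.
Qed.

Let inner0 J : inner J !=set0.
Proof. by have [x [_ [_ xJ _]]] := inner_nonempty J; exists x. Qed.

Let lend_filter J : set_system R :=
  match (sitv J).1 with BSide _ a => a^'+ | BInfty _ => ninfty_nbhs R end.

Let rend_filter J : set_system R :=
  match (sitv J).2 with BSide _ b => b^'- | BInfty _ => pinfty_nbhs R end.

Let lend_proper J : ProperFilter (lend_filter J).
Proof. by rewrite /lend_filter; case: (sitv J).1 => [? ?|?] /=; typeclasses eauto. Qed.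

Let rend_proper J : ProperFilter (rend_filter J).
Proof. by rewrite /rend_filter; case: (sitv J).2 => [? ?|?] /=; typeclasses eauto. Qed.

Let near_lend J y : inner J y ->
  \forall x \near lend_filter J, inner J x /\ x <= y.
Proof.
move=> yJ; have := inner_subset yJ; have := yJ.
rewrite /lend_filter /inner /=; have := sitv_lt J.
case: (sitv J) => -[c a|[]] b //= ab yi yab.
- have ay : a < y.
    have /nbhs_ballP[r /= r0 rb] := yi.
    have : (y - r / 2) \in Interval (BSide c a) b.
      by apply: rb; rewrite /ball /= opprB addrC subrK gtr0_norm
        ?divr_gt0// ltr_pdivrMr// ltr_pMr// ltr1n.
    rewrite itv_boundlr => /andP[+ _] => /lteifW; rewrite ?bnd_simp.
    have r2 : 0 < r / 2 by rewrite divr_gt0.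
    lra.
  near=> x; split; last by near: x; exact: nbhs_right_le.
  have ax : a < x by near: x; exact: nbhs_right_gt.
  have xy : x < y by near: x; exact: nbhs_right_lt.
  have : \forall z \near x, z \in `]a, y[ by apply: near_in_itvoo; rewrite in_itv /= ax.
  apply: filterS => z; rewrite /= in_itv/= => /andP[az zy].
  move: yab; rewrite !itv_boundlr => /andP[_ yb]; apply/andP; split.
    by case: (c); rewrite bnd_simp ?ltW.
  by apply: le_trans yb; rewrite bnd_simp ltW.
- near=> x; split; last by near: x; apply: nbhs_ninfty_le; exact: num_real.
  have xy : x < y by near: x; apply: nbhs_ninfty_lt; exact: num_real.
  have : \forall z \near x, z < y by exact: lt_nbhsl.
  apply: filterS => z zy.
  move: yab; rewrite /= !itv_boundlr => /andP[_ yb]; apply/andP; split => //.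
  by apply: le_trans yb; rewrite bnd_simp ltW.
Unshelve. all: by end_near. Qed.

Let near_rend J y : inner J y ->
  \forall x \near rend_filter J, inner J x /\ y <= x.
Proof.
move=> yJ; have := inner_subset yJ; have := yJ.
rewrite /rend_filter /inner /=; have := sitv_lt J.
case: (sitv J) => b [c a|[]] //= ab yi yab; [|by case: b ab yi yab => [? ?|[]]|].
- have ya : y < a.
    have /nbhs_ballP[r /= r0 rb] := yi.
    have : (y + r / 2) \in Interval b (BSide c a).
      by apply: rb; rewrite /ball /= opprD addNKr normrN gtr0_norm
        ?divr_gt0// ltr_pdivrMr// ltr_pMr// ltr1n.
    rewrite itv_boundlr => /andP[_] /lteifW; rewrite ?bnd_simp.
    have r2 : 0 < r / 2 by rewrite divr_gt0.
    lra.
  near=> x; split; last by near: x; exact: nbhs_left_ge.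
  have xa : x < a by near: x; exact: nbhs_left_lt.
  have yx : y < x by near: x; exact: nbhs_left_gt.
  have : \forall z \near x, z \in `]y, a[ by apply: near_in_itvoo; rewrite in_itv /= yx.
  apply: filterS => z; rewrite /= in_itv/= => /andP[yz za].
  move: yab; rewrite !itv_boundlr => /andP[by_ _]; apply/andP; split.
    by apply: le_trans by_ _; rewrite bnd_simp ltW.
  by case: (c); rewrite bnd_simp ?ltW.
- near=> x; split; last by near: x; apply: nbhs_pinfty_ge; exact: num_real.
  have yx : y < x by near: x; apply: nbhs_pinfty_gt; exact: num_real.
  have : \forall z \near x, y < z by exact: lt_nbhsr.
  apply: filterS => z yz.
  move: yab; rewrite /= !itv_boundlr => /andP[by_ _]; apply/andP; split => //.
  by apply: le_trans by_ _; rewrite bnd_simp ltW.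
Unshelve. all: by end_near. Qed.

(** By monotonicity the limit of s at an endpoint is its infimum or supremum. *)
Lemma scale_lend_gtNy J :
  (-oo < scale_lend J)%E <-> exists c, forall x, inner J x -> c <= scale J x.
Proof.
have FF := lend_proper J.
have slE : scale_lend J = lim ((scale J x)%:E @[x --> lend_filter J]).
  by rewrite /scale_lend /lend_filter; case: (sitv J).1.
suff -> : scale_lend J = ereal_inf [set (scale J x)%:E | x in inner J].
  exact: inf_gtNy.
rewrite slE; apply/cvg_lim => //.
apply: cvg_to_inf => // y yJ; apply: filterS (near_lend yJ) => x [xJ xy].
by split => //; rewrite scale_le//; exact: inner_subset.
Qed.

Lemma scale_rend_lty J :
  (scale_rend J < +oo)%E <-> exists c, forall x, inner J x -> scale J x <= c.
Proof.
have FF := rend_proper J.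
have srE : scale_rend J = lim ((scale J x)%:E @[x --> rend_filter J]).
  by rewrite /scale_rend /rend_filter; case: (sitv J).2.
have -> : scale_rend J = (- ereal_inf [set (- scale J x)%:E | x in inner J])%E.
  rewrite srE; apply/cvg_lim => //.
  have : (- scale J x)%:E @[x --> rend_filter J] -->
      ereal_inf [set (- scale J x)%:E | x in inner J].
    apply: (@cvg_to_inf _ _ _ (fun x => - scale J x)) => // y yJ.
    apply: filterS (near_rend yJ) => x [xJ xy].
    by split => //; rewrite lerN2 scale_le//; exact: inner_subset.
  move=> /cvgeN; apply: cvg_trans; apply: near_eq_cvg; apply: nearW => x /=.
  by rewrite opprK.
rewrite lteNl /= (@inf_gtNy _ (fun x => - scale J x))//.
by split=> -[c H]; exists (- c) => x /H; rewrite ?lerN2// lerNr.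
Qed.

End ScaleAtEndpoints.

(** * Equality of measures, measures with a density *)

Section MeasureEquality.
Context {R : realType}.
Notation borel := (measurableTypeR R).
Implicit Types mu nu : {measure set borel -> \bar R}.

Lemma eq_measure_on_itvoc mu nu (a b : R) :
  (forall x y, a <= x -> x <= y -> y <= b -> mu `]x, y]%classic = nu `]x, y]%classic) ->
  (mu `]a, b]%classic < +oo)%E ->
  forall B : set borel, measurable B -> B `<=` `]a, b] -> mu B = nu B.
Proof.
move=> munu muoo B mB Bab.
have mab : measurable (`]a, b]%classic : set borel) by exact: measurable_itv.
pose mu' : {measure set borel -> \bar R} := mrestr mu mab.
pose nu' : {measure set borel -> \bar R} := mrestr nu mab.
have -> : mu B = mu' B by rewrite /mu' /= /mrestr setIidl.
have -> : nu B = nu' B by rewrite /nu' /= /mrestr setIidl.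
apply: (@measure_unique _ R borel (@ocitv R) (fun n => `](- n%:R), n%:R]%classic)) => //.
- exact: ocitvI.
- by move=> n; exact: is_ocitv.
- exact: (@bigcup_itvT R false false).
- move=> _ [[x y] _ <-] /=; rewrite /mu' /nu' /= /mrestr.
  rewrite (_ : _ `&` _ = `]Num.max x a, Num.min y b]%classic); last first.
    apply/seteqP; split => z /=; rewrite !in_itv/= gt_max le_min.
      by move=> [/andP[-> ->] /andP[-> ->]].
    by move=> /andP[/andP[-> ->] /andP[-> ->]].
  have [xy|yx] := leP (Num.max x a) (Num.min y b).
    apply: munu => //; first by rewrite le_max lexx orbT.
    by rewrite ge_min lexx orbT.
  by rewrite set_itv_ge ?measure0// bnd_simp -leNgt ltW.
- move=> n; apply: le_lt_trans muoo; rewrite /mu' /= /mrestr.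
  by apply: le_measure; rewrite ?inE//; exact: measurableI.
Qed.

(** The members of the cover may overlap: the measures are compared on the
    disjoint pieces cut out by the earlier members. *)
Lemma eq_measure_countable_cover mu nu (J : countType) (K : J -> set borel) :
  (forall j, measurable (K j)) ->
  (forall j (B : set borel), measurable B -> B `<=` K j -> mu B = nu B) ->
  (forall B : set borel, measurable B ->
     (forall j x, B x -> ~ K j x) -> mu B = nu B) ->
  forall B : set borel, measurable B -> mu B = nu B.
Proof.
move=> mK eqK eq0 B mB.
pose F n : set borel := if unpickle n is Some j then K j else set0.
have mF n : measurable (F n) by rewrite /F; case: unpickle.
have mD n : measurable (seqDU F n) by apply: measurableD => //; exact: bigsetU_measurable.
have BE : B = (\bigcup_n (B `&` seqDU F n)) `|` (B `\` \bigcup_n F n).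
  by rewrite -setI_bigcupr -seqDU_bigcup_eq setUIDK.
have mU : measurable (\bigcup_n F n) by exact: bigcupT_measurable.
have mBU : measurable (\bigcup_n (B `&` seqDU F n)).
  by apply: bigcupT_measurable => n; exact: measurableI.
have mBD : measurable (B `\` \bigcup_n F n) by exact: measurableD.
have disj0 : \bigcup_n (B `&` seqDU F n) `&` (B `\` \bigcup_n F n) = set0.
  by rewrite -setI_bigcupr -seqDU_bigcup_eq setIACA setICr setI0.
have tD : trivIset setT (fun n => B `&` seqDU F n).
  by apply: trivIset_setIl; exact: trivIset_seqDU.
rewrite BE !measureU//; congr (_ + _)%E; last first.
  apply: eq0 => // j x [_ nF] xj; apply: nF; exists (pickle j) => //.
  by rewrite /F pickleK.
have mBn n : measurable (B `&` seqDU F n) by exact: measurableI.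
have sumE (r : {measure set borel -> \bar R}) : r (\bigcup_n (B `&` seqDU F n)) =
    (\sum_(0 <= n <oo) r (B `&` seqDU F n))%E by exact: measure_semi_bigcup.
apply: (eq_trans (sumE mu)); apply: (eq_trans _ (esym (sumE nu))).
apply: eq_eseriesr => n _; have : B `&` seqDU F n `<=` F n by move=> x [_ []].
rewrite {2}/F; case: unpickle => [j|] BF; last first.
  by move: BF; rewrite subset0 => ->; rewrite !measure0.
by apply: (eqK j) => //; exact: measurableI.
Qed.

End MeasureEquality.

Section DensityMeasure.
Context {R : realType}.
Notation borel := (measurableTypeR R).
Variables (mu : {measure set borel -> \bar R}) (f : borel -> \bar R).
Hypothesis mf : measurable_fun [set: borel] f.
Hypothesis f0 : forall x, (0 <= f x)%E.

Lemma density_measure : exists nu : {measure set borel -> \bar R},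
  forall B, nu B = (\int[mu]_(x in B) f x)%E.
Proof.
pose nu0 (B : set borel) : \bar R := (\int[mu]_(x in B) f x)%E.
have nu_set0 : nu0 set0 = 0%E by exact: integral_set0.
have nu_ge0 B : (0 <= nu0 B)%E by exact: integral_ge0.
pose mnu := isMeasure.Build _ _ _ nu0 nu_set0 nu_ge0
  (@semi_sigma_additive_nng_induced _ _ _ mu f mf f0).
pose nu : {measure set borel -> \bar R} := HB.pack nu0 mnu.
by exists nu.
Qed.

End DensityMeasure.

(** * Density of one scale measure with respect to another *)

Section RationalNeighbourhoods.
Context {R : realType}.
Notation borel := (measurableTypeR R).

(** Rational endpoints make local statements countably many, hence compatible
    with almost everywhere quantification. *)
Lemma near_rat_segment (x : R) (P : R -> Prop) : (\forall y \near x, P y) ->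
  exists p q : rat, ratr p < x < ratr q /\ forall y, ratr p <= y <= ratr q -> P y.
Proof.
move=> /nbhs_ballP[r /= r0 rP].
have [p] : exists p : rat, ratr p \in `]x - r, x[ by apply: rat_in_itvoo; rewrite gtrBl.
rewrite in_itv /= => /andP[pr px].
have [q] : exists q : rat, ratr q \in `]x, x + r[ by apply: rat_in_itvoo; rewrite ltrDl.
rewrite in_itv /= => /andP[xq qr].
exists p, q; rewrite px xq; split => // y /andP[py yq].
by apply: rP; rewrite /ball /= ltr_norml; lra.
Qed.

(* The filter structure is given explicitly because it is registered on the
   Borel copy of R, whereas predicates are often stated on R itself. *)
Lemma ae_sub (mu : {measure set borel -> \bar R}) (P Q : R -> Prop) :
  (forall x, P x -> Q x) -> {ae mu, forall x : R, P x} -> {ae mu, forall x : R, Q x}.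
Proof. exact: (@filterS borel _ (ae_filter_ringOfSetsType mu)). Qed.

Lemma ae_and (mu : {measure set borel -> \bar R}) (P Q : R -> Prop) :
  {ae mu, forall x : R, P x} -> {ae mu, forall x : R, Q x} ->
  {ae mu, forall x : R, P x /\ Q x}.
Proof. exact: (@filterI borel _ (ae_filter_ringOfSetsType mu)). Qed.

Lemma ae_forall_countable d (T : measurableType d) (mu : {measure set T -> \bar R})
    (I : countType) (P : I -> T -> Prop) :
  (forall i, {ae mu, forall x, P i x}) -> {ae mu, forall x, forall i, P i x}.
Proof.
move=> aeP; have : {ae mu, forall x, forall n,
    (if unpickle n is Some i then P i else fun=> True) x}.
  apply: ae_foralln => n; case: unpickle => [i|]; first exact: aeP.
  exact: aeW.
by apply: filterS => x Px i; have := Px (pickle i); rewrite pickleK.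
Qed.

Lemma ae_dscale (J : scaled_interval R) (P : R -> Prop) :
  {ae (@lebesgue_measure R), forall t, P t} ->
  {ae dscale J, forall x, x \in sitv J -> P (scale J x)}.
Proof.
move=> [M [mM M0 PM]]; exists ([set` sitv J] `&` scale J @^-1` M); split.
- by apply: measurable_scale => //; exact: measurable_sitv.
- apply/eqP; rewrite -measure_le0 -M0 /dscale.
  apply: le_measure; rewrite ?inE//.
    apply: measurable_scale_image.
    by apply: measurable_scale => //; exact: measurable_sitv.
  by move=> _ [x [[_ Mx] _] <-].
- by move=> x /= /not_implyP[xJ nP]; split => //; exact: PM.
Qed.

End RationalNeighbourhoods.

Section ScaleDensity.
Context {R : realType}.
Notation borel := (measurableTypeR R).
Variables (J J' : scaled_interval R) (f : borel -> R).
Hypothesis JJ' : inner J `<=` inner J'.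
Hypothesis mf : measurable_fun setT f.
Hypothesis f0 : forall x, 0 <= f x.
Hypothesis dsf : forall x y, inner J x -> inner J y ->
  dscale J' `[x, y] = (\int[dscale J]_(t in `[x, y]) (f t)%:E)%E.

Let integral_density (a b : R) : inner J a -> inner J b -> a <= b ->
  (\int[lebesgue_measure]_(t in `[scale J a, scale J b]) (f (scale_inv J t))%:E =
   (scale J' b - scale J' a)%:E)%E.
Proof.
move=> aJ bJ ab; have aJ' := inner_subset aJ; have bJ' := inner_subset bJ.
rewrite -dscale_itv//; try by apply: inner_subset; exact: JJ'.
rewrite dsf// ge0_integral_dscale//.
- by rewrite scale_image_segment.
- exact: sitv_segment.
- by apply: measurable_funTS; exact/measurable_EFinP.
- by move=> x _; rewrite lee_fin.
Qed.

Let is_derive_density_segment (a b : R) : inner J a -> inner J b ->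
  {ae (@lebesgue_measure R), forall t, scale J a < t < scale J b ->
     is_derive t 1 (scale J' \o scale_inv J) (f (scale_inv J t))}.
Proof.
move=> aJ bJ; have aJ' := inner_subset aJ; have bJ' := inner_subset bJ.
have [ab|ba] := leP a b; last first.
  apply: aeW => t /andP[at_ tb]; have := lt_trans at_ tb.
  by rewrite scale_lt// ltNge ltW.
pose h t := f (scale_inv J t).
have mh : measurable_fun [set: borel] (h : borel -> R).
  by apply: (measurableT_comp mf); exact: measurable_scale_inv.
have inth : (@lebesgue_measure R).-integrable `[scale J a, scale J b] (EFin \o h).
  apply/integrableP; split; first by apply: measurable_funTS; exact/measurable_EFinP.
  under eq_integral do rewrite /= ger0_norm ?f0//.
  by rewrite integral_density// ltry.
pose g := h \_ `[scale J a, scale J b].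
have intg : (@lebesgue_measure R).-integrable setT (EFin \o g).
  by move: inth; rewrite integrable_mkcond//= restrict_EFin.
have intgy y : (@lebesgue_measure R).-integrable `]-oo, y] (EFin \o g).
  by apply: (integrableS _ _ _ intg).
have := @FTC1Ny R g intgy (integrable_locally (measurable_itv _) inth).
apply: ae_sub => t + /andP[at_ tb] => -[Fd].
have tab : t \in `]scale J a, scale J b[ by rewrite in_itv /= at_.
rewrite {2}/g patchE mem_set; last exact: subset_itv_oo_cc tab.
move=> Ft; set F := (fun x => _) in Fd Ft.
have Fder : is_derive t 1 F (h t) by rewrite -Ft; exact: is_derive_derive1.
have : is_derive t 1 (fun z => F z + scale J' a) (h t).
  by rewrite -[X in is_derive _ _ _ X]addr0; apply: is_deriveD.
apply: near_eq_is_derive.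
have : \forall z \near t, z \in `]scale J a, scale J b[ by exact: near_in_itvoo.
apply: filterS => z zab; have [x xab zE] := scale_image_oo aJ' bJ' zab.
have xJ : inner J x.
  by apply: (inner_segment aJ bJ); exact: subset_itv_oo_cc xab.
move: xab; rewrite /= in_itv/= => /andP[ax xb].
rewrite /= -zE scaleK; last exact: inner_subset.
rewrite /F /Rintegral.
have -> : (\int[lebesgue_measure]_(x0 in `]-oo, scale J x]) (g x0)%:E =
   (scale J' x - scale J' a)%:E)%E.
  rewrite -integral_density//; last exact: ltW.
  rewrite integral_mkcond [RHS]integral_mkcond.
  apply: eq_integral => y _; rewrite !patchE /g patchE.
  rewrite !mem_setE !in_itv /=.
  have [yx|xy] := leP y (scale J x); last by rewrite andbF.
  rewrite andbT (le_trans yx) ?andbT; first by case: ifPn.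
  by rewrite scale_le ?(ltW xb)//; exact: inner_subset.
by rewrite /= subrK.
Qed.

(** The hypothesis says that s' \o s^-1 is an integral of f \o s^-1 on each
    compact part of s(J), so that Lebesgue's differentiation theorem applies. *)
Lemma is_derive_density :
  {ae dscale J, forall x, inner J x ->
     is_derive (scale J x) 1 (scale J' \o scale_inv J) (f x)}.
Proof.
have : {ae (@lebesgue_measure R), forall t, forall pq : rat * rat,
    inner J (ratr pq.1) -> inner J (ratr pq.2) ->
    scale J (ratr pq.1) < t < scale J (ratr pq.2) ->
    is_derive t 1 (scale J' \o scale_inv J) (f (scale_inv J t))}.
  apply: ae_forall_countable => -[p q] /=.
  have [pJ|npJ] := pselect (inner J (ratr p)); last by apply: aeW.
  have [qJ|nqJ] := pselect (inner J (ratr q)); last by apply: aeW.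
  have := is_derive_density_segment pJ qJ.
  by apply: ae_sub => t H _ _; exact: H.
move=> /(ae_dscale J); apply: ae_sub => x H xJ.
have xJ' := inner_subset xJ.
have [p [q [/andP[px xq] pqJ]]] := near_rat_segment (near_inner xJ).
have pq := lt_trans px xq.
have pJ : inner J (ratr p) by apply: pqJ; rewrite lexx ltW.
have qJ : inner J (ratr q) by apply: pqJ; rewrite lexx ltW.
have := H xJ' (p, q) pJ qJ; rewrite scaleK//; apply.
by rewrite /= !scale_lt ?px ?xq//; exact: inner_subset.
Qed.

End ScaleDensity.

(** * Vanishing of du/ds over null sets *)

Section NullScaleDerivative.
Context {R : realType}.
Notation borel := (measurableTypeR R).
Implicit Types (J : scaled_interval R) (u v : R -> R).

Lemma continuous_scale_abs_continuous J u x : scale_abs_continuous J u ->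
  inner J x -> {for x, continuous u}.
Proof.
move=> [g acg ug] xJ; have xJ' := inner_subset xJ.
have [a [b [aJ bJ axb]]] := (innerP J x).1 xJ; have /andP[ax xb] := axb.
have acab : abs_continuous_on (scale J a) (scale J b) g.
  apply: acg => z; rewrite -scale_image_segment//; last exact: ltW (lt_trans ax xb).
  by move=> [t tab <-]; exists t => //; exact: (sitv_segment aJ bJ).
have gc : {for scale J x, continuous g}.
  apply/cvgrPdist_lt => e e0; have [d d0 dP] := acab e e0.
  have : \forall z \near scale J x, z \in `]scale J a, scale J b[.
    by apply: near_in_itvoo; rewrite in_itv/= !scale_lt.
  have : \forall z \near scale J x, `|scale J x - z| < d.
    exact: (nbhsx_ballx _ _ d0).
  apply: filterS2 => z zd; rewrite in_itv /= => /andP[az zb].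
  pose l (_ : 'I_1) := Num.min (scale J x) z.
  pose r (_ : 'I_1) := Num.max (scale J x) z.
  have := dP 1%N l r; rewrite !big_ord1 /l /r.
  have -> : `|g (Num.max (scale J x) z) - g (Num.min (scale J x) z)| =
    `|g (scale J x) - g z| by case: (leP (scale J x) z) => // _; rewrite distrC.
  apply.
  - move=> _; split.
    + by rewrite le_min (ltW az) scale_le// (ltW ax).
    + by rewrite ge_min le_max lexx.
    + by rewrite ge_max (ltW zb) scale_le// (ltW xb).
  - by apply/trivIsetP => i j _ _; rewrite !ord1.
  - move: zd; rewrite /ball /=; case: (leP (scale J x) z) => xz.
      by rewrite distrC ger0_norm// subr_ge0.
    by rewrite ger0_norm// subr_ge0 ltW.
have : {for x, continuous (g \o scale J)}.
  by apply: continuous_comp => //; exact: continuous_scale.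
rewrite /prop_for /continuous_at -[(g \o _) x]ug//.
apply: cvg_trans; apply: near_eq_cvg.
by apply: filterS (near_inner xJ) => z zJ; rewrite ug//; exact: inner_subset.
Qed.

Variables (J J' : scaled_interval R) (v : R -> R).
Hypothesis JJ' : [set` sitv J] `<=` [set` sitv J'].
Hypothesis acv : scale_abs_continuous J' v.

Let inner_sub : inner J `<=` inner J'.
Proof. exact: interiorS. Qed.

(** Around a point where dv/ds exists and is not zero, v varies at least like a
    multiple of s: the point is in such a set for some rational a, b and some k. *)
Let steep (a b : R) (k : nat) (B : set R) : set R := [set x |
  [/\ a <= x <= b, B x & forall y, a <= y <= b ->
    `|scale J x - scale J y| <= k%:R * `|v x - v y| ] ].

Let measurable_steep a b k (B : set borel) : inner J a -> inner J b ->
  measurable B -> measurable (steep a b k B : set borel).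
Proof.
move=> aJ bJ mB.
have abJ x : a <= x <= b -> inner J x.
  by move=> axb; apply: (inner_segment aJ bJ); rewrite /= in_itv.
have -> : steep a b k B = B `&` steep a b k setT.
  by apply/seteqP; split => x [] // ? []; split.
apply: measurableI => //; apply: closed_measurable.
rewrite -[X in closed X]setCK; apply: open_closedC.
rewrite openE => x /= nx.
have [axb|/negP] := boolP (a <= x <= b); last first.
  have : open (~` `[a, b]%classic : set R) by apply: closed_openC; exact: itv_closed.
  rewrite openE => /(_ x) + nab; rewrite /= in_itv /= => /(_ nab).
  by apply: filterS => z; rewrite /= in_itv/= => nz [].
have {nx} [y yab xy] : exists2 y, a <= y <= b &
    k%:R * `|v x - v y| < `|scale J x - scale J y|.
  apply: contrapT => nex; apply: nx; split => // y yab.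
  by rewrite leNgt; apply/negP => yx; apply: nex; exists y.
have xJ := abJ _ axb.
have cx : (fun z => `|scale J z - scale J y| - k%:R * `|v z - v y|) @ x -->
    `|scale J x - scale J y| - k%:R * `|v x - v y|.
  apply: cvgB.
    apply: cvg_norm; apply: cvgB; last exact: cvg_cst.
    exact: continuous_scale.
  apply: cvgM; first exact: cvg_cst.
  apply: cvg_norm; apply: cvgB; last exact: cvg_cst.
  by apply: (continuous_scale_abs_continuous acv); exact: inner_sub.
have xy0 : 0 < `|scale J x - scale J y| - k%:R * `|v x - v y| by rewrite subr_gt0.
have : \forall z \near x, 0 < `|scale J z - scale J y| - k%:R * `|v z - v y|.
  exact: cvgr_gt _ cx _ xy0.
by apply: filterS => z; rewrite subr_gt0 ltNge => /negP nz [_ _ /(_ y yab)].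
Qed.

(* Inner regularity reduces to compact parts K of the image by s; psi is the map
   s \o s'^-1, and W = s'(s^-1(K)) is null. *)
Let dscale_steep a b k (B : set borel) : inner J a -> inner J b -> measurable B ->
  dscale J' B = 0%E -> dscale J (steep a b k B) = 0%E.
Proof.
move=> aJ bJ mB B0; have [g acg vg] := acv.
have abJ x : a <= x <= b -> inner J x.
  by move=> axb; apply: (inner_segment aJ bJ); rewrite /= in_itv.
have stJ x : steep a b k B x -> x \in sitv J.
  by move=> [/abJ/inner_subset].
have stJ' x : steep a b k B x -> x \in sitv J' by move=> /stJ/JJ'.
have aJ' : a \in sitv J' by apply: JJ'; exact: inner_subset.
have bJ' : b \in sitv J' by apply: JJ'; exact: inner_subset.
rewrite /dscale lebesgue_regularity_inner_sup; last first.
  by apply: measurable_scale_image; exact: measurable_steep.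
apply/eqP; rewrite eq_le; apply/andP; split; last first.
  apply: ereal_sup_ubound; exists set0; rewrite ?measure0//; split; first exact: compact0.
  exact: sub0set.
apply: ge_ereal_sup => _ [K [cK Kst] <-]; rewrite measure_le0; apply/eqP.
have KP z : K z -> exists x, [/\ steep a b k B x, scale_inv J z = x & scale J x = z].
  by move=> /Kst[x [sx xJ] <-]; exists x; rewrite scaleK.
pose W : set R := (scale J' \o scale_inv J) @` K.
have [ab|ba] := leP a b; last first.
  rewrite (_ : K = set0) ?measure0// -subset0 => z /KP[x [[/andP[ax xb]]]].
  by have := le_trans ax xb; rewrite leNgt ba.
have cW : compact W.
  apply: continuous_compact => //; apply: continuous_in_subspaceT => z.
  rewrite inE => /KP[x [[/abJ xJ _ _] zx <-]].
  apply: continuous_comp; first exact: continuous_scale_inv.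
  rewrite scaleK; last exact: inner_subset.
  by apply: continuous_scale; exact: inner_sub.
have imK : (scale J \o scale_inv J') @` W = K.
  apply/seteqP; split => [_ [_ [z Kz <-] <-]|z Kz] /=.
    have [x [sx -> zx]] := KP _ Kz.
    by rewrite scaleK ?zx//; exact: stJ'.
  have [x [sx zx xz]] := KP _ Kz.
  exists (scale J' x); first by exists z => //=; rewrite zx.
  by rewrite scaleK//; exact: stJ'.
rewrite -imK.
apply: (@lebesgue_measure_dominated_image0 _ (scale J' a) (scale J' b) k%:R g) => //.
- apply: acg => z; rewrite -scale_image_segment// => -[t tab <-].
  by exists t => //; exact: (sitv_segment aJ' bJ').
- move=> _ [z Kz <-] /=; have [x [[/andP[ax xb] Bx Px] zx xz]] := KP _ Kz.
  by rewrite in_itv /= zx !scale_le ?ax//; apply: JJ'; apply: inner_subset;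
    apply: abJ; rewrite ax.
- apply/eqP; rewrite -measure_le0 -B0 /dscale; apply: le_measure; rewrite ?inE.
  + exact: compact_measurable.
  + exact: measurable_scale_image.
  + move=> _ [z Kz <-]; have [x [sx zx xz]] := KP _ Kz.
    by exists x; rewrite /= ?zx//; split; [case: sx|exact: stJ'].
- by rewrite imK; exact: compact_measurable.
- move=> _ _ [y Ky <-] [z Kz <-] /=.
  have [y' [sy -> yy]] := KP _ Ky; have [z' [sz -> zz]] := KP _ Kz.
  have y'J := stJ _ sy; have z'J := stJ _ sz.
  have y'J' := stJ' _ sy; have z'J' := stJ' _ sz.
  rewrite scale_le// => yz; rewrite !scaleK// subr_ge0 scale_le// yz /=.
  have [z'ab _ /(_ y')] := sz; have [y'ab _ _] := sy => /(_ y'ab).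
  by rewrite ger0_norm ?subr_ge0 ?scale_le// !vg.
Qed.

(** On B the function v, absolutely continuous along s', has no variation to
    spare: if dv/ds was not zero on a subset of B of positive ds measure, s would
    be dominated by v there, and the null set s'(B) would be mapped to a set of
    positive measure, contradicting property (N). Points where dv/ds does not
    exist are harmless because the derivative is then 0 by convention. *)
Lemma null_scale_derive (B : set borel) : measurable B -> dscale J' B = 0%E ->
  {ae dscale J, forall x, inner J x -> B x -> scale_derive J v x = 0}.
Proof.
move=> mB B0.
have : {ae dscale J, forall x : R, forall pqk : rat * rat * nat,
    inner J (ratr pqk.1.1) -> inner J (ratr pqk.1.2) ->
    ~ steep (ratr pqk.1.1) (ratr pqk.1.2) pqk.2 B x}.
  apply: ae_forall_countable => -[[p q] k] /=.
  have [pJ|npJ] := pselect (inner J (ratr p)); last by apply: aeW.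
  have [qJ|nqJ] := pselect (inner J (ratr q)); last by apply: aeW.
  exists (steep (ratr p) (ratr q) k B); split; first exact: measurable_steep.
    exact: dscale_steep.
  by move=> x /= nst; apply: contrapT => sx; apply: nst.
apply: ae_sub => x nst xJ Bx; apply: contrapT => /eqP dx0.
pose F := v \o scale_inv J.
have [dF|nF] := pselect (derivable F (scale J x) 1); last first.
  by move: dx0; rewrite /scale_derive /= derive1_nonderivable ?eqxx.
pose l := derive1 F (scale J x).
have l0 : 0 < `|l| by rewrite normr_gt0.
have Fl : h^-1 *: (F (h *: 1 + scale J x) - F (scale J x)) @[h --> 0^'] --> l.
  by have := dF; rewrite /derivable /l derive1E.
have l20 : 0 < `|l| / 2 by rewrite divr_gt0.
have : \forall h \near 0^',
    `|l| / 2 < `|h^-1 *: (F (h *: 1 + scale J x) - F (scale J x))|.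
  apply: (cvgr_gt (`|l|)); first exact: cvg_norm Fl.
  by rewrite ltr_pdivrMr// ltr_pMr// ltr1n.
move=> /nbhs_ballP[d /= d0 dP].
have nearx : \forall y \near x, inner J y /\ `|scale J x - scale J y| < d.
  apply: filterI; first exact: near_inner.
  by have /cvgrPdist_lt/(_ _ d0) := continuous_scale xJ.
have [p [q [/andP[px xq] pqP]]] := near_rat_segment nearx.
have pq := lt_trans px xq.
have pJ : inner J (ratr p) by apply: (pqP _ _).1; rewrite lexx ltW.
have qJ : inner J (ratr q) by apply: (pqP _ _).1; rewrite lexx ltW.
have [k kl] : exists k : nat, 2 / `|l| <= k%:R.
  exists (Num.bound (2 / `|l|)); apply/ltW/archi_boundP.
  by rewrite divr_ge0.
apply: (nst (p, q, k) pJ qJ); split => //=; first by rewrite !ltW.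
move=> y ypq; have [yJ yd] := pqP _ ypq.
have [->|yx] := eqVneq y x; first by rewrite !subrr !normr0 mulr0.
have yxs : scale J y - scale J x != 0.
  rewrite subr_eq0; apply: contra_neq yx; apply: scale_inj.
    exact: inner_subset.
  exact: inner_subset.
have := dP (scale J y - scale J x).
rewrite /ball /= sub0r opprB => /(_ yd yxs).
rewrite /F /= [_ *: 1]mulr1 subrK !scaleK; [|exact: inner_subset|exact: inner_subset].
rewrite normrM normfV ltr_pdivlMl ?normr_gt0// => /ltW H.
rewrite distrC (distrC (v x)).
apply: (@le_trans _ _ (2 / `|l| * `|v y - v x|)); last by rewrite ler_wpM2r.
by rewrite -ler_pdivrMl ?divr_gt0// invf_div mulrC.
Qed.

End NullScaleDerivative.

(** * The scale measure of a family *)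

Section ScaleMeasure.
Context {R : realType}.
Notation borel := (measurableTypeR R).
Variable I : interval_family R.
Hypothesis disjI : trivIset (index I) (fun n => [set` sitv (I n)]).
Implicit Types (u : R -> R) (x : R).

Definition inner_family : set R := \bigcup_(n in index I) inner (I n).

Definition member_at x : nat := xget 0%N [set n | index I n /\ inner (I n) x].

(** Gathers the derivatives du/ds_n into one function on the line, so that the
    energy becomes a single integral against the scale measure. Endpoints, which
    are null, are given the value 0. *)
Definition family_derive u x : R :=
  if x \in inner_family then scale_derive (I (member_at x)) u x else 0.

Lemma sitv_disjoint n k x : index I n -> index I k ->
  x \in sitv (I n) -> x \in sitv (I k) -> n = k.
Proof.
move=> nI kI xn xk; apply: contrapT => /eqP nk.
have /trivIsetP/(_ n k nI kI nk) := disjI.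
by rewrite -subset0 => /(_ x); exact.
Qed.

Lemma family_deriveE n u x : index I n -> inner (I n) x ->
  family_derive u x = scale_derive (I n) u x.
Proof.
move=> nI xn; rewrite /family_derive mem_set; last by exists n.
suff -> : member_at x = n by [].
rewrite /member_at; case: xgetP => [k _ [kI xk]|/(_ n)[]//].
exact: (sitv_disjoint kI nI (inner_subset xk) (inner_subset xn)).
Qed.

Lemma family_derive_out u x : ~ inner_family x -> family_derive u x = 0.
Proof. by move=> nx; rewrite /family_derive memNset. Qed.

Lemma scale_measureE (A : set borel) :
  scale_measure I A = (\sum_(0 <= n <oo) dscale_or0 I n A)%E.
Proof. by []. Qed.

Lemma dscale_le_scale_measure n (A : set borel) : index I n ->
  (dscale (I n) A <= scale_measure I A)%E.
Proof.
move=> nI; rewrite scale_measureE (@nneseriesD1 _ _ n)//.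
rewrite {1}/dscale_or0 mem_set//; apply: leeDl.
by apply: nneseries_ge0 => k _ _; exact: measure_ge0.
Qed.

Lemma scale_measure_sub n (A : set borel) : index I n ->
  A `<=` [set` sitv (I n)] -> scale_measure I A = dscale (I n) A.
Proof.
move=> nI An; rewrite scale_measureE (@nneseriesD1 _ _ n)//.
rewrite {1}/dscale_or0 mem_set// eseries0 ?adde0// => k _ /= kn.
rewrite /dscale_or0; case: ifPn => //; rewrite inE => kI.
rewrite -[LHS]/(dscale (I k) A) -dscale_setI.
rewrite (_ : _ `&` _ = set0) ?dscale0// -subset0 => x [Ax xk].
by move: kn; rewrite (sitv_disjoint kI nI xk (An _ Ax)) eqxx.
Qed.

Lemma scale_measure0 (A : set borel) :
  (forall n, index I n -> dscale (I n) A = 0%E) -> scale_measure I A = 0%E.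
Proof.
move=> A0; rewrite scale_measureE eseries0// => n _ _.
by rewrite /dscale_or0; case: ifPn => //; rewrite inE => /A0.
Qed.

Lemma measurable_inner_family : measurable (inner_family : set borel).
Proof.
by apply: open_measurable; apply: bigcup_open => n _; exact: open_inner.
Qed.

Lemma scale_measure_not_inner : scale_measure I (~` inner_family) = 0%E.
Proof.
apply: scale_measure0 => n nI; apply/eqP; rewrite -measure_le0.
rewrite -(dscale_not_inner (I n)); apply: le_measure; rewrite ?inE.
- by apply: measurableC; exact: measurable_inner_family.
- by apply: measurableC; exact: measurable_inner.
- by apply: subsetC => x xn; exists n.
Qed.

Lemma scale_measure_countable (A : set borel) : countable A -> scale_measure I A = 0%E.
Proof. by move=> cA; apply: scale_measure0 => n _; exact: dscale_countable. Qed.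

Lemma ae_inner_family : {ae scale_measure I, forall x, inner_family x}.
Proof.
exists (~` inner_family); split => //; last exact: scale_measure_not_inner.
by apply: measurableC; exact: measurable_inner_family.
Qed.

Lemma ae_scale_measure_dscale n (P : R -> Prop) : index I n ->
  {ae scale_measure I, forall x, P x} -> {ae dscale (I n), forall x, P x}.
Proof.
move=> nI [M [mM M0 PM]]; exists M; split => //.
by apply/eqP; rewrite -measure_le0 -M0; exact: dscale_le_scale_measure.
Qed.

Lemma ae_dscale_scale_measure (P : R -> Prop) :
  (forall n, index I n -> {ae dscale (I n), forall x, inner (I n) x -> P x}) ->
  {ae scale_measure I, forall x, P x}.
Proof.
move=> aeP.
have {}aeP n : {ae scale_measure I, forall x : R, index I n -> inner (I n) x -> P x}.
  have [nI|nI] := pselect (index I n); last by apply: aeW.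
  have [M [mM M0 PM]] := aeP n nI.
  exists (M `&` inner (I n)); split.
  - by apply: measurableI => //; exact: measurable_inner.
  - rewrite (scale_measure_sub nI); last by move=> x [_ /inner_subset].
    apply/eqP; rewrite -measure_le0 -M0; apply: le_measure; rewrite ?inE//.
    by apply: measurableI => //; exact: measurable_inner.
  - move=> x /= /not_implyP[_ /not_implyP[xn nP]]; split => //.
    by apply: PM => /= /(_ xn).
have := ae_and (ae_forall_countable aeP) ae_inner_family.
by apply: ae_sub => x [H [n nI xn]]; exact: H xn.
Qed.

Lemma ge0_integral_scale_measure (D : set borel) (f : borel -> \bar R) :
  measurable D -> measurable_fun D f -> (forall x, D x -> 0 <= f x)%E ->
  (\int[scale_measure I]_(x in D) f x =
   \sum_(0 <= n <oo | n \in index I) \int[dscale (I n)]_(x in D) f x)%E.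
Proof.
move=> mD mf f0; rewrite /scale_measure ge0_integral_measure_series//.
rewrite [RHS]eseries_mkcond; apply: eq_eseriesr => n _.
rewrite /dscale_or0; case: ifPn => // _; exact: integral_measure_zero.
Qed.

Lemma integral_scale_measure_sub n (A : set borel) (f : borel -> \bar R) :
  index I n -> A `<=` [set` sitv (I n)] ->
  (\int[scale_measure I]_(x in A) f x = \int[dscale (I n)]_(x in A) f x)%E.
Proof.
move=> nI An; apply: eq_measure_integral => B mB BA.
by apply: scale_measure_sub => //; exact: subset_trans An.
Qed.

Lemma measurable_family_derive u :
  (forall n, index I n -> measurable_fun ([set` sitv (I n)] : set borel)
     (scale_derive (I n) u)) ->
  measurable_fun [set: borel] (family_derive u : borel -> R).
Proof.
move=> mu.
have -> : [set: borel] = inner_family `|` ~` inner_family by rewrite setUv.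
have mi := measurable_inner_family.
apply/measurable_funU => //; first exact: measurableC.
split; last first.
  apply: (@eq_measurable_fun _ _ _ _ _ (cst (0 : R))); last exact: measurable_cst.
  by move=> x; rewrite inE => /family_derive_out ->.
rewrite /inner_family bigcup_mkcond; apply/measurable_fun_bigcup => n.
  by case: ifPn => // _; exact: measurable_inner.
case: ifPn => [|_]; last exact: measurable_fun_set0.
rewrite inE => nI; apply: (@eq_measurable_fun _ _ _ _ _ (scale_derive (I n) u)).
  by move=> x; rewrite inE => /(family_deriveE u nI) ->.
apply: (measurable_funS _ _ (mu n nI)); first exact: measurable_sitv.
exact: inner_subset.
Qed.

Lemma integral_dscale_derive n u (D : set borel) : index I n -> measurable D ->
  measurable_fun ([set` sitv (I n)] : set borel) (scale_derive (I n) u) ->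
  measurable_fun [set: borel] (family_derive u : borel -> R) ->
  (\int[dscale (I n)]_(x in D) ((family_derive u x) ^+ 2)%:E =
   \int[dscale (I n)]_(x in D `&` [set` sitv (I n)])
     ((scale_derive (I n) u x) ^+ 2)%:E)%E.
Proof.
move=> nI mD mu mf; have mi := measurable_inner (I n).
have ms := measurable_sitv (I n).
rewrite (@ge0_negligible_integral _ _ _ (dscale (I n)) D (D `\` inner (I n)))//=.
- rewrite [RHS](@ge0_negligible_integral _ _ _ (dscale (I n)) _ (D `\` inner (I n)))//=.
  + rewrite setDD (_ : (D `&` _) `\` _ = D `&` inner (I n)); last first.
      apply/seteqP; split => [x [[Dx _] nx]|x [Dx xn]].
        by split => //; apply: contrapT => ?; apply: nx.
      by split; [split => //; exact: inner_subset|case].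
    by apply: eq_integral => x; rewrite inE => -[_ xn]; rewrite (family_deriveE u nI xn).
  + exact: measurableD.
  + exact: measurableI.
  + apply/measurable_EFinP; apply: measurable_funX.
    by apply: (measurable_funS _ _ mu) => //; exact: subIsetr.
  + by move=> x _; rewrite lee_fin sqr_ge0.
  + apply/eqP; rewrite -measure_le0 -(dscale_not_inner (I n)).
    apply: le_measure; rewrite ?inE.
    * exact: measurableD.
    * exact: measurableC.
    * by move=> x [].
- exact: measurableD.
- by apply/measurable_EFinP; apply: measurable_funX; exact: measurable_funTS.
- by move=> x _; rewrite lee_fin sqr_ge0.
- apply/eqP; rewrite -measure_le0 -(dscale_not_inner (I n)).
    apply: le_measure; rewrite ?inE.
  + exact: measurableD.
  + exact: measurableC.
  + by move=> x [].
Qed.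

(** Each I_n contributes its own term because ds_n is carried by the interior of
    I_n, where the gathered derivative is du/ds_n. *)
Lemma family_energyE u :
  (forall n, index I n -> measurable_fun ([set` sitv (I n)] : set borel)
     (scale_derive (I n) u)) ->
  family_energy I u u =
  (2^-1%:E * \int[scale_measure I]_x ((family_derive u x) ^+ 2)%:E)%E.
Proof.
move=> mu; have mf := measurable_family_derive mu.
rewrite ge0_integral_scale_measure//; last 2 first.
  by apply/measurable_EFinP; apply: measurable_funX.
  by move=> x _; rewrite lee_fin sqr_ge0.
rewrite -nneseriesZl//; last first.
  by move=> n _; apply: integral_ge0 => x _; rewrite lee_fin sqr_ge0.
rewrite /family_energy; apply: eq_eseriesr => n; rewrite inE => nI.
by rewrite /scale_energy integral_dscale_derive ?setTI//; exact: mu.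
Qed.

End ScaleMeasure.

(** * Restricting the scale measure: transfer of functions and energies *)

Section Sufficiency.
Context {R : realType}.
Notation borel := (measurableTypeR R).
Variable m : {measure set borel -> \bar R}.
Variables I I' : interval_family R.
Hypothesis disjI : trivIset (index I) (fun n => [set` sitv (I n)]).
Hypothesis disjI' : trivIset (index I') (fun n => [set` sitv (I' n)]).
Hypothesis coarse : coarser I' I.
Variables (A : set borel) (mA : measurable A).
Hypothesis densA : forall B : set borel, measurable B ->
  scale_measure I' B = scale_measure I (A `&` B).

Section OneInterval.
Variables n k : nat.
Hypothesis nI : index I n.
Hypothesis kI : index I' k.
Hypothesis nk : [set` sitv (I n)] `<=` [set` sitv (I' k)].

Let innerS : inner (I n) `<=` inner (I' k).
Proof. exact: interiorS. Qed.

Let dscale_dens (B : set borel) : measurable B -> B `<=` [set` sitv (I n)] ->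
  dscale (I' k) B = dscale (I n) (A `&` B).
Proof.
move=> mB Bn; rewrite -(scale_measure_sub disjI' kI); last exact: subset_trans nk.
by rewrite densA// (scale_measure_sub disjI nI)// => x [_ /Bn].
Qed.

Lemma scale_le_density x y : x \in sitv (I n) -> y \in sitv (I n) -> x <= y ->
  scale (I' k) y - scale (I' k) x <= scale (I n) y - scale (I n) x.
Proof.
move=> xn yn xy.
rewrite -lee_fin -!dscale_itv//; try exact: nk.
rewrite dscale_dens//; last exact: sitv_segment.
by apply: le_measure; rewrite ?inE//; exact: measurableI.
Qed.

(** Put phi = s' \o s^-1. Almost everywhere on A the derivative of phi is 1, so
    that dv/ds = dv/ds'; the complement of A is ds'-null, so that dv/ds = 0
    almost everywhere there. *)
Lemma scale_derive_density v : scale_abs_continuous (I' k) v ->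
  {ae dscale (I n), forall x, inner (I n) x ->
    scale_derive (I n) v x = \1_A x * scale_derive (I' k) v x}.
Proof.
move=> acv.
have dphi : {ae dscale (I n), forall x, inner (I n) x ->
    is_derive (scale (I n) x) 1 (scale (I' k) \o scale_inv (I n)) (\1_A x)}.
  apply: is_derive_density => //.
  move=> x y xn yn; rewrite dscale_dens//; last first.
    by apply: sitv_segment; exact: inner_subset.
  by rewrite integral_indic.
have dnull : {ae dscale (I n), forall x, inner (I n) x ->
    (inner (I n) `\` A) x -> scale_derive (I n) v x = 0}.
  apply: (null_scale_derive nk acv).
    by apply: measurableD => //; exact: measurable_inner.
  rewrite dscale_dens; last 2 first.
    by apply: measurableD => //; exact: measurable_inner.
    by move=> x [/inner_subset].
  by rewrite setDE setICA setICr setI0 measure0.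
apply: ae_sub (ae_and dphi dnull) => x [dx nx] xn.
have [xA|xA] := pselect (A x); last first.
  by rewrite nx// indicE memNset// mul0r.
move: (dx xn); rewrite indicE mem_set// => dphix; rewrite mul1r.
have xn' := inner_subset xn; have xk' := nk xn'; have xk := innerS xn.
pose phi := scale (I' k) \o scale_inv (I n).
have phix : phi (scale (I n) x) = scale (I' k) x by rewrite /phi /= scaleK.
pose G := v \o scale_inv (I' k).
have -> : scale_derive (I' k) v x = derive1 G (phi (scale (I n) x)).
  by rewrite phix.
have near_inner_inv := near_scale_invK xn.
rewrite -(@derive1_comp_unit_speed _ G phi (scale (I n) \o scale_inv (I' k))) //.
- rewrite /scale_derive /=; apply: near_eq_derive1.
  apply: filterS near_inner_inv => z [zn _].
  by rewrite /G /phi /= scaleK//; apply: nk; exact: inner_subset.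
- apply: filterS near_inner_inv => z [zn zE].
  by rewrite /phi /= scaleK ?zE//; apply: nk; exact: inner_subset.
- rewrite phix.
  have : \forall y \near scale (I' k) x, inner (I n) (scale_inv (I' k) y).
    exact: near_scale_inv xk (near_inner xn).
  apply: filterS2 (near_scale_invK xk) => y [yk yE] yn.
  by rewrite /phi /= scaleK ?yE//; exact: inner_subset.
- apply: filterS near_inner_inv => z [zn zE].
  rewrite -zE; apply: continuous_comp; first exact: continuous_scale_inv.
  by rewrite scaleK; [apply: continuous_scale; exact: innerS|exact: inner_subset].
Qed.

(** If v = g \o s', then v = (g \o phi) \o s with phi increasing and
    1-Lipschitz. *)
Lemma scale_abs_continuous_density v :
  scale_abs_continuous (I' k) v -> scale_abs_continuous (I n) v.
Proof.
move=> [g acg vg]; exists (g \o (scale (I' k) \o scale_inv (I n))); last first.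
  by move=> x xn; rewrite /= scaleK// vg//; exact: nk.
move=> c d cdJ e e0.
have [dc|cd] := ltP d c.
  exists 1 => // -[|N] l r lr _ _; first by rewrite big_ord0.
  by have [cl lr0 rd] := lr ord0; have := le_trans cl (le_trans lr0 rd); rewrite leNgt dc.
have cJ : (scale (I n) @` [set` sitv (I n)]) c by apply: cdJ; rewrite /= in_itv /= lexx.
have dJ : (scale (I n) @` [set` sitv (I n)]) d.
  by apply: cdJ; rewrite /= in_itv /= lexx cd.
move: cJ dJ => [x xn xc] [y yn yd]; subst c d.
have xy : x <= y by rewrite -(scale_le xn yn).
have [|delta d0 dP] := acg (scale (I' k) x) (scale (I' k) y) _ e e0.
  move=> z; rewrite -scale_image_segment//; try exact: nk.
  by move=> [t txy <-]; exists t => //; apply: nk; exact: sitv_segment txy.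
exists delta => // N l r lr tlr slr.
have inJ t : scale (I n) x <= t <= scale (I n) y ->
    scale_inv (I n) t \in sitv (I n) /\ scale (I n) (scale_inv (I n) t) = t.
  by move=> txy; apply: scale_invK; apply: cdJ; rewrite /= in_itv.
have lP i : scale_inv (I n) (l i) \in sitv (I n) /\
    scale (I n) (scale_inv (I n) (l i)) = l i.
  by apply: inJ; have [-> lr1 ry] := lr i; rewrite (le_trans lr1).
have rP i : scale_inv (I n) (r i) \in sitv (I n) /\
    scale (I n) (scale_inv (I n) (r i)) = r i.
  by apply: inJ; have [xl lr1 ->] := lr i; rewrite (le_trans xl).
have phi_le a b : a \in sitv (I n) -> b \in sitv (I n) ->
    (scale (I' k) a <= scale (I' k) b) = (scale (I n) a <= scale (I n) b).
  by move=> aJ bJ; rewrite !scale_le//; exact: nk.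
apply: (dP N (fun i => scale (I' k) (scale_inv (I n) (l i)))
  (fun i => scale (I' k) (scale_inv (I n) (r i)))).
- move=> i; have [lJ lE] := lP i; have [rJ rE] := rP i; have [xl li ry] := lr i.
  by rewrite !phi_le// lE rE.
- move/trivIsetP : tlr => tlr; apply/trivIsetP => i j _ _ ij.
  have := tlr i j Logic.I Logic.I ij; rewrite -!subset0 => lrij z /=.
  have [liJ liE] := lP i; have [riJ riE] := rP i.
  have [ljJ ljE] := lP j; have [rjJ rjE] := rP j.
  move=> [/(scale_image_oo (nk liJ) (nk riJ))[t + <-]].
  rewrite /= !in_itv/= => /andP[lt tr].
  have tJ : t \in sitv (I n).
    by apply: (sitv_segment liJ riJ); rewrite /= in_itv /= !ltW.
  rewrite !scale_lt; try exact: nk.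
  move=> /andP[lt' tr']; apply: (lrij (scale (I n) t)); split => /=; rewrite in_itv/=.
    by rewrite -liE -riE !scale_lt// lt.
  by rewrite -ljE -rjE !scale_lt// lt'.
- apply: le_lt_trans slr; apply: ler_sum => i _.
  have [lJ lE] := lP i; have [rJ rE] := rP i; have [_ li _] := lr i.
  rewrite -{2}lE -{2}rE; apply: scale_le_density => //.
  by rewrite -(scale_le lJ rJ) lE rE.
Qed.

Let lendNyS : lend (I n) = -oo%E -> (-oo < scale_lend (I n))%E ->
  lend (I' k) = -oo%E /\ (-oo < scale_lend (I' k))%E.
Proof.
move=> ln /scale_lend_gtNy[c cP].
have [_ [y0 [_ _ y0n]]] := inner_nonempty (I n); have y0J := inner_subset y0n.
split.
  case E : (lend (I' k)) => [a| |] //.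
    have xn : Num.min y0 (a - 1) \in sitv (I n).
      by apply: (lendNy_closed ln y0J); rewrite ge_min lexx.
    have := lend_le (nk xn); rewrite E lee_fin le_min => /andP[_].
    by rewrite leNgt gtrBl ltr01.
  by have := lend_le (nk y0J); rewrite E.
apply/scale_lend_gtNy; exists (scale (I' k) y0 - (scale (I n) y0 - c)) => x xk.
have xk' := inner_subset xk; have y0k := nk y0J.
have yc : c <= scale (I n) y0 by exact: cP.
have [y0x|xy0] := leP y0 x.
  have : scale (I' k) y0 <= scale (I' k) x by rewrite scale_le.
  lra.
have xJ : x \in sitv (I n) by apply: (lendNy_closed ln y0J); exact: ltW.
have xn : inner (I n) x.
  apply: (@inner_between _ _ (x - 1) y0) => //.
    by apply: (lendNy_closed ln xJ); rewrite gerBl.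
  by rewrite gtrBl ltr01.
have := scale_le_density xJ y0J (ltW xy0); have := cP x xn.
lra.
Qed.

Let rendyS : rend (I n) = +oo%E -> (scale_rend (I n) < +oo)%E ->
  rend (I' k) = +oo%E /\ (scale_rend (I' k) < +oo)%E.
Proof.
move=> ln /scale_rend_lty[c cP].
have [_ [y0 [_ _ y0n]]] := inner_nonempty (I n); have y0J := inner_subset y0n.
split.
  case E : (rend (I' k)) => [a| |] //.
    have xn : Num.max y0 (a + 1) \in sitv (I n).
      by apply: (rendy_closed ln y0J); rewrite le_max lexx.
    have := rend_ge (nk xn); rewrite E lee_fin ge_max => /andP[_].
    by rewrite leNgt ltrDl ltr01.
  by have := rend_ge (nk y0J); rewrite E.
apply/scale_rend_lty; exists (scale (I' k) y0 + (c - scale (I n) y0)) => x xk.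
have xk' := inner_subset xk; have y0k := nk y0J.
have yc : scale (I n) y0 <= c by exact: cP.
have [xy0|y0x] := leP x y0.
  have : scale (I' k) x <= scale (I' k) y0 by rewrite scale_le.
  lra.
have xJ : x \in sitv (I n) by apply: (rendy_closed ln y0J); exact: ltW.
have xn : inner (I n) x.
  apply: (@inner_between _ _ y0 (x + 1)) => //.
    by apply: (rendy_closed ln xJ); rewrite lerDl.
  by rewrite y0x ltrDl ltr01.
have := scale_le_density y0J xJ (ltW y0x); have := cP x xn.
lra.
Qed.

Lemma scale_dom_density v : scale_dom m (I' k) v ->
  (\int[dscale (I n)]_(x in [set` sitv (I n)])
     ((scale_derive (I n) v x) ^+ 2)%:E < +oo)%E ->
  scale_dom m (I n) v.
Proof.
move=> [[mv v2] acv _ vl vr] dv2.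
have acv' := scale_abs_continuous_density acv.
have ms := measurable_sitv (I n); have ms' := measurable_sitv (I' k).
split => //.
- split; first exact: measurable_funS mv.
  apply: le_lt_trans v2; apply: ge0_subset_integral => //.
    by apply/measurable_EFinP; exact: measurable_funX.
  by move=> x _; rewrite lee_fin sqr_ge0.
- split => //; apply: measurable_scale_derive => x; rewrite inE => xn.
  exact: continuous_scale_abs_continuous acv' xn.
- by move=> ln sn; apply: vl; have [] := lendNyS ln sn.
- by move=> ln sn; apply: vr; have [] := rendyS ln sn.
Qed.

End OneInterval.

Lemma family_derive_density v : family_dom m I' v ->
  {ae scale_measure I, forall x,
    family_derive I v x = \1_A x * family_derive I' v x}.
Proof.
move=> [_ vI' _]; apply: ae_dscale_scale_measure => // n nI.
have [k kI nk] := coarse nI; have [_ acv _ _ _] := vI' k kI.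
apply: ae_sub (scale_derive_density nI kI nk acv) => x H xn.
by rewrite (family_deriveE disjI v nI xn) H// (@family_deriveE _ I' _ k)//;
  exact: interiorS nk _ xn.
Qed.

Let measurable_member_derive v : family_dom m I' v ->
  (forall k, index I' k ->
    measurable_fun ([set` sitv (I' k)] : set borel) (scale_derive (I' k) v)) /\
  (forall n, index I n ->
    measurable_fun ([set` sitv (I n)] : set borel) (scale_derive (I n) v)).
Proof.
move=> [_ vI' _]; split => [k /vI'[_ _ []]//|n nI].
have [k kI nk] := coarse nI; have [_ acv _ _ _] := vI' k kI.
apply: measurable_scale_derive => x; rewrite inE => xn.
apply: continuous_scale_abs_continuous xn.
exact: scale_abs_continuous_density nI kI nk v acv.
Qed.

(** Up to null sets dv/ds is dv/ds' times the indicator of A, and the second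
    scale measure is the restriction to A of the first one. *)
Lemma family_energy_density v : family_dom m I' v ->
  family_energy I v v = family_energy I' v v.
Proof.
move=> vI'; have [mv' mv] := measurable_member_derive vI'.
rewrite (family_energyE disjI mv) (family_energyE disjI' mv').
apply: (congr1 (mule 2^-1%:E)).
have mf := measurable_family_derive disjI mv.
have mf' := measurable_family_derive disjI' mv'.
have mA1 : measurable_fun [set: borel] (\1_A : borel -> R) by exact: measurable_indic.
pose q (w : R -> R) (x : borel) := ((w x) ^+ 2)%:E.
have mq : measurable_fun setT (q (family_derive I v)).
  by apply/measurable_EFinP; exact: measurable_funX.
have mq' : measurable_fun setT (q (family_derive I' v)).
  by apply/measurable_EFinP; exact: measurable_funX.
have q0 w x : setT x -> (0 <= q w x)%E by rewrite lee_fin sqr_ge0.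
rewrite -[LHS]/(\int[scale_measure I]_x q (family_derive I v) x)%E.
rewrite -[RHS]/(\int[scale_measure I']_x q (family_derive I' v) x)%E.
transitivity (\int[mrestr (scale_measure I) mA]_x q (family_derive I' v) x)%E; last first.
  by apply: eq_measure_integral => B mB _; rewrite densA// setIC.
rewrite (ge0_integral_mrestr _ _ measurableT mq' (q0 _)) setTI.
rewrite [RHS]integral_mkcond.
apply: ae_eq_integral => //.
- by apply/(measurable_restrictT _ _).1 => //; exact: measurable_funTS.
- apply: ae_sub (family_derive_density vI') => x vx _.
  rewrite patchE /q vx indicE; case: ifPn => xA; first by rewrite mul1r.
  by rewrite mul0r expr0n.
Qed.

Lemma family_dom_density v : family_dom m I' v -> family_dom m I v.
Proof.
move=> vI'; have [mv' mv] := measurable_member_derive vI'.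
have EE := family_energy_density vI'.
have [vL vdom vE] := vI'.
split; [exact: vL| |by rewrite EE].
move=> n nI; have [k kI nk] := coarse nI.
apply: (scale_dom_density nI kI nk (vdom k kI)).
have : (family_energy I v v < +oo)%E by rewrite EE.
rewrite /family_energy (@nneseriesD1 _ _ n); last 2 first.
- move=> i _; rewrite /scale_energy mule_ge0 ?lee_fin ?invr_ge0//.
  by apply: integral_ge0 => x _; rewrite lee_fin -expr2 sqr_ge0.
- by rewrite inE.
set S := (X in (_ + X)%E) => SE.
have S0 : (0 <= S)%E.
  apply: nneseries_ge0 => i _ _; rewrite /scale_energy mule_ge0 ?lee_fin ?invr_ge0//.
  by apply: integral_ge0 => x _; rewrite lee_fin -expr2 sqr_ge0.
have : (scale_energy (I n) v v < +oo)%E by apply: le_lt_trans SE; exact: leeDl.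
rewrite /scale_energy -[X in _ -> (X < _)%E]/(\int[dscale (I n)]_(x in [set` sitv (I n)])
  (scale_derive (I n) v x * scale_derive (I n) v x)%:E)%E.
rewrite !ltey; apply: contra_neq => ->.
by rewrite gt0_muley// lte_fin invr_gt0.
Qed.

End Sufficiency.

(** * Comparison of forms through their families *)

Section QuadraticForms.
Context {R : realType}.
Notation borel := (measurableTypeR R).
Variable m : {measure set borel -> \bar R}.
Implicit Types E : quad_form R.

Lemma form_diag_ae E u v : dirichlet_form m E -> dom E u -> dom E v ->
  (u = v %[ae m]) -> E u u = E v v.
Proof.
move=> dE uE vE uv.
by rewrite (form_ae dE uE vE uE uv) (form_sym dE vE uE) (form_ae dE uE vE vE uv).
Qed.

Lemma form_polarization E u v : dirichlet_form m E -> dom E u -> dom E v ->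
  E u v = (E (1 *: u + v) (1 *: u + v) - E u u - E v v) / 2.
Proof.
move=> dE uE vE; have uvE := dom_linear dE 1 uE vE.
have L w : dom E w -> E (1 *: u + v) w = E u w + E v w.
  by move=> wE; rewrite (form_linear dE)// mul1r.
rewrite (L _ uvE) (form_sym dE uE uvE) (form_sym dE vE uvE) !L//.
rewrite (form_sym dE vE uE); lra.
Qed.

Lemma represents_family_dom I E u : represents m I E -> family_dom m I u ->
  dom E u /\ (E u u)%:E = family_energy I u u.
Proof.
move=> [domE formE] uI; split; last exact: formE.
by apply/domE; have [uL _ _] := uI; split => //; exists u => //; exact: aeW.
Qed.

Variables (E E' : quad_form R) (I I' : interval_family R).
Hypothesis rE : regular_dirichlet_form m E.
Hypothesis rE' : regular_dirichlet_form m E'.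
Hypothesis repE : represents m I E.
Hypothesis repE' : represents m I' E'.

(** By polarization only energies E u u matter, and these do not depend on the
    version of u; both forms can thus be read on their families of intervals. *)
Lemma D_subspace_family :
  D_subspace m E' E <->
  forall u, family_dom m I' u -> exists2 v, family_dom m I v &
    u = v %[ae m] /\ family_energy I v v = family_energy I' u u.
Proof.
have [dE _ _] := rE; have [dE' _ _] := rE'.
split=> [[_ _ domS formS] u uI'|H].
  have [uE' eu] := represents_family_dom repE' uI'.
  have /repE.1[uL [v vI uv]] := domS u uE'.
  have [vE ev] := represents_family_dom repE vI.
  exists v; first exact: vI.
  split; first exact: uv.
  rewrite -ev -eu -(formS u u uE' uE').
  by rewrite (form_diag_ae dE (domS _ uE') vE uv).
have good u : dom E' u -> dom E u /\ E u u = E' u u.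
  move=> uE'; have /repE'.1[uL [w wI' uw]] := uE'.
  have [wE' ew] := represents_family_dom repE' wI'.
  have [v vI [wv ewv]] := H w wI'.
  have [vE ev] := represents_family_dom repE vI.
  have uv : u = v %[ae m] by apply: ae_eq_trans uw wv.
  have uE : dom E u by apply/repE.1; split; [exact: uL|exists v].
  split; first exact: uE.
  apply: EFin_inj.
  rewrite (form_diag_ae dE uE vE uv) (form_diag_ae dE' uE' wE' uw).
  by rewrite ev ew.
split => //; first by move=> u /good[].
move=> u v uE' vE'; have [uE eu] := good u uE'; have [vE ev] := good v vE'.
rewrite (form_polarization dE uE vE) (form_polarization dE' uE' vE').
by rewrite (good _ (dom_linear dE' 1 uE' vE')).2 eu ev.
Qed.

End QuadraticForms.

Section IndicatorDensity.
Context {R : realType}.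
Notation borel := (measurableTypeR R).

(** The set A is where the density is 1. *)
Lemma zero_one_density (mu nu : {measure set borel -> \bar R}) (f : R -> \bar R) :
  radon_nikodym_derivative nu mu f ->
  {ae mu, forall x, f x = 0%E \/ f x = 1%E} ->
  exists2 A : set borel, measurable A &
    forall B : set borel, measurable B -> nu B = mu (A `&` B).
Proof.
move=> [mf f0 fP] f01.
have mA : measurable ([set x | f x = 1%E] : set borel).
  rewrite -[X in measurable X]setTI.
  by apply: (mf measurableT [set 1%E]); exact: emeasurable_set1.
exists [set x | f x = 1%E] => // B mB.
rewrite fP// -(integral_indic mu mB mA); apply: ae_eq_integral => //.
- exact: measurable_funTS.
- by apply/measurable_EFinP; apply: measurable_funTS; exact: measurable_indic.
- apply: ae_sub f01 => x [] fx _; rewrite fx indicE.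
    rewrite memNset//= fx => /eqP; rewrite eqe => /eqP/esym/eqP.
    by rewrite oner_eq0.
  by rewrite mem_set.
Qed.

End IndicatorDensity.

(** * Test functions *)

Section TestFunctions.
Context {R : realType}.
Notation borel := (measurableTypeR R).
Implicit Types (m mu : {measure set borel -> \bar R}).

Lemma Lfun2_square_integrable m (u : borel -> R) :
  square_integrable m setT u -> u \in Lfun m 2%:E.
Proof.
move=> [mu u2]; apply/andP; split; rewrite inE//= /finite_norm unlock /=.
apply: poweR_lty; move: u2; congr (_ < _)%E; apply: eq_integral => x _.
by rewrite /= powR_mulrn ?normr_ge0// -normrX ger0_norm ?sqr_ge0.
Qed.

Lemma bounded_square_integrable m (u : borel -> R) (a b H : R) (D : set borel) :
  radon m -> measurable D -> measurable_fun [set: borel] u ->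
  (forall x, `|u x| <= H) -> (forall x, ~ (a <= x <= b) -> u x = 0) ->
  square_integrable m D u.
Proof.
move=> rm mD mu uH u0; split; first exact: measurable_funTS.
have mab : measurable (`[a, b]%classic : set borel) by exact: measurable_itv.
have H0 : 0 <= H by exact: le_trans (uH 0).
apply: (@le_lt_trans _ _ (\int[m]_(x in setT) ((H ^+ 2) * \1_`[a, b]%classic x)%:E)%E).
  apply: (@le_trans _ _ (\int[m]_x ((u x) ^+ 2)%:E)%E).
    apply: ge0_subset_integral => //; last by move=> x _; rewrite lee_fin sqr_ge0.
    by apply/measurable_EFinP; exact: measurable_funX.
  apply: ge0_le_integral => //.
  - by move=> x _; rewrite lee_fin sqr_ge0.
  - by apply/measurable_EFinP; exact: measurable_funX.
  - by apply/measurable_EFinP; apply: measurable_funM => //; exact: measurable_indic.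
  - move=> x _; rewrite lee_fin indicE mem_setE in_itv /=.
    have [axb|/negP nab] := boolP (a <= x <= b); last by rewrite u0// expr0n mulr0.
    by rewrite mulr1 -[leLHS]ger0_norm ?sqr_ge0// normrX lerXn2r ?nnegrE.
under eq_integral do rewrite EFinM.
rewrite ge0_integralZl//; last 2 first.
  by apply/measurable_EFinP; exact: measurable_indic.
  by rewrite lee_fin sqr_ge0.
rewrite integral_indic// setIT lte_mul_pinfty ?lee_fin ?sqr_ge0//.
by apply: rm; exact: segment_compact.
Qed.

(** A fully supported measure charges W near p, so that continuity carries the
    almost sure value over to p. With W an interval having p as an endpoint, this
    reads off one-sided values at p. *)
Lemma ae_cst_closure m (W : set R) (w : R -> R) (p c : R) :
  fully_supported m -> open W -> closure W p -> {for p, continuous w} ->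
  {ae m, forall x : R, W x -> w x = c} -> w p = c.
Proof.
move=> fm oW Wp cw [N [mN N0 WN]]; apply: contrapT => /eqP wpc.
have e0 : 0 < `|w p - c| by rewrite normr_gt0 subr_eq0.
have : \forall x \near p, `|w p - w x| < `|w p - c| by have /cvgrPdist_lt/(_ _ e0) := cw.
move=> /nbhs_ballP[r /= r0 rw].
have [z [Wz pz]] := Wp _ (nbhsx_ballx p _ r0).
have oV : open (W `&` ball p r) by apply: openI => //; exact: ball_open.
have V0 : (W `&` ball p r) !=set0 by exists z.
have := fm _ oV V0; rewrite ltNge => /negP; apply; rewrite -N0.
apply: le_measure; rewrite ?inE//; first exact: open_measurable.
move=> x [Wx px]; apply: WN => /= /(_ Wx) wx.
by have := rw x px; rewrite wx ltxx.
Qed.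

Lemma derive1_lipschitz (f : R -> R) (x : R) :
  (\forall y \near x, `|f y - f x| <= `|y - x|) -> `|derive1 f x| <= 1.
Proof.
move=> fx; have [df|ndf] := pselect (derivable f x 1); last first.
  by rewrite derive1_nonderivable// normr0.
have fl : h^-1 *: (f (h *: 1 + x) - f x) @[h --> 0^'] --> derive1 f x.
  by have := df; rewrite /derivable derive1E.
rewrite -(cvg_lim (@Rhausdorff R) (cvg_norm fl)); apply: limr_le.
- exact: cvgP (cvg_norm fl).
- have : \forall h \near (0 : R), `|f (h *: 1 + x) - f x| <= `|h|.
    have /nbhs_ballP[r /= r0 rf] := fx; apply/nbhs_ballP; exists r => // h.
    rewrite /ball /= sub0r normrN => hr; rewrite [_ *: 1]mulr1.
    have := rf (h + x); rewrite /ball /= addrK; apply.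
    by rewrite opprD addrCA subrr addr0 normrN.
  move=> /nbhs_dnbhs; apply: filterS2 (nbhs_dnbhs_neq (0:R)) => h h0 fh.
  by rewrite /= normrM normfV ler_pdivrMl ?normr_gt0// mulr1.
Qed.

End TestFunctions.

Section FamilyTestFunctions.
Context {R : realType}.
Notation borel := (measurableTypeR R).
Variable m : {measure set borel -> \bar R}.
Hypothesis radon_m : radon m.
Variable I : interval_family R.
Hypothesis disjI : trivIset (index I) (fun n => [set` sitv (I n)]).

Definition short_map (T : R -> R) := forall y z, `|T y - T z| <= `|y - z|.

Lemma scale_abs_continuous_short (J : scaled_interval R) (T u : R -> R) :
  short_map T -> {in sitv J, u =1 T \o scale J} -> scale_abs_continuous J u.
Proof.
move=> sT uT; exists T => // c d _ e e0; exists e => // N l r lr _ slr.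
apply: le_lt_trans slr; apply: ler_sum => i _.
by have [_ li _] := lr i; rewrite (le_trans (sT _ _))// ger0_norm// subr_ge0.
Qed.

(** As the derivative is bounded by the indicator of a set of finite scale
    measure, only absolute continuity has to be checked on each interval; the
    conditions at infinity hold because u vanishes there. *)
Lemma family_dom_bounded (u : R -> R) (a b H : R) (D : set borel) :
  measurable_fun [set: borel] (u : borel -> R) ->
  (forall x, `|u x| <= H) -> (forall x, ~ (a <= x <= b) -> u x = 0) ->
  (forall n, index I n -> scale_abs_continuous (I n) u) ->
  measurable D -> (scale_measure I D < +oo)%E ->
  (forall x, `|family_derive I u x| <= \1_D x) -> family_dom m I u.
Proof.
move=> mu uH u0 acu mD Doo uD.
have md n : index I n ->
    measurable_fun ([set` sitv (I n)] : set borel) (scale_derive (I n) u).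
  move=> nI; apply: measurable_scale_derive => x; rewrite inE.
  exact: continuous_scale_abs_continuous (acu n nI).
have mf := measurable_family_derive disjI md.
have msq : measurable_fun [set: borel]
    (fun x : borel => ((family_derive I u x) ^+ 2)%:E).
  by apply/measurable_EFinP; exact: measurable_funX.
have mD1 : measurable_fun [set: borel] (fun x : borel => (\1_D x : R)%:E).
  by apply/measurable_EFinP; exact: measurable_indic.
have sq_le x : setT x -> (((family_derive I u x) ^+ 2)%:E <= (\1_D x : R)%:E)%E.
  move=> _; rewrite lee_fin -[leLHS]ger0_norm ?sqr_ge0// normrX.
  have := uD x; rewrite indicE; case: (x \in D) => /= ux.
    by rewrite expr_le1.
  by move: ux; rewrite normr_le0 => /eqP->; rewrite normr0 expr0n.
have sq_ge0 x : setT x -> (0 <= ((family_derive I u x) ^+ 2)%:E)%E.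
  by rewrite lee_fin sqr_ge0.
have le_int (mu' : {measure set borel -> \bar R}) : (mu' D < +oo)%E ->
    (\int[mu']_x ((family_derive I u x) ^+ 2)%:E < +oo)%E.
  move=> D'oo; apply: le_lt_trans D'oo.
  rewrite -[leRHS](_ : \int[mu']_x (\1_D x)%:E = _)%E.
    by apply: ge0_le_integral => // x _; rewrite lee_fin.
  by rewrite integral_indic// setIT.
split.
- apply: Lfun2_square_integrable.
  exact: (bounded_square_integrable radon_m _ mu uH u0).
- move=> n nI; split.
  + apply: (bounded_square_integrable radon_m _ mu uH u0).
    exact: measurable_sitv.
  + exact: acu.
  + split; first exact: md.
    rewrite -[X in (\int[_]_(_ in X) _)%E]setTI.
    rewrite -(integral_dscale_derive disjI nI measurableT (md n nI) mf).
    apply: le_int; apply: le_lt_trans Doo; exact: dscale_le_scale_measure.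
  + move=> _ _ _; apply: cvg_near_cst; near=> x.
    apply: u0 => /andP[ax _]; have : x < a.
      by near: x; apply: nbhs_ninfty_lt; exact: num_real.
    by rewrite ltNge ax.
  + move=> _ _ _; apply: cvg_near_cst; near=> x.
    apply: u0 => /andP[_ xb]; have : b < x.
      by near: x; apply: nbhs_pinfty_gt; exact: num_real.
    by rewrite ltNge xb.
- rewrite (family_energyE disjI md) lte_mul_pinfty ?lee_fin ?invr_ge0//.
  exact: le_int.
Unshelve. all: by end_near. Qed.

Variable k : nat.
Hypothesis kI : index I k.
Variable T : R -> R.
Hypothesis shortT : short_map T.

Definition test_function : R -> R :=
  (fun x => T (scale (I k) x)) \_ [set` sitv (I k)].

Lemma test_functionE x : x \in sitv (I k) -> test_function x = T (scale (I k) x).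
Proof. by move=> xk; rewrite /test_function patchE mem_set. Qed.

Lemma test_function_out x : ~ (x \in sitv (I k)) -> test_function x = 0.
Proof. by move=> xk; rewrite /test_function patchE memNset. Qed.

Lemma near_test_function x (t : R -> R) : inner (I k) x ->
  (\forall y \near scale (I k) x, T y = t y) ->
  \forall z \near x, test_function z = t (scale (I k) z).
Proof.
move=> xk Tt; have := continuous_scale xk Tt.
apply: filterS2 (near_inner xk) => z zk; rewrite /= => <-.
by apply: test_functionE; exact: inner_subset.
Qed.

(** No continuity is asked at the endpoints of I_k, where the test function may
    jump to the value 0 that it takes outside. *)
Lemma family_dom_test (a b H x0 x1 : R) :
  (forall y, `|T y| <= H) ->
  (forall x, x \in sitv (I k) -> ~ (a <= x <= b) -> T (scale (I k) x) = 0) ->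
  x0 \in sitv (I k) -> x1 \in sitv (I k) ->
  (forall x, inner (I k) x -> ~ (x0 <= x <= x1) ->
    \forall y \near scale (I k) x, T y = T (scale (I k) x)) ->
  family_dom m I test_function.
Proof.
move=> TH T0 x0k x1k Tcst.
have mk := measurable_sitv (I k).
have cT : continuous T.
  move=> y; apply/cvgrPdist_lt => e e0; apply/nbhs_ballP; exists e => // z.
  by rewrite /ball /= => yz; rewrite (le_lt_trans (shortT _ _)).
have mT : measurable_fun [set: borel] (T : borel -> R).
  exact: continuous_measurable_fun.
have H0 : 0 <= H by exact: le_trans (TH 0).
apply: (@family_dom_bounded _ a b H `[x0, x1]%classic).
- apply/(measurable_restrictT _ _).1 => //.
  apply: (measurable_comp measurableT) => //.
  exact: measurable_scale.
- by move=> x; rewrite /test_function patchE; case: ifPn; rewrite ?normr0.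
- move=> x nx; have [xk|xk] := pselect (x \in sitv (I k)).
    by rewrite test_functionE// T0.
  exact: test_function_out.
- move=> n nI; have [->|nk] := eqVneq n k.
    by apply: scale_abs_continuous_short shortT _ => x /test_functionE.
  apply: (@scale_abs_continuous_short _ (cst 0)).
    by move=> y z; rewrite subrr normr0.
  move=> x xn; apply: test_function_out => xk.
  by move: nk; rewrite (sitv_disjoint disjI nI kI xn xk) eqxx.
- exact: measurable_itv.
- rewrite (scale_measure_sub disjI kI); last exact: sitv_segment.
  exact: dscale_segment_lty.
- move=> x; have [[n nI xn]|nx] := pselect (inner_family I x); last first.
    by rewrite family_derive_out// normr0 indicE.
  rewrite (family_deriveE disjI _ nI xn).
  have [nk|nk] := eqVneq n k; last first.
    rewrite (near_cst_scale_derive (c := 0) xn) ?normr0 ?indicE//.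
    apply: filterS (near_inner xn) => z zn; apply: test_function_out => zk.
    by move: nk; rewrite (sitv_disjoint disjI nI kI (inner_subset zn) zk) eqxx.
  rewrite nk in xn nI *.
  have [x01|nx01] := pselect (x0 <= x <= x1); last first.
    rewrite (near_cst_scale_derive (c := T (scale (I k) x)) xn) ?normr0 ?indicE//.
    exact: near_test_function (Tcst x xn nx01).
  rewrite indicE mem_set ?in_itv//=; apply: derive1_lipschitz.
  have near_u : \forall z \near scale (I k) x, test_function (scale_inv (I k) z) = T z.
    apply: filterS (near_scale_invK xn) => z [zk zE].
    by rewrite test_functionE ?zE//; exact: inner_subset.
  have u_x := nbhs_singleton near_u.
  by apply: filterS near_u => z; rewrite /= => ->; rewrite u_x.
Qed.

End FamilyTestFunctions.

(** * Inclusion of interiors *)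

Section ShortMaps.
Context {R : realType}.
Implicit Types f g : R -> R.

Lemma short_map_cst (c : R) : short_map (fun=> c).
Proof. by move=> y z; rewrite subrr normr0. Qed.

Lemma short_map_subr (c : R) : short_map (fun z => z - c).
Proof. by move=> y z; rewrite opprD addrACA subrr addr0. Qed.

Lemma short_map_subl (c : R) : short_map (fun z => c - z).
Proof. by move=> y z; rewrite opprD addrACA subrr add0r -opprD normrN. Qed.

Lemma short_map_min f g : short_map f -> short_map g ->
  short_map (fun z => Num.min (f z) (g z)).
Proof.
move=> sf sg y z; have := sf y z; have := sg y z; rewrite !ler_norml.
by case: (leP (f y) (g y)); case: (leP (f z) (g z)); lra.
Qed.

Lemma short_map_max f g : short_map f -> short_map g ->
  short_map (fun z => Num.max (f z) (g z)).
Proof.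
move=> sf sg y z; have := sf y z; have := sg y z; rewrite !ler_norml.
by case: (leP (f y) (g y)); case: (leP (f z) (g z)); lra.
Qed.

End ShortMaps.

Section InteriorInclusion.
Context {R : realType}.
Notation borel := (measurableTypeR R).
Variable m : {measure set borel -> \bar R}.
Hypothesis radon_m : radon m.
Hypothesis full_m : fully_supported m.
Variables I I' : interval_family R.
Hypothesis disjI : trivIset (index I) (fun n => [set` sitv (I n)]).
Hypothesis disjI' : trivIset (index I') (fun n => [set` sitv (I' n)]).
Hypothesis sub_dom : forall u, family_dom m I' u -> exists2 v, family_dom m I v &
  u = v %[ae m] /\ family_energy I v v = family_energy I' u u.

Let closure_left (p e : R) : 0 < e -> closure (`]p - e, p[%classic : set R) p.
Proof.
move=> e0 A /nbhs_ballP[r /= r0 rA].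
pose d := Num.min (r / 2) (e / 2).
have d0 : 0 < d by rewrite lt_min !divr_gt0.
have dr : d <= r / 2 by rewrite ge_min lexx.
have de : d <= e / 2 by rewrite ge_min lexx orbT.
exists (p - d); split; first by rewrite /= in_itv /=; lra.
by apply: rA; rewrite /ball /= opprB addrC subrK gtr0_norm//; lra.
Qed.

Let closure_right (p e : R) : 0 < e -> closure (`]p, p + e[%classic : set R) p.
Proof.
move=> e0 A /nbhs_ballP[r /= r0 rA].
pose d := Num.min (r / 2) (e / 2).
have d0 : 0 < d by rewrite lt_min !divr_gt0.
have dr : d <= r / 2 by rewrite ge_min lexx.
have de : d <= e / 2 by rewrite ge_min lexx orbT.
exists (p + d); split; first by rewrite /= in_itv /=; lra.
by apply: rA; rewrite /ball /= opprD addNKr normrN gtr0_norm//; lra.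
Qed.

(** Functions of the larger domain are continuous inside I_n. *)
Lemma family_dom_no_jump u n (p e c1 c2 : R) : family_dom m I' u ->
  index I n -> inner (I n) p -> 0 < e ->
  (forall x, p - e < x < p -> u x = c1) ->
  (forall x, p < x < p + e -> u x = c2) -> c1 = c2.
Proof.
move=> uI' nI pn e0 u1 u2; have [v [_ vI _] [uv _]] := sub_dom uI'.
have [_ acv _ _ _] := vI n nI.
have cv := continuous_scale_abs_continuous acv pn.
have vp1 : v p = c1.
  apply: (ae_cst_closure full_m (@itv_open _ _ (p - e) p)) => //.
    exact: closure_left.
  apply: ae_sub uv => x uvx; rewrite /= in_itv /= => xp.
  by rewrite -uvx ?u1.
have vp2 : v p = c2.
  apply: (ae_cst_closure full_m (@itv_open _ _ p (p + e))) => //.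
    exact: closure_right.
  apply: ae_sub uv => x uvx; rewrite /= in_itv /= => xp.
  by rewrite -uvx ?u2.
by rewrite -vp1 vp2.
Qed.

Let meets_right k n x y : index I' k -> index I n ->
  inner (I n) x -> inner (I n) y -> x \in sitv (I' k) -> x <= y -> y \in sitv (I' k).
Proof.
move=> kI nI xn yn xk xy; apply: contrapT => yk.
have [x0 [x1 [x01 x0i x1i]]] := inner_nonempty (I' k).
have x0k := inner_subset x0i; have x1k := inner_subset x1i.
have ub : ubound [set` sitv (I' k)] y.
  move=> z zk; rewrite leNgt; apply/negP => yz; apply: yk.
  by apply: (interval_is_interval xk zk); rewrite xy ltW.
have k0 : [set` sitv (I' k)] !=set0 by exists x.
pose p := sup [set` sitv (I' k)].
have lep z : z \in sitv (I' k) -> z <= p by move=> zk; apply: ub_le_sup => //; exists y.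
have py : p <= y by exact: ge_sup.
have pn : inner (I n) p.
  by apply: (inner_segment xn yn); rewrite /= in_itv /= lep.
have below w : x1 < w < p -> w \in sitv (I' k).
  move=> /andP[x1w /(sup_gt k0)[t tk wt]].
  by apply: (interval_is_interval x1k tk); rewrite !ltW.
have x1p : x1 < p.
  have [_ [b [_ bk /andP[_ x1b]]]] := (innerP _ _).1 x1i.
  exact: lt_le_trans (lep _ bk).
(* T rises from 0 to H along s' between x0 and x1 and then stays at H up to p. *)
pose c := scale (I' k) x0; pose H := scale (I' k) x1 - c.
have H0 : 0 < H by rewrite subr_gt0 scale_lt.
pose T z := Num.max 0 (Num.min (z - c) H).
have sT : short_map T.
  apply: short_map_max; first exact: short_map_cst.
  by apply: short_map_min; [exact: short_map_subr|exact: short_map_cst].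
have Tle z : z <= c -> T z = 0.
  by move=> zc; rewrite /T; case: (leP (z - c) H); case: (leP 0); lra.
have Tge z : scale (I' k) x1 <= z -> T z = H.
  by move=> zc; rewrite /T /H in H0 *; case: (leP (z - c)) => ?; case: leP; lra.
have uI' : family_dom m I' (test_function I' k T).
  apply: (family_dom_test radon_m disjI' kI sT (a := x0) (b := p) (H := H)
    (x0 := x0) (x1 := x1)) => //.
  - by move=> z; rewrite ger0_norm /T ?le_max ?lexx// ge_max (ltW H0) ge_min lexx orbT.
  - move=> z zk zp; apply: Tle; rewrite /c scale_le// leNgt; apply/negP => x0z.
    by apply: zp; rewrite (ltW x0z) lep.
  - move=> z zi nz; have zk := inner_subset zi.
    have [zx0|x0z] := ltP z x0.
      have : scale (I' k) z < c by rewrite scale_lt.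
      move=> zc; have := lt_nbhsl zc; apply: filterS => t tc.
      by rewrite !Tle// ltW.
    have x1z : x1 < z by rewrite ltNge; apply/negP => zx1; apply: nz; rewrite x0z.
    have : scale (I' k) x1 < scale (I' k) z by rewrite scale_lt.
    move=> zc; have := lt_nbhsr zc; apply: filterS => t tc.
    by rewrite !Tge// ltW.
suff : H = 0 by move=> H00; rewrite H00 ltxx in H0.
apply: (family_dom_no_jump uI' nI pn (e := p - x1)); first by rewrite subr_gt0.
- move=> w; rewrite opprB addrC subrK => wp.
  have wk := below _ wp; rewrite test_functionE//.
  by apply: Tge; rewrite scale_le//; case/andP: wp => /ltW.
- move=> w /andP[pw _]; apply: test_function_out => /lep.
  by rewrite leNgt pw.
Qed.

Let meets_left k n x y : index I' k -> index I n ->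
  inner (I n) x -> inner (I n) y -> x \in sitv (I' k) -> y <= x -> y \in sitv (I' k).
Proof.
move=> kI nI xn yn xk yx; apply: contrapT => yk.
have [x0 [x1 [x01 x0i x1i]]] := inner_nonempty (I' k).
have x0k := inner_subset x0i; have x1k := inner_subset x1i.
have lb : lbound [set` sitv (I' k)] y.
  move=> z zk; rewrite leNgt; apply/negP => zy; apply: yk.
  by apply: (interval_is_interval zk xk); rewrite yx ltW.
have k0 : [set` sitv (I' k)] !=set0 by exists x.
pose p := inf [set` sitv (I' k)].
have gep z : z \in sitv (I' k) -> p <= z by move=> zk; apply: ge_inf => //; exists y.
have py : y <= p by exact: lb_le_inf.
have pn : inner (I n) p.
  by apply: (inner_segment yn xn); rewrite /= in_itv /= gep// py.
have above w : p < w < x0 -> w \in sitv (I' k).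
  move=> /andP[/(inf_lt k0)[t tk tw] wx0].
  by apply: (interval_is_interval tk x0k); rewrite !ltW.
have px0 : p < x0.
  have [a [_ [ak _ /andP[ax0 _]]]] := (innerP _ _).1 x0i.
  exact: le_lt_trans (gep _ ak) _.
pose c := scale (I' k) x1; pose H := c - scale (I' k) x0.
have H0 : 0 < H by rewrite subr_gt0 scale_lt.
pose T z := Num.max 0 (Num.min (c - z) H).
have sT : short_map T.
  apply: short_map_max; first exact: short_map_cst.
  by apply: short_map_min; [exact: short_map_subl|exact: short_map_cst].
have Tge z : c <= z -> T z = 0.
  by move=> zc; rewrite /T; case: (leP (c - z) H); case: (leP 0); lra.
have Tle z : z <= scale (I' k) x0 -> T z = H.
  by move=> zc; rewrite /T /H in H0 *; case: (leP (c - z)) => ?; case: leP; lra.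
have uI' : family_dom m I' (test_function I' k T).
  apply: (family_dom_test radon_m disjI' kI sT (a := p) (b := x1) (H := H)
    (x0 := x0) (x1 := x1)) => //.
  - by move=> z; rewrite ger0_norm /T ?le_max ?lexx// ge_max (ltW H0) ge_min lexx orbT.
  - move=> z zk zp; apply: Tge; rewrite /c scale_le// leNgt; apply/negP => zx1.
    by apply: zp; rewrite (ltW zx1) gep.
  - move=> z zi nz; have zk := inner_subset zi.
    have [x1z|zx1] := ltP x1 z.
      have : c < scale (I' k) z by rewrite scale_lt.
      move=> zc; have := lt_nbhsr zc; apply: filterS => t tc.
      by rewrite !Tge// ltW.
    have zx0 : z < x0 by rewrite ltNge; apply/negP => x0z; apply: nz; rewrite x0z.
    have : scale (I' k) z < scale (I' k) x0 by rewrite scale_lt.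
    move=> zc; have := lt_nbhsl zc; apply: filterS => t tc.
    by rewrite !Tle// ltW.
suff : 0 = H by move=> H00; rewrite -H00 ltxx in H0.
apply: (family_dom_no_jump uI' nI pn (e := x0 - p)); first by rewrite subr_gt0.
- move=> w /andP[_ wp]; apply: test_function_out => /gep.
  by rewrite leNgt wp.
- move=> w; rewrite addrC subrK => wp.
  have wk := above _ wp; rewrite test_functionE//.
  by apply: Tle; rewrite scale_le//; case/andP: wp => _ /ltW.
Qed.

Let meets n : index I n -> exists2 k, index I' k &
  exists2 x, inner (I n) x & x \in sitv (I' k).
Proof.
move=> nI; apply: contrapT => nex.
have [x0 [x1 [x01 x0n x1n]]] := inner_nonempty (I n).
have out k x : index I' k -> x0 <= x <= x1 -> ~ (x \in sitv (I' k)).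
  move=> kI xx xk; apply: nex; exists k => //; exists x => //.
  by apply: (inner_segment x0n x1n); rewrite /= in_itv.
have m01 : measurable (`[x0, x1]%classic : set borel) by exact: measurable_itv.
pose u : R -> R := \1_(`[x0, x1]%classic).
have uE x : u x = (x0 <= x <= x1)%R%:R by rewrite /u indicE mem_setE in_itv.
have u0 k : index I' k -> {in sitv (I' k), u =1 cst 0}.
  move=> kI x xk; rewrite uE; have [xx|//] := boolP (x0 <= x <= x1).
  by have := out k x kI xx xk.
have uI' : family_dom m I' u.
  apply: (@family_dom_bounded _ m radon_m I' disjI' u x0 x1 1 set0) => //.
  - exact: measurable_indic.
  - by move=> x; rewrite uE; case: (_ <= _ <= _); rewrite ?normr0 ?normr1.
  - by move=> x /negP xx; rewrite uE (negbTE xx).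
  - move=> k kI; apply: (@scale_abs_continuous_short _ _ (cst 0)).
      exact: short_map_cst.
    exact: u0.
  - by rewrite measure0.
  - move=> x; have [[k kI xk]|nx] := pselect (inner_family I' x); last first.
      by rewrite family_derive_out// normr0 indicE.
    rewrite (family_deriveE disjI' _ kI xk).
    rewrite (near_cst_scale_derive (c := 0) xk) ?normr0 ?indicE//.
    apply: filterS (near_inner xk) => z zk; apply: (u0 k) => //.
    exact: inner_subset.
suff /eqP : (0 : R) = 1 by rewrite eq_sym oner_eq0.
apply: (family_dom_no_jump uI' nI x0n (e := x1 - x0)); first by rewrite subr_gt0.
- by move=> x /andP[_ xx0]; rewrite uE leNgt xx0.
- by move=> x /andP[x0x]; rewrite addrC subrK => xx1; rewrite uE !ltW.
Qed.

(** Otherwise some function that jumps inside I_n has finite energy along the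
    second family: the cut-off of a test function at an endpoint of an interval of
    that family, or the indicator of a segment that no such interval meets. *)
Lemma inner_inclusion n : index I n ->
  exists2 k, index I' k & inner (I n) `<=` inner (I' k).
Proof.
move=> nI; have [k kI [x xn xk]] := meets nI; exists k => //.
rewrite -open_subsetE; last exact: open_inner.
move=> y yn /=; have [xy|/ltW yx] := leP x y.
  exact: (meets_right kI nI xn yn).
exact: (meets_left kI nI xn yn).
Qed.

End InteriorInclusion.

(** * Energies of tents *)

Section Speed.
Context {R : realType}.
Notation borel := (measurableTypeR R).
Variable m : {measure set borel -> \bar R}.
Hypothesis radon_m : radon m.
Hypothesis full_m : fully_supported m.
Variables I I' : interval_family R.
Hypothesis disjI : trivIset (index I) (fun n => [set` sitv (I n)]).
Hypothesis disjI' : trivIset (index I') (fun n => [set` sitv (I' n)]).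
Hypothesis sub_dom : forall u, family_dom m I' u -> exists2 v, family_dom m I v &
  u = v %[ae m] /\ family_energy I v v = family_energy I' u u.

(** The scale functions of the second family, gathered into one function. *)
Definition family_scale (x : R) : R := scale (I' (member_at I' x)) x.

Lemma family_scaleE k x : index I' k -> inner (I' k) x ->
  family_scale x = scale (I' k) x.
Proof.
move=> kI xk; rewrite /family_scale; suff -> : member_at I' x = k by [].
rewrite /member_at; case: xgetP => [j _ [jI xj]|/(_ k)[]//].
exact: (sitv_disjoint disjI' jI kI (inner_subset xj) (inner_subset xk)).
Qed.

Lemma near_family_scale k x : index I' k -> inner (I' k) x ->
  \forall z \near x, family_scale z = scale (I' k) z.
Proof.
by move=> kI xk; apply: filterS (near_inner xk) => z; exact: family_scaleE.
Qed.

(** The square of ds'/ds. It turns out to be the density of the second scale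
    measure with respect to the first one. *)
Definition speed (x : R) : R := (family_derive I family_scale x) ^+ 2.

Lemma speed_ge0 x : 0 <= speed x.
Proof. exact: sqr_ge0. Qed.

Lemma measurable_speed : measurable_fun [set: borel] (speed : borel -> R).
Proof.
apply: measurable_funX; apply: measurable_family_derive => // n nI.
apply: measurable_scale_derive => x; rewrite inE => xn.
have [k kI nk] := inner_inclusion radon_m full_m disjI' sub_dom nI.
have cs := continuous_scale (nk _ xn).
rewrite /continuous_at (family_scaleE kI (nk _ xn)).
apply: cvg_trans cs; apply: near_eq_cvg.
by apply: filterS (near_family_scale kI (nk _ xn)) => z ->.
Qed.

Let speed_integral (D : set borel) : \bar R :=
  (\int[scale_measure I]_(x in D) (speed x)%:E)%E.

Let family_derive_eq u v : (forall n x, index I n -> inner (I n) x -> u x = v x) ->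
  family_derive I u = family_derive I v.
Proof.
move=> uv; apply/funext => x.
have [[n nI xn]|nx] := pselect (inner_family I x); last by rewrite !family_derive_out.
rewrite !(family_deriveE disjI _ nI xn); apply: (near_eq_scale_derive xn).
by apply: filterS (near_inner xn) => z; exact: uv.
Qed.

Let measurable_member u n : family_dom m I u -> index I n ->
  measurable_fun ([set` sitv (I n)] : set borel) (scale_derive (I n) u).
Proof. by move=> [_ uI _] /uI[_ _ []]. Qed.

Let measurable_member' u n : family_dom m I' u -> index I' n ->
  measurable_fun ([set` sitv (I' n)] : set borel) (scale_derive (I' n) u).
Proof. by move=> [_ uI _] /uI[_ _ []]. Qed.

Let half_inj (a b : \bar R) : (2^-1%:E * a = 2^-1%:E * b)%E -> a = b.
Proof.
move=> /(congr1 (mule 2%:E)); rewrite !muleA -EFinM divff; last by rewrite pnatr_eq0.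
by rewrite !mul1e.
Qed.

Let energy_transfer u : family_dom m I' u ->
  measurable_fun [set: borel] (family_derive I u : borel -> R) /\
  (\int[scale_measure I]_x ((family_derive I u x) ^+ 2)%:E =
   \int[scale_measure I']_x ((family_derive I' u x) ^+ 2)%:E)%E.
Proof.
move=> uI'; have [v vI [uv]] := sub_dom uI'.
have vu : family_derive I v = family_derive I u.
  apply: family_derive_eq => n x nI xn.
  have [_ vdom _] := vI; have [_ acv _ _ _] := vdom n nI.
  have cv := continuous_scale_abs_continuous acv xn.
  have [k kI nk] := inner_inclusion radon_m full_m disjI' sub_dom nI.
  have [_ udom _] := uI'; have [_ acu _ _ _] := udom k kI.
  have cu := continuous_scale_abs_continuous acu (nk _ xn).
  have : v x - u x = 0.
    apply: (ae_cst_closure full_m (@open_inner R (I n))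
      (w := fun x => v x - u x) (p := x)).
    - exact: subset_closure.
    - exact: cvgB.
    - by apply: ae_sub uv => z uvz _; rewrite uvz// subrr.
  by move/eqP; rewrite subr_eq0 => /eqP.
rewrite (family_energyE disjI (fun n => measurable_member vI)).
rewrite (family_energyE disjI' (fun n => measurable_member' uI')).
rewrite vu => /half_inj EE; split; last exact: EE.
rewrite -vu.
exact: (measurable_family_derive disjI (fun n => measurable_member vI)).
Qed.

Section Tent.
Variables (k : nat) (x0 x1 x2 x3 : R).
Hypothesis kI : index I' k.
Hypotheses (x0k : inner (I' k) x0) (x3k : inner (I' k) x3).
Hypotheses (x01 : x0 < x1) (x12 : x1 <= x2) (x23 : x2 < x3).
Let s := scale (I' k).
Hypothesis same_height : s x1 - s x0 = s x3 - s x2.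

(* The tent T \o s' has slope 1 along s' on ]x0, x1], slope -1 on ]x2, x3], and
   slope 0 elsewhere. *)
Let H := s x1 - s x0.
Let T (z : R) := Num.max 0 (Num.min (Num.min (z - s x0) H) (s x3 - z)).
Let u := test_function I' k T.
Let slopes : set borel := `]x0, x1]%classic `|` `]x2, x3]%classic.

Let x03k x : x0 <= x <= x3 -> inner (I' k) x.
Proof. by move=> xx; apply: (inner_segment x0k x3k); rewrite /= in_itv. Qed.

Let sitvk x : x0 <= x <= x3 -> x \in sitv (I' k).
Proof. by move=> /x03k/inner_subset. Qed.

Let x0i : x0 \in sitv (I' k).
Proof. by apply: sitvk; move: x01 x12 x23; lra. Qed.
Let x1i : x1 \in sitv (I' k).
Proof. by apply: sitvk; move: x01 x12 x23; lra. Qed.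
Let x2i : x2 \in sitv (I' k).
Proof. by apply: sitvk; move: x01 x12 x23; lra. Qed.
Let x3i : x3 \in sitv (I' k).
Proof. by apply: sitvk; move: x01 x12 x23; lra. Qed.
Let s01 : s x0 < s x1. Proof. by rewrite scale_lt. Qed.
Let s12 : s x1 <= s x2. Proof. by rewrite scale_le. Qed.
Let s23 : s x2 < s x3. Proof. by rewrite scale_lt. Qed.

Let T_out z : z <= s x0 \/ s x3 <= z -> T z = 0.
Proof.
move=> zP; rewrite /T; apply/max_l; rewrite !ge_min.
by case: zP => zP; apply/orP; [left; apply/orP; left|right]; lra.
Qed.

Let T_up z : s x0 <= z <= s x1 -> T z = z - s x0.
Proof.
move=> zP; have := same_height; have := s12; have := s23; move=> ? ? ?.
rewrite /T (@min_l _ _ (z - s x0) H); last by rewrite /H; lra.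
by rewrite min_l ?max_r//; lra.
Qed.

Let T_flat z : s x1 <= z <= s x2 -> T z = H.
Proof.
move=> zP; have := same_height; have := s01; have := s12; have := s23; move=> ? ? ? ?.
rewrite /T (@min_r _ _ (z - s x0) H); last by rewrite /H; lra.
by rewrite min_l ?max_r// /H; lra.
Qed.

Let T_down z : s x2 <= z <= s x3 -> T z = s x3 - z.
Proof.
move=> zP; have := same_height; have := s01; have := s12; have := s23; move=> ? ? ? ?.
rewrite /T (@min_r _ _ (z - s x0) H); last by rewrite /H; lra.
by rewrite min_r ?max_r// /H; lra.
Qed.

Let u_dom : family_dom m I' u.
Proof.
have H0 : 0 <= H by rewrite /H subr_ge0 ltW.
apply: (family_dom_test radon_m disjI' kI _ (a := x0) (b := x3) (H := H)
  (x0 := x0) (x1 := x3)) => //.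
- apply: short_map_max; first exact: short_map_cst.
  apply: short_map_min; last exact: short_map_subl.
  by apply: short_map_min; [exact: short_map_subr|exact: short_map_cst].
- by move=> z; rewrite ger0_norm /T ?le_max ?lexx// ge_max H0 !ge_min lexx orbT.
- move=> x xk nx; apply: T_out; rewrite !scale_le//.
  have [xx0|x0x] := leP x x0; [by left|right].
  by rewrite leNgt; apply/negP => xx3; apply: nx; rewrite !ltW.
- move=> x xi nx; have xk := inner_subset xi.
  have [xx0|x0x] := ltP x x0.
    have sx : s x < s x0 by rewrite scale_lt.
    apply: filterS (lt_nbhsl sx) => z zs.
    by rewrite !T_out//; left; apply: ltW.
  have xx3 : x3 < x by rewrite ltNge; apply/negP => xx3; apply: nx; rewrite x0x.
  have sx : s x3 < s x by rewrite scale_lt.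
  apply: filterS (lt_nbhsr sx) => z zs.
  by rewrite !T_out//; right; apply: ltW.
Qed.

Let near_between (a b x : R) (P : R -> Prop) : a < x < b ->
  (forall z, a < z < b -> P z) -> \forall z \near x, P z.
Proof.
move=> axb abP; have : \forall z \near x, z \in `]a, b[.
  by apply: near_in_itvoo; rewrite in_itv.
by apply: filterS => z; rewrite in_itv; exact: abP.
Qed.

Let u_out x : x < x0 \/ x3 < x -> u x = 0.
Proof.
move=> xx; have [xk|xk] := pselect (x \in sitv (I' k)); last exact: test_function_out.
rewrite /u test_functionE//; apply: T_out.
by rewrite !scale_le//; case: xx => /ltW; [left|right].
Qed.

Let derive_u (F : interval_family R) x :
  trivIset (index F) (fun n => [set` sitv (F n)]) ->
  x \notin [:: x0; x1; x2; x3] ->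
  (family_derive F u x) ^+ 2 = \1_slopes x * (family_derive F family_scale x) ^+ 2.
Proof.
move=> disjF; rewrite !inE !negb_or => /and4P[n0 n1 n2 n3].
have [[n nF xn]|nx] := pselect (inner_family F x); last first.
  by rewrite !family_derive_out// expr0n mulr0.
rewrite !(family_deriveE disjF _ nF xn).
have slopesE : \1_slopes x = ((x0 < x <= x1) || (x2 < x <= x3))%R%:R :> R.
  by rewrite indicE in_setU !mem_setE !in_itv.
have flat c : (\forall z \near x, u z = c) -> (x0 < x <= x1) || (x2 < x <= x3) = false ->
    scale_derive (F n) u x ^+ 2 = \1_slopes x * scale_derive (F n) family_scale x ^+ 2.
  by move=> uc sl; rewrite slopesE sl (near_cst_scale_derive xn uc) mul0r expr0n.
have near_scale : x0 < x < x3 ->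
    \forall z \near x, [/\ x0 < z < x3, z \in sitv (I' k) & family_scale z = s z].
  move=> xx; apply: near_between xx _ => z zz.
  have zz' : x0 <= z <= x3 by case/andP: zz => /ltW -> /ltW.
  split => //; first exact: sitvk.
  by rewrite (family_scaleE kI)//; exact: x03k.
have [xx0|x0x] := ltP x x0.
  apply: (flat 0); last by apply/negP => /orP[]; move: x01 x12 x23; lra.
  by apply: filterS (lt_nbhsl xx0) => z zx; apply: u_out; left.
have [x3x|xx3] := ltP x3 x.
  apply: (flat 0); last by apply/negP => /orP[]; move: x01 x12 x23; lra.
  by apply: filterS (lt_nbhsr x3x) => z zx; apply: u_out; right.
have {}x0x : x0 < x by rewrite lt_neqAle eq_sym n0.
have {}xx3 : x < x3 by rewrite lt_neqAle n3.
have nears := near_scale (introT andP (conj x0x xx3)).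
have [xx1|x1x] := leP x x1.
  have {}xx1 : x < x1 by rewrite lt_neqAle n1.
  rewrite slopesE x0x (ltW xx1) mul1r; congr (_ ^+ 2).
  apply: (near_subc_scale_derive (c := s x0) xn).
  apply: filterS2 nears (lt_nbhsl xx1) => z [zz zk ->] zx1.
  rewrite /u test_functionE// T_up// !scale_le// (ltW zx1).
  by case/andP: zz => /ltW ->.
have [xx2|x2x] := leP x x2.
  have {}xx2 : x < x2 by rewrite lt_neqAle n2.
  apply: (flat H); last by apply/negP => /orP[]; move: x01 x12 x23; lra.
  have x12x : x1 < x < x2 by rewrite x1x.
  apply: filterS2 nears (near_between x12x (fun z zz => zz)) => z [zz zk _] zx.
  by rewrite /u test_functionE// T_flat// !scale_le//; lra.
rewrite slopesE x2x (ltW xx3) orbT mul1r.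
rewrite (near_csub_scale_derive (c := s x3) (v := family_scale) xn) ?sqrrN//.
apply: filterS2 nears (lt_nbhsr x2x) => z [zz zk ->] x2z.
rewrite /u test_functionE// T_down// !scale_le// (ltW x2z).
by case/andP: zz => _ /ltW ->.
Qed.

Let measurable_slopes : measurable slopes.
Proof. by apply: measurableU; exact: measurable_itv. Qed.

Let integral_slopes (F : interval_family R) :
  trivIset (index F) (fun n => [set` sitv (F n)]) ->
  measurable_fun [set: borel] (family_derive F u : borel -> R) ->
  measurable_fun [set: borel] (fun x : borel => (family_derive F family_scale x) ^+ 2) ->
  (\int[scale_measure F]_x ((family_derive F u x) ^+ 2)%:E =
   \int[scale_measure F]_(x in slopes) ((family_derive F family_scale x) ^+ 2)%:E)%E.
Proof.
move=> disjF mu ms; rewrite [RHS]integral_mkcond; apply: ae_eq_integral => //.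
- by apply/measurable_EFinP; exact: measurable_funX.
- apply/(measurable_restrictT _ _).1 => //.
  by apply: measurable_funTS; exact/measurable_EFinP.
- exists [set` [:: x0; x1; x2; x3]]; split.
  + apply: countable_measurable; first by move=> t; exact: measurable_set1.
    exact/finite_set_countable/finite_seq.
  + by apply: scale_measure_countable; exact/finite_set_countable/finite_seq.
  + move=> x /= nx; apply: contrapT => /negP xx; apply: nx => _.
    rewrite derive_u// patchE indicE; case: ifPn => xs; first by rewrite mul1r.
    by rewrite mul0r.
Qed.

(** The two sides are twice the energies of the tent for the two forms. *)
Lemma speed_slopes :
  (speed_integral `]x0, x1]%classic + speed_integral `]x2, x3]%classic =
   dscale (I' k) `]x0, x1]%classic + dscale (I' k) `]x2, x3]%classic)%E.
Proof.
have [mu EE] := energy_transfer u_dom.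
have mu' := measurable_family_derive disjI' (fun n => measurable_member' u_dom).
have one x : inner_family I' x -> (family_derive I' family_scale x) ^+ 2 = 1.
  move=> [n nI xn]; rewrite (family_deriveE disjI' _ nI xn).
  rewrite (near_eq_scale_derive xn (near_family_scale nI xn)).
  by rewrite (scale_derive_scale xn) expr1n.
have m1 : measurable_fun [set: borel]
    (fun x : borel => (family_derive I' family_scale x) ^+ 2).
  apply: measurable_funX; apply: (measurable_family_derive disjI') => n nI.
  apply: measurable_scale_derive => x; rewrite inE => xn.
  rewrite /continuous_at (family_scaleE nI xn).
  apply: cvg_trans (continuous_scale xn); apply: near_eq_cvg.
  by apply: filterS (near_family_scale nI xn) => z ->.
move: EE; rewrite (integral_slopes disjI mu measurable_speed).
rewrite (integral_slopes disjI' mu' m1).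
have slopes_inner x : slopes x -> inner (I' k) x.
  by rewrite /slopes /= !in_itv/= => -[] xx; apply: x03k; move: x01 x12 x23; lra.
have -> : (\int[scale_measure I']_(x in slopes)
    ((family_derive I' family_scale x) ^+ 2)%:E =
    dscale (I' k) slopes)%E.
  rewrite -(scale_measure_sub disjI' kI); last by move=> x /slopes_inner/inner_subset.
  rewrite -[RHS]mul1e -integral_cst//; apply: eq_integral => x.
  rewrite inE => /slopes_inner xk.
  by rewrite one//; exists k.
have disj0 : `]x0, x1]%classic `&` `]x2, x3]%classic = set0 :> set borel.
  by rewrite -subset0 => x [] /=; rewrite !in_itv/=; move: x12; lra.
have m01 : measurable (`]x0, x1]%classic : set borel) by exact: measurable_itv.
have m23 : measurable (`]x2, x3]%classic : set borel) by exact: measurable_itv.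
rewrite /slopes (measureU (dscale (I' k)) m01 m23 disj0).
rewrite (ge0_integral_setU _ m01 m23)//.
- by apply/measurable_EFinP; apply: measurable_funTS; exact: measurable_speed.
- by move=> x _; rewrite lee_fin speed_ge0.
- exact/disj_set2P.
Qed.

End Tent.
End Speed.

(** * The density and its values *)

Section ScaleMeasureDensity.
Context {R : realType}.
Notation borel := (measurableTypeR R).
Variable m : {measure set borel -> \bar R}.
Hypothesis radon_m : radon m.
Hypothesis full_m : fully_supported m.
Variables I I' : interval_family R.
Hypothesis effI : effective_intervals I.
Hypothesis effI' : effective_intervals I'.
Hypothesis sub_dom : forall u, family_dom m I' u -> exists2 v, family_dom m I v &
  u = v %[ae m] /\ family_energy I v v = family_energy I' u u.

Let disjI : trivIset (index I) (fun n => [set` sitv (I n)]).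
Proof. by case: effI. Qed.
Let disjI' : trivIset (index I') (fun n => [set` sitv (I' n)]).
Proof. by case: effI'. Qed.

Lemma dscale_itvoc (J : scaled_interval R) x y : x \in sitv J -> y \in sitv J -> x <= y ->
  dscale J `]x, y]%classic = (scale J y - scale J x)%:E.
Proof.
move=> xJ yJ xy; rewrite -dscale_itv// -(setU1itv false (x := x)) ?bnd_simp//.
have -> : dscale J ([set x] `|` `]x, y]%classic) =
    (dscale J [set x] + dscale J `]x, y]%classic)%E.
  apply: (measureU (dscale J)); [exact: measurable_set1|exact: measurable_itv|].
  by rewrite -subset0 => z [->] /=; rewrite in_itv/= ltxx.
by rewrite (dscale_countable _ (finite_set_countable (finite_set1 x))) add0e.
Qed.

Let three_pairs (a b c : \bar R) (d : R) : (0 <= a)%E -> (0 <= b)%E -> (0 <= c)%E ->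
  (a + b = d%:E + d%:E)%E -> (b + c = d%:E + d%:E)%E -> (a + c = d%:E + d%:E)%E ->
  [/\ a = d%:E, b = d%:E & c = d%:E].
Proof.
case: a => [a| |] //; case: b => [b| |] //; case: c => [c| |] // _ _ _.
move=> [ab] [bc] [ac]; split; congr EFin; lra.
Qed.

Let f (x : borel) : \bar R := (speed I I' x)%:E.

Let mf : measurable_fun [set: borel] f.
Proof. apply/measurable_EFinP.
exact: (measurable_speed radon_m full_m disjI disjI' sub_dom).
Qed.

Let f0 x : (0 <= f x)%E. Proof. by rewrite lee_fin speed_ge0. Qed.

(** A tent only gives the sum of the masses of its two slopes. Cutting ]x, y] into
    three pieces of equal height along s', the three tents whose slopes are two of
    these pieces determine the mass of each piece. *)
Let speed_itvoc k x y : index I' k -> inner (I' k) x -> inner (I' k) y -> x <= y ->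
  (\int[scale_measure I]_(t in `]x, y]) f t = dscale (I' k) `]x, y]%classic)%E.
Proof.
move=> kI xk yk; rewrite le_eqVlt => /predU1P[->|xy].
  by rewrite set_itvoc0 integral_set0 measure0.
have xi := inner_subset xk; have yi := inner_subset yk.
pose s := scale (I' k); pose d := (s y - s x) / 3.
have sxy : s x < s y by rewrite scale_lt.
have d0 : 0 < d by rewrite divr_gt0// subr_gt0.
have between t : s x <= t <= s y -> exists2 z, x <= z <= y & s z = t.
  move=> st; have : (s @` `[x, y]) t by rewrite scale_image_segment ?ltW//= in_itv.
  by move=> [z]; rewrite /= in_itv => zxy <-; exists z.
have d3 : s y = s x + d + d + d by rewrite /d; field.
have [z1 z1xy sz1] := between (s x + d) ltac:(lra).
have [z2 z2xy sz2] := between (s x + d + d) ltac:(lra).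
have inxy z : x <= z <= y -> inner (I' k) z.
  by move=> zz; apply: (inner_segment xk yk); rewrite /= in_itv.
have z1k := inxy _ z1xy; have z2k := inxy _ z2xy.
have z1i := inner_subset z1k; have z2i := inner_subset z2k.
have xz1 : x < z1 by rewrite -(scale_lt xi z1i) -/s; lra.
have z12 : z1 < z2 by rewrite -(scale_lt z1i z2i) -/s; lra.
have z2y : z2 < y by rewrite -(scale_lt z2i yi) -/s; lra.
have slopes := speed_slopes radon_m full_m disjI disjI' sub_dom kI.
have sh1 : s z1 - s x = s z2 - s z1 by lra.
have sh2 : s z2 - s z1 = s y - s z2 by lra.
have sh3 : s z1 - s x = s y - s z2 by lra.
have h1 := slopes _ _ _ _ xk z2k xz1 (lexx z1) z12 sh1.
have h2 := slopes _ _ _ _ z1k yk z12 (lexx z2) z2y sh2.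
have h3 := slopes _ _ _ _ xk yk xz1 (ltW z12) z2y sh3.
have dd1 : dscale (I' k) `]x, z1]%classic = d%:E.
  by rewrite dscale_itvoc ?ltW//; congr EFin; rewrite -/s; lra.
have dd2 : dscale (I' k) `]z1, z2]%classic = d%:E.
  by rewrite dscale_itvoc ?ltW//; congr EFin; rewrite -/s; lra.
have dd3 : dscale (I' k) `]z2, y]%classic = d%:E.
  by rewrite dscale_itvoc ?ltW//; congr EFin; rewrite -/s; lra.
move: h1 h2 h3; rewrite dd1 dd2 dd3 => h1 h2 h3.
have pos (D : set borel) : (0 <= \int[scale_measure I]_(t in D) f t)%E.
  exact: integral_ge0.
have [i1 i2 i3] := three_pairs (pos _) (pos _) (pos _) h1 h2 h3.
have split_at a b c : a < b -> b < c ->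
    (\int[scale_measure I]_(t in `]a, c]) f t =
     \int[scale_measure I]_(t in `]a, b]) f t +
     \int[scale_measure I]_(t in `]b, c]) f t)%E.
  move=> ab bc.
  have -> : `]a, c]%classic = `]a, b]%classic `|` `]b, c]%classic :> set borel.
    by apply: itv_bndbnd_setU; rewrite bnd_simp ltW.
  have mab : measurable (`]a, b]%classic : set borel) by exact: measurable_itv.
  have mbc : measurable (`]b, c]%classic : set borel) by exact: measurable_itv.
  apply: (ge0_integral_setU _ mab mbc) => //.
  - exact: measurable_funTS.
  - apply/disj_setPS => z [] /=; rewrite !in_itv/= => /andP[_ zb] /andP[bz _].
    by rewrite ltNge zb in bz.
rewrite (split_at _ _ _ xz1 (lt_trans z12 z2y)) (split_at _ _ _ z12 z2y).
rewrite i1 i2 i3 dscale_itvoc ?(ltW xy)// -!EFinD; congr EFin.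
by rewrite -/s; lra.
Qed.

(** Both sides agree on the half-open subintervals of the interiors of the
    intervals of the second family, and neither charges the complement of these
    interiors. *)
Lemma scale_measure_speed (B : set borel) : measurable B ->
  scale_measure I' B = (\int[scale_measure I]_(x in B) (speed I I' x)%:E)%E.
Proof.
have [nu nuE] := density_measure (scale_measure I) mf f0.
move=> mB; rewrite -[RHS]nuE.
pose good (kpq : nat * rat * rat) := [/\ index I' kpq.1.1,
  inner (I' kpq.1.1) (ratr kpq.1.2) & inner (I' kpq.1.1) (ratr kpq.2)].
pose K kpq : set borel :=
  if `[< good kpq >] then `]ratr kpq.1.2, ratr kpq.2]%classic else set0.
apply: (eq_measure_countable_cover (K := K)) mB.
- by move=> kpq; rewrite /K; case: ifPn => // _; exact: measurable_itv.
- move=> [[k p] q] A mA; rewrite /K /=.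
  case: ifPn => [/asboolP[/= kI pk qk]|_]; last first.
    by rewrite subset0 => ->; rewrite !measure0.
  apply: eq_measure_on_itvoc => //.
    move=> x y px xy yq.
    have xk : inner (I' k) x.
      by apply: (inner_segment pk qk); rewrite /= in_itv /= px (le_trans xy).
    have yk : inner (I' k) y.
      by apply: (inner_segment pk qk); rewrite /= in_itv /= yq (le_trans px).
    rewrite nuE (speed_itvoc kI xk yk xy) (scale_measure_sub disjI' kI)//.
    move=> z /= zxy; apply: (sitv_segment (inner_subset xk) (inner_subset yk)).
    exact: subset_itv_oc_cc zxy.
  rewrite (scale_measure_sub disjI' kI); last first.
    move=> z /= zpq; apply: (sitv_segment (inner_subset pk) (inner_subset qk)).
    exact: subset_itv_oc_cc zpq.
  apply: le_lt_trans (dscale_segment_lty (inner_subset pk) (inner_subset qk)).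
  apply: le_measure; rewrite ?inE; [exact: measurable_itv|exact: measurable_itv|].
  by move=> z; exact: subset_itv_oc_cc.
- move=> A mA nA.
  have A' : A `<=` ~` inner_family I'.
    move=> x Ax [k kI xk].
    have [p [q [/andP[px xq] pqk]]] := near_rat_segment (near_inner xk).
    have pq := lt_trans px xq.
    apply: (nA (k, p, q) x Ax); rewrite /K /= ifT.
      by rewrite /= in_itv/= px ltW.
    by apply/asboolP; split => //=; apply: pqk; rewrite lexx ltW.
  have mI' := measurable_inner_family I'; have mI := measurable_inner_family I.
  have -> : scale_measure I' A = 0%E.
    apply/eqP; rewrite -measure_le0 -(scale_measure_not_inner I').
    by apply: le_measure; rewrite ?inE//; exact: measurableC.
  rewrite nuE; apply/esym/null_set_integral => //; first exact: measurable_funTS.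
  apply/eqP; rewrite -measure_le0 -(scale_measure_not_inner I).
  apply: le_measure; rewrite ?inE//; first exact: measurableC.
  move=> x /A'; apply: contra_not => -[n nI xn].
  have [k kI nk] := inner_inclusion radon_m full_m disjI' sub_dom nI.
  by exists k => //; exact: nk.
Qed.

Let dscale_speed n k x y : index I n -> index I' k -> inner (I n) `<=` inner (I' k) ->
  inner (I n) x -> inner (I n) y ->
  dscale (I' k) `[x, y]%classic = (\int[dscale (I n)]_(t in `[x, y]) f t)%E.
Proof.
move=> nI kI nk xn yn.
rewrite -(scale_measure_sub disjI' kI); last first.
  by apply: sitv_segment; apply: inner_subset; exact: nk.
rewrite scale_measure_speed; last exact: measurable_itv.
apply: integral_scale_measure_sub => //.
by apply: sitv_segment; exact: inner_subset.
Qed.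

(** The density is by definition the square of ds'/ds; but, being a density, it is
    also ds'/ds itself by Lebesgue's differentiation theorem. *)
Lemma ae_speed01 : {ae scale_measure I, forall x, speed I I' x = 0 \/ speed I I' x = 1}.
Proof.
apply: ae_dscale_scale_measure => // n nI.
have [k kI nk] := inner_inclusion radon_m full_m disjI' sub_dom nI.
have ms := measurable_speed radon_m full_m disjI disjI' sub_dom.
have := is_derive_density nk ms (speed_ge0 I I')
  (fun x y => dscale_speed nI kI nk (x := x) (y := y)).
apply: ae_sub => x dx xn; have xk := nk _ xn.
have speedE : speed I I' x = scale_derive (I n) (family_scale I') x ^+ 2.
  by rewrite /speed (family_deriveE disjI _ nI xn).
have pE : scale_derive (I n) (family_scale I') x = speed I I' x.
  rewrite (near_eq_scale_derive xn (near_family_scale disjI' kI xk)).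
  exact: is_derive1_derive1 (dx xn).
move: speedE; rewrite pE => /eqP.
rewrite expr2 -[X in X == _]mulr1 -subr_eq0 -mulrBr mulf_eq0 subr_eq0.
by move=> /orP[/eqP->|/eqP <-]; [left|right].
Qed.

Let scale_contraction n k x y : index I n -> index I' k ->
  inner (I n) `<=` inner (I' k) -> inner (I n) x -> inner (I n) y -> x <= y ->
  scale (I' k) y - scale (I' k) x <= scale (I n) y - scale (I n) x.
Proof.
move=> nI kI nk xn yn xy.
have xi := inner_subset xn; have yi := inner_subset yn.
rewrite -lee_fin -!dscale_itv//; try by apply: inner_subset; exact: nk.
have mxy : measurable (`[x, y]%classic : set borel) by exact: measurable_itv.
rewrite (dscale_speed nI kI nk xn yn) -[leRHS]mul1e -(integral_cst (dscale (I n)) mxy).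
apply: ae_ge0_le_integral => //.
- exact: measurable_funTS.
- apply: ae_sub (ae_scale_measure_dscale nI ae_speed01) => z z01 _.
  by rewrite /f lee_fin; case: z01 => ->.
Qed.

(** Only the endpoints of I_n are at stake. Since ds' <= ds inside I_n, the scale
    s' has a finite limit at an endpoint of I_n where s has one, and adaptedness
    puts this endpoint in the interval of the second family. *)
Lemma necessarily_coarser : coarser I' I.
Proof.
move=> n nI; have [k kI nk] := inner_inclusion radon_m full_m disjI' sub_dom nI.
exists k => // x xJ; apply: contrapT => xk.
have [y [z [yz yn zn]]] := inner_nonempty (I n).
have yJ := inner_subset yn; have zJ := inner_subset zn.
have yk := nk _ yn; have zk := nk _ zn.
have [adl adr] := (effI'.2 k kI).
have xNn : ~ inner (I n) x by move=> /nk/inner_subset.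
have [xy|yx] := leP x y.
- have {}xy : x < y.
    by rewrite lt_neqAle xy andbT; apply/eqP => xy'; apply: xNn; rewrite xy'.
  have inn t : x < t <= y -> inner (I n) t.
    move=> /andP[xt ty]; apply: (inner_between xJ zJ).
    by rewrite xt (le_lt_trans ty).
  have lendE : lend (I' k) = x%:E.
    by apply: (lend_eq xk xy) => t /inn/nk/inner_subset.
  have /scale_lend_gtNy sl : exists c, forall t, inner (I' k) t -> c <= scale (I' k) t.
    exists (scale (I' k) y - (scale (I n) y - scale (I n) x)) => t tk.
    have ti := inner_subset tk; have yi := inner_subset yk.
    have sxy : scale (I n) x <= scale (I n) y by rewrite scale_le// ltW.
    have [yt|ty] := leP y t.
      have : scale (I' k) y <= scale (I' k) t by rewrite scale_le.
      lra.
    have xt : x < t.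
      rewrite lt_neqAle -[x <= t]lee_fin -lendE lend_le// andbT.
      by apply/eqP => xt; apply: xk; rewrite xt.
    have tn : inner (I n) t by apply: inn; rewrite xt ltW.
    have := scale_contraction nI kI nk tn yn (ltW ty).
    have : scale (I n) x <= scale (I n) t.
      by rewrite scale_le// ?(ltW xt)//; exact: inner_subset.
    lra.
  have /adl : (-oo < lend (I' k) + scale_lend (I' k))%E.
    by move: sl; rewrite lendE; case: (scale_lend (I' k)) => [r| |] //= _; rewrite ltNyr.
  by rewrite lendE => -[t tk [tx]]; apply: xk; rewrite -tx.
- have inn t : y <= t < x -> inner (I n) t.
    have [w [wy wn]] : exists w, w < y /\ w \in sitv (I n).
      by have [a [_ [aJ _ /andP[ay _]]]] := (innerP _ _).1 yn; exists a.
    move=> /andP[yt tx]; apply: (inner_between wn xJ).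
    by rewrite tx (lt_le_trans wy).
  have rendE : rend (I' k) = x%:E.
    by apply: (rend_eq xk yx) => t /inn/nk/inner_subset.
  have /scale_rend_lty sr : exists c, forall t, inner (I' k) t -> scale (I' k) t <= c.
    exists (scale (I' k) y + (scale (I n) x - scale (I n) y)) => t tk.
    have ti := inner_subset tk; have yi := inner_subset yk.
    have sxy : scale (I n) y <= scale (I n) x by rewrite scale_le// ltW.
    have [ty|yt] := leP t y.
      have : scale (I' k) t <= scale (I' k) y by rewrite scale_le.
      lra.
    have tx : t < x.
      rewrite lt_neqAle -[t <= x]lee_fin -rendE rend_ge// andbT.
      by apply/eqP => xt; apply: xk; rewrite -xt.
    have tn : inner (I n) t by apply: inn; rewrite tx ltW.
    have := scale_contraction nI kI nk yn tn (ltW yt).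
    have : scale (I n) t <= scale (I n) x.
      by rewrite scale_le// ?(ltW tx)//; exact: inner_subset.
    lra.
  have /adr : (rend (I' k) + scale_rend (I' k) < +oo)%E.
    by move: sr; rewrite rendE; case: (scale_rend (I' k)) => [r| |] //= _; rewrite ltry.
  by rewrite rendE => -[t tk [tx]]; apply: xk; rewrite -tx.
Qed.

End ScaleMeasureDensity.

(** * Characterization of D-subspaces *)

Theorem theorem3p1 (R : realType)
    (m : {measure set (measurableTypeR R) -> \bar R})
    (E E' : quad_form R) (I I' : interval_family R) :
  radon m -> fully_supported m ->
  regular_dirichlet_form m E -> strongly_local m E ->
  regular_dirichlet_form m E' -> strongly_local m E' ->
  effective_intervals I -> represents m I E ->
  effective_intervals I' -> represents m I' E' ->
  D_subspace m E' E <->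
  (coarser I' I /\
   (scale_measure I' `<< scale_measure I /\
    exists2 f, radon_nikodym_derivative (scale_measure I') (scale_measure I) f &
      {ae scale_measure I, forall x, f x = 0%E \/ f x = 1%E})).
Proof.
move=> radon_m full_m rE _ rE' _ effI repE effI' repE'.
have [disjI _] := effI; have [disjI' _] := effI'.
rewrite (D_subspace_family rE rE' repE repE').
split=> [sub_dom|[coarse [_ [f fRN f01]]]].
  have mspeed := measurable_speed radon_m full_m disjI disjI' sub_dom.
  have speedE := scale_measure_speed radon_m full_m effI effI' sub_dom.
  have mf : measurable_fun setT (fun x : measurableTypeR R => (speed I I' x)%:E).
    exact/measurable_EFinP.
  split; first exact: (necessarily_coarser radon_m full_m effI effI' sub_dom).
  split.
    move=> N nullN A mA AN; rewrite speedE//.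
    apply: null_set_integral => //; first exact: measurable_funTS.
    exact: nullN.
  exists (fun x => (speed I I' x)%:E).
    split; [exact: mf| |by move=> A mA; exact: speedE].
    by move=> x; rewrite lee_fin speed_ge0.
  apply: (@ae_sub _ _ (fun x => speed I I' x = 0 \/ speed I I' x = 1)).
    by move=> x [->|->]; [left|right].
  exact: (ae_speed01 radon_m full_m effI effI' sub_dom).
have [A mA densA] := zero_one_density fRN f01.
move=> u uI'; exists u; first exact: (family_dom_density disjI disjI' coarse mA densA).
split; first exact: aeW.
exact: (family_energy_density disjI disjI' coarse mA densA uI').
Qed.
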